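(* Let $d\ge2$, let $p\in S^d$, and let $\mu$ be a probability measure on the unit sphere $S^d$ of the form $d\mu(q)=f(\mathbf{d}(p,q))\,dV(q)$. Let $F(x)=\int_{S^d}\frac12\mathbf{d}^2(y,x)\,d\mu(y)$ be its Fréchet function, let $\mathcal{C}_p$ be the cut locus (antipode) of $p$, and let $\alpha_d=\frac{V(S^{d-1})}{d}\int_0^\pi f(\varphi)\,d(\varphi\sin^{d-1}\varphi)$. Then: 1. If the density is bounded on the ball $B_\epsilon(\mathcal{C}_p)$ for some $\epsilon>0$ and $\alpha_d>0$, then $p$ is a local minimum of $F$. 2. If $d<4$, the density vanishes on $B_\epsilon(\mathcal{C}_p)$ for some $\epsilon>0$, and $\alpha_d=0$, then $p$ is a local maximum of $F$.
   Context: $S^d$ carries its standard round metric; $\mathbf{d}$ is the great-circle distance, $dV$ the volume element, $V(S^k)$ the volume of the $k$-dimensional unit sphere; $B_\epsilon(\mathcal{C}_p)$ is the ball of radius $\epsilon$ centered at $\mathcal{C}_p$. The notation $\int_0^\pi f(\varphi)\,d(g(\varphi))$ means $\int_0^\pi f(\varphi)g'(\varphi)\,d\varphi$. *)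

(* Defs.v *)
From HB Require Import structures.
From mathcomp Require Import all_boot all_order all_algebra.
From mathcomp Require Import all_classical all_reals all_analysis.
From mathcomp Require Import perm measurable_realfun.

Set Implicit Arguments.
Unset Strict Implicit.
Unset Printing Implicit Defensive.
Import Order.TTheory GRing.Theory Num.Theory.
Import numFieldNormedType.Exports.

Local Open Scope classical_set_scope.
Local Open Scope ring_scope.

(* Vectors of R^n are n-tuples of reals: these carry the product sigma-algebra,
   which on R^n is the Borel sigma-algebra. *)
Definition dotp (R : realType) (n : nat) (x y : n.-tuple R) : R :=
  \sum_(i < n) tnth x i * tnth y i.

Definition cons_pair (R : realType) (n : nat) (xt : R * n.-tuple R) :
  n.+1.-tuple R := [tuple of xt.1 :: xt.2].

Lemma measurable_cons_pair (R : realType) (n : nat) :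
  measurable_fun setT (@cons_pair R n).
Proof. exact: measurable_cons. Qed.

Lemma measurable_inv (R : realType) : measurable_fun setT (@GRing.inv R).
Proof.
rewrite (_ : @GRing.inv R = fun x => x * (x * x) `^ (-1)); last first.
  apply/funext => x; rewrite powR_inv1 -?expr2 ?sqr_ge0//.
  have [->|x0] := eqVneq x 0; first by rewrite invr0 mul0r.
  by rewrite expr2 invfM mulrA divff// mul1r.
apply: measurable_funM => //.
apply: (measurableT_comp (measurable_powR _)).
exact: measurable_funM.
Qed.

Lemma measurable_sqrt (R : realType) : measurable_fun setT (@Num.sqrt R).
Proof. by apply: continuous_measurable_fun; exact: sqrt_continuous. Qed.

Section lebesgue_cons.
Context (R : realType) (n : nat).
Variable mu : {sigma_finite_measure set (n.-tuple R) -> \bar R}.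
Local Open Scope ereal_scope.

Definition lebesgue_cons : set (n.+1.-tuple R) -> \bar R :=
  pushforward (@lebesgue_measure R \x mu) (@cons_pair R n).

Let lebesgue_cons0 : lebesgue_cons set0 = 0.
Proof. by rewrite /lebesgue_cons /pushforward preimage_set0 measure0. Qed.

Let lebesgue_cons_ge0 A : 0 <= lebesgue_cons A.
Proof. by rewrite /lebesgue_cons /pushforward; exact: measure_ge0. Qed.

Let lebesgue_cons_sigma_additive : semi_sigma_additive lebesgue_cons.
Proof.
have mcons := @measurable_cons_pair R n.
move=> F mF tF mUF; rewrite /lebesgue_cons /pushforward preimage_bigcup.
apply: measure_semi_sigma_additive.
- by move=> k; rewrite -[X in measurable X]setTI; exact: mcons.
- apply/trivIsetP => /= i j _ _ ij; rewrite -preimage_setI.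
  by move/trivIsetP : tF => /(_ _ _ _ _ ij) ->//; rewrite preimage_set0.
- by rewrite -preimage_bigcup -[X in measurable X]setTI; exact: mcons.
Qed.

HB.instance Definition _ := isMeasure.Build _ _ _ lebesgue_cons
  lebesgue_cons0 lebesgue_cons_ge0 lebesgue_cons_sigma_additive.

Let lebesgue_cons_sigma_finite : sigma_finite setT lebesgue_cons.
Proof.
pose g (t : n.+1.-tuple R) := (tnth t ord0, [tuple of behead t]).
have mg : measurable_fun setT g.
  apply/measurable_fun_pairP; split; first exact: measurable_tnth.
  exact: measurable_behead.
have gK : cancel (@cons_pair R n) g.
  by move=> [x t]; congr pair; apply: val_inj.
have /sigma_finiteP[F [TF ndF Foo]] := sigma_finiteT (@lebesgue_measure R).
have /sigma_finiteP[G [TG ndG Goo]] := sigma_finiteT mu.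
have FGT : \bigcup_k (F k `*` G k) = setT.
  rewrite -setXTT TF TG predeqE => -[x y]; split.
    by move=> [k _ []/= ? ?]; split; exists k.
  move=> [/= [i _ Fix] [k _ Gky]]; exists (maxn i k) => //; split.
  - by move: x Fix; exact/subsetPset/ndF/leq_maxl.
  - by move: y Gky; exact/subsetPset/ndG/leq_maxr.
exists (fun k => g @^-1` (F k `*` G k)).
  by rewrite -preimage_bigcup FGT.
move=> k; have [mFk Fk] := Foo k; have [mGk Gk] := Goo k; split.
  by rewrite -[X in measurable X]setTI; apply: mg => //; exact: measurableX.
rewrite /lebesgue_cons /pushforward -comp_preimage.
rewrite (_ : g \o _ = id); last by apply/funext => x; exact: gK.
by rewrite preimage_id product_measure1E// lte_mul_pinfty// ge0_fin_numE.
Qed.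

HB.instance Definition _ := Measure_isSigmaFinite.Build _ _ _ lebesgue_cons
  lebesgue_cons_sigma_finite.

End lebesgue_cons.

(* Lebesgue measure on R^n, as the n-fold product of [lebesgue_measure]; on R^0
   it is the unit mass at the only point. *)
Fixpoint lebesgue_tuple (R : realType) (n : nat) :
    {sigma_finite_measure set (n.-tuple R) -> \bar R} :=
  match n with
  | 0 => \d_([tuple] : 0.-tuple R)
  | m.+1 => lebesgue_cons (lebesgue_tuple R m)
  end.

(* [sphere R n] is the n-dimensional unit sphere S^n in R^(n+1), with the Borel
   sigma-algebra inherited from R^(n+1). *)
Definition on_sphere (R : realType) (n : nat) (q : n.+1.-tuple R) : bool :=
  dotp q q == 1.

Definition sphere (R : realType) (n : nat) : Type :=
  {q : n.+1.-tuple R | on_sphere q}.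

Section sphere.
Context (R : realType) (n : nat).

HB.instance Definition _ := SubChoice.on (sphere R n).

Definition north_tuple : n.+1.-tuple R := [tuple of 1 :: nseq n 0].

Lemma north_on_sphere : on_sphere north_tuple.
Proof.
rewrite /on_sphere /dotp big_ord_recl big1 ?addr0 ?tnth0 ?mulr1// => i _.
by rewrite tnthS tnth_nseq mulr0.
Qed.

HB.instance Definition _ := isPointed.Build (sphere R n)
  (Sub north_tuple north_on_sphere).

HB.instance Definition _ := Measurable.copy (sphere R n)
  (g_sigma_algebra_preimageType (\val : sphere R n -> n.+1.-tuple R)).

Definition sdist (p q : sphere R n) : R := acos (dotp (\val p) (\val q)).

Lemma antipode_on_sphere (p : sphere R n) :
  on_sphere [tuple of map -%R (\val p)].
Proof.
have /eqP hp : on_sphere (\val p) := valP p.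
apply/eqP; rewrite -[RHS]hp; apply: eq_bigr => i _.
by rewrite !tnth_map mulrNN.
Qed.

(* The cut locus of [p] on the round sphere is the single point [antipode p]. *)
Definition antipode (p : sphere R n) : sphere R n :=
  Sub [tuple of map -%R (\val p)] (antipode_on_sphere p).

Definition sball (c : sphere R n) (eps : R) : set (sphere R n) :=
  [set q | sdist c q < eps].

(* The Riemannian volume of the round metric is computed in the two charts
   given by the open hemispheres q_0 > 0 (s = false) and q_0 < 0 (s = true) and
   the projection [proj] onto the last n coordinates; they cover the sphere up
   to the equator q_0 = 0, which is negligible.  The inverse charts are
   x |-> (z(x), x) with z(x) = +- sqrt (1 - |x|^2), whose partial derivatives
   (- x_i / z, e_i) have as Gram matrix the round metric in these coordinates,
     g_ij(x) = delta_ij + x_i x_j / (1 - |x|^2),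
   and the volume of A is the integral of sqrt (det g) over the images of A
   under the charts. *)
Definition hemisphere (s : bool) : set (sphere R n) :=
  [set q | 0 < (-1) ^+ s * tnth (\val q) ord0].

Definition proj (q : sphere R n) : n.-tuple R := [tuple of behead (\val q)].

Definition metric_mx (x : n.-tuple R) : 'M[R]_n :=
  \matrix_(i, j) ((i == j)%:R + tnth x i * tnth x j / (1 - dotp x x)).


Definition hemisphere_volume (s : bool) (A : set (sphere R n)) : \bar R :=
  (\int[lebesgue_tuple R n]_(x in proj @` (A `&` hemisphere s))
     (Num.sqrt (\det (metric_mx x)))%:E)%E.

Lemma measurable_dotp : measurable_fun setT (fun x : n.-tuple R => dotp x x).
Proof.
rewrite /dotp; apply: measurable_sum => i.
by apply: measurable_funM; exact: measurable_tnth.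
Qed.

Lemma measurable_volume_density :
  measurable_fun setT (fun x : n.-tuple R => Num.sqrt (\det (metric_mx x))).
Proof.
apply: (measurableT_comp (@measurable_sqrt R)); rewrite /determinant.
apply: measurable_sum => sg; apply: measurable_funM => //.
apply: measurable_prod => i _.
rewrite (_ : (fun _ => _) = fun x : n.-tuple R => (i == sg i)%:R
    + tnth x i * tnth x (sg i) * (1 - dotp x x)^-1); last first.
  by apply/funext => x; rewrite mxE.
apply: measurable_funD => //; apply: measurable_funM.
  by apply: measurable_funM; exact: measurable_tnth.
apply: (measurableT_comp (@measurable_inv R)).
by apply: measurable_funB => //; exact: measurable_dotp.
Qed.

Lemma proj_dotp (q : sphere R n) :
  tnth (\val q) ord0 ^+ 2 = 1 - dotp (proj q) (proj q).
Proof.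
have /eqP hq : on_sphere (\val q) := valP q.
apply: (addIr (dotp (proj q) (proj q))); rewrite subrK -[RHS]hq.
rewrite [RHS]/dotp big_ord_recl -expr2; congr +%R.
by apply: eq_bigr => i _; rewrite [\val q]tuple_eta !tnthS.
Qed.

Lemma hemisphere_height (s : bool) (q : sphere R n) : hemisphere s q ->
  tnth (\val q) ord0 = (-1) ^+ s * Num.sqrt (1 - dotp (proj q) (proj q)).
Proof.
rewrite /hemisphere/= -proj_dotp sqrtr_sqr.
case: s; rewrite ?expr0 ?expr1 ?mul1r ?mulN1r.
  by rewrite oppr_gt0 => q0; rewrite ltr0_norm// opprK.
by move=> q0; rewrite gtr0_norm.
Qed.

Lemma sphere_eq (q : sphere R n) :
  \val q = [tuple of tnth (\val q) ord0 :: proj q].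
Proof. by rewrite {1}[\val q]tuple_eta; apply: val_inj. Qed.

Lemma proj_inj (s : bool) (q r : sphere R n) :
  hemisphere s q -> hemisphere s r -> proj q = proj r -> q = r.
Proof.
move=> sq sr qr; apply: val_inj; rewrite [LHS]sphere_eq [RHS]sphere_eq.
by rewrite (hemisphere_height sq) (hemisphere_height sr) qr.
Qed.

Lemma measurable_proj_hemisphere (s : bool) (A : set (sphere R n)) :
  measurable A -> measurable (proj @` (A `&` hemisphere s)).
Proof.
case=> B mB <-{A}; rewrite setTI.
pose h (x : n.-tuple R) : R := (-1) ^+ s * Num.sqrt (1 - dotp x x).
pose g (x : n.-tuple R) := cons_pair (h x, x).
have mh : measurable_fun setT h.
  apply: measurable_funM => //; apply: (measurableT_comp (@measurable_sqrt R)).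
  by apply: measurable_funB => //; exact: measurable_dotp.
have mg : measurable_fun setT g.
  by apply: (measurable_cons mh); exact: measurable_id.
rewrite (_ : _ @` _ = [set x | dotp x x < 1] `&` g @^-1` B); last first.
  apply/seteqP; split => [_ [q [Bq sq] <-]|x [/= x1 Bx]].
    split => /=.
      rewrite -subr_gt0 -proj_dotp exprn_even_gt0//=.
      by apply/eqP => q0; move: sq; rewrite /hemisphere/= q0 mulr0 ltxx.
    rewrite (_ : g (proj q) = \val q)// /g /h -(hemisphere_height sq).
    exact/esym/sphere_eq.
  have gS : on_sphere (g x).
    rewrite /on_sphere /dotp big_ord_recl tnth0 /h.
    under eq_bigr do rewrite !tnthS.
    by rewrite mulrACA -expr2 -expr2 sqrr_sign mul1r sqr_sqrtr ?subrK// subr_ge0 ltW.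
  exists (Sub (g x) gS : sphere R n); last first.
    by apply: val_inj.
  split; first by [].
  rewrite /hemisphere/= tnth0 /h mulrA -expr2 sqrr_sign mul1r.
  by rewrite sqrtr_gt0 subr_gt0.
apply: measurableI.
  rewrite (_ : [set x | _] = setT `&` (fun x => dotp x x) @^-1` `]-oo, 1[).
    exact: (measurable_dotp measurableT (measurable_itv _)).
  by rewrite setTI; apply/seteqP; split => x /=; rewrite in_itv.
by rewrite -[X in measurable X]setTI; exact: mg.
Qed.

Let hemisphere_volume0 s : hemisphere_volume s set0 = 0%E.
Proof. by rewrite /hemisphere_volume set0I image_set0 integral_set0. Qed.

Let hemisphere_volume_ge0 s A : (0 <= hemisphere_volume s A)%E.
Proof. by apply: integral_ge0 => x _; rewrite lee_fin sqrtr_ge0. Qed.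

Let hemisphere_volume_sigma_additive s :
  semi_sigma_additive (hemisphere_volume s).
Proof.
move=> F mF tF mUF; rewrite /hemisphere_volume setI_bigcupl image_bigcup.
apply: (@semi_sigma_additive_nng_induced _ _ _ _
  (fun x => (Num.sqrt (\det (metric_mx x)))%:E)).
- by apply/measurable_EFinP; exact: measurable_volume_density.
- by move=> x; rewrite lee_fin sqrtr_ge0.
- by move=> k; exact: measurable_proj_hemisphere.
- move=> i j _ _ [_ [[q [Fq sq] <-] [r [Fr sr]]]] /(proj_inj sr sq) rq.
  by apply: (tF i j) => //; exists q; split=> //; rewrite -rq.
- by rewrite -image_bigcup -setI_bigcupl; exact: measurable_proj_hemisphere.
Qed.

HB.instance Definition _ s := isMeasure.Build _ _ _ (hemisphere_volume s)
  (hemisphere_volume0 s) (hemisphere_volume_ge0 s)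
  (hemisphere_volume_sigma_additive (s := s)).

Definition sphere_volume : {measure set (sphere R n) -> \bar R} :=
  measure_add (hemisphere_volume false) (hemisphere_volume true).

End sphere.

Section frechet.
Context (R : realType) (n : nat).
Local Open Scope ring_scope.

Definition frechet (mu : probability (sphere R n) R) (x : sphere R n) : R :=
  \int[mu]_y (2^-1 * sdist y x ^+ 2).

Definition local_minimum (F : sphere R n -> R) (p : sphere R n) : Prop :=
  exists2 r : R, 0 < r & forall x, sball p r x -> F p <= F x.

Definition local_maximum (F : sphere R n -> R) (p : sphere R n) : Prop :=
  exists2 r : R, 0 < r & forall x, sball p r x -> F x <= F p.

(* The constant alpha_n attached to the radial density f on S^n. *)
Definition alpha (f : R -> R) : R :=
  fine (sphere_volume R n.-1 [set: sphere R n.-1]) / n%:R *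
  \int[lebesgue_measure]_(phi in `[0, pi])
    (f phi * derive1 (fun t : R => t * sin t ^+ n.-1) phi).

End frechet.
Arguments alpha {R} n f.

(* Main.v *)
(* Write Phi(t) for the value of F at distance t from p; it equals the integral
   of k(<x, q>) with k(cos phi) = phi^2 / 2, x at distance t.  The Laplacian of
   q |-> k(<x, q>) is 1 + (d - 1) phi cot phi, and in polar coordinates the
   integral of 1 + (d - 1) phi cot phi against mu is a positive multiple of
   alpha_d.  Laplacians are limits of symmetric second differences along the d
   geodesics of an orthonormal frame, and a Fatou argument bounds the integral
   of the limit by the lower limit of the integrals.

   Part 1: if Phi(t_n) < Phi(0) with t_n -> 0, all second differences at p are
   negative, so the integral of the Laplacian is <= 0 and alpha_d <= 0; the
   minorant pi / sin phi near the antipode is integrable as f is bounded there.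

   Part 2: let H(t) be the integral of 1 + (d - 1) phi cot phi for x at distance
   t, so that H(0) = 0.  For d < 4 the Laplacian of phi cot phi is <= -(d - 1),
   so H < 0 at small t > 0.  If Phi(t) > Phi(0) for some small t, then Phi minus
   a linear function has an interior minimum, where H >= 0: a contradiction. *)

Require Import Defs.
From HB Require Import structures.
From mathcomp Require Import all_boot all_order all_algebra.
From mathcomp Require Import all_classical all_reals all_analysis.
From mathcomp Require Import measurable_realfun ring lra.

Set Implicit Arguments.
Unset Strict Implicit.
Unset Printing Implicit Defensive.
Import Order.TTheory GRing.Theory Num.Theory.
Import numFieldNormedType.Exports.

Local Open Scope classical_set_scope.
Local Open Scope ring_scope.

(** * Integration on the sphere *)

(** The volume is defined through hemisphere charts, so its invariance under isometries is not
    visible and has to be proved: the charts turn it into the cone measure of Lebesgue measure on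
    the ball, and the isometries in use are products of reflections and plane rotations, the latter
    products of shears. Invariance carries [mu] to a model measure [sigma] with the same radial
    density around the north pole, where [meridian t] is an explicit point at distance t, and it
    makes a mean over the sphere depend on the distance to the pole only. Differentiation under the
    integral sign is avoided: the Laplacian of half the squared distance tends to - oo at the
    antipode, where mass may sit. One-sided bounds suffice for Fatou, which is applied three times:
    to half the squared distance at the pole and at an interior minimum, and to phi cot phi at the
    pole. A single second difference has a limit that depends on its direction; only the sum over an
    orthonormal frame depends on u = <x, q> alone. In the code m = d - 1. *)

Section transfer.
Local Open Scope ereal_scope.
Context d1 d2 (X : measurableType d1) (Y : measurableType d2) (R : realType).
Variables (mu : {measure set X -> \bar R}) (nu : {measure set Y -> \bar R}).
Variables (phi : X -> Y) (g : X -> R).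
Hypotheses (mphi : measurable_fun setT phi) (mg : measurable_fun setT g).
Hypothesis g0 : forall x, (0 <= g x)%R.
Hypothesis nuE : forall A, measurable A ->
  nu A = \int[mu]_x (g x * \1_A (phi x))%:E.

Import HBNNSimple.

(** Both sides agree on indicators by hypothesis, hence on simple functions, hence in the limit by
    monotone convergence. Charts, affine maps, densities and weighted push-forwards are all
    instances. *)
Lemma ge0_integral_transfer (f : Y -> \bar R) :
  measurable_fun setT f -> (forall y, 0 <= f y) ->
  \int[nu]_y f y = \int[mu]_x ((g x)%:E * f (phi x)).
Proof.
move=> mf f0; pose f_ := nnsfun_approx measurableT mf.
transitivity (limn (fun n => \int[nu]_y (f_ n y)%:E)).
  rewrite -monotone_convergence//.
  - apply: eq_integral => y _; apply/esym/cvg_lim => //.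
    exact: cvg_nnsfun_approx.
  - by move=> n; exact/measurable_EFinP/measurable_funP.
  - by move=> n y _; rewrite lee_fin.
  - by move=> y _ m n mn; rewrite lee_fin; exact/lefP/nd_nnsfun_approx.
have mfn n : measurable_fun setT (fun x => (g x * f_ n (phi x))%:E).
  by apply/measurable_EFinP; apply: measurable_funM => //; apply: measurableT_comp.
rewrite [X in limn X](_ : _ =
    (fun n => \int[mu]_x (g x * f_ n (phi x))%:E)).
  rewrite -monotone_convergence//.
  - apply: eq_integral => x _; apply/cvg_lim => //.
    under eq_fun do rewrite EFinM.
    by apply: cvgeZl => //; exact: cvg_nnsfun_approx.
  - by move=> n x _; rewrite lee_fin mulr_ge0.
  - move=> x _ m n mn; rewrite lee_fin ler_wpM2l//.
    exact/lefP/nd_nnsfun_approx.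
apply/funext => n.
have mI r : measurable (f_ n @^-1` [set r]) by [].
transitivity (\sum_(r \in range (f_ n)) r%:E * nu (f_ n @^-1` [set r])).
  by rewrite -sintegralE -integralT_nnsfun.
transitivity (\int[mu]_x \sum_(r \in range (f_ n))
    (r * (g x * \1_(f_ n @^-1` [set r]) (phi x)))%:E); last first.
  apply: eq_integral => x _; rewrite fsumEFin// [in RHS]fimfunE.
  rewrite mulr_fsumr//; congr (_%:E); apply: eq_fsbigr => r _.
  by rewrite mulrCA.
have mh r : measurable_fun setT (fun x => g x * \1_(f_ n @^-1` [set r]) (phi x))%R.
  by apply: measurable_funM => //; apply: measurableT_comp.
rewrite ge0_integral_fsum//; last 2 first.
- by move=> r; apply/measurable_EFinP; exact: measurable_funM.
- move=> r x _; rewrite mulrCA lee_fin mulr_ge0//.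
  exact: nnfun_muleindic_ge0.
apply: eq_fsbigr => r /[!inE] -[y _ <-]; rewrite nuE//.
rewrite -ge0_integralZl//.
- exact/measurable_EFinP.
- by move=> x _; rewrite lee_fin mulr_ge0.
- by rewrite lee_fin.
Qed.
End transfer.

(** * Affine substitution on the line *)

Section real_line.
Local Open Scope ereal_scope.
Context (R : realType).
Notation mu := (@lebesgue_measure R).

Lemma measurable_affine (a b : R) :
  measurable_fun setT ((fun x => a * x + b)%R : measurableTypeR R -> measurableTypeR R).
Proof.
by apply: measurable_funD => //; exact: measurable_funM.
Qed.

(** Uniqueness of Lebesgue measure: [|a|] times the push-forward gives the intervals []c, d]] their
    length. For a < 0 the preimage is closed on the left instead, which does not affect the
    length. *)
Lemma lebesgue_measure_affine (a b : R) (A : set R) : a != 0%R -> measurable A ->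
  mu A = `|a|%:E * mu ((fun x => a * x + b)%R @^-1` A).
Proof.
move=> a0 mA.
apply: (@lebesgue_measure_unique R (mscale (NngNum (normr_ge0 a)) (pushforward mu ((fun x => a * x + b)%R : measurableTypeR R -> measurableTypeR R)))) => //.
  exact: measurable_affine.
move=> ? _ [[c d]] _ <- /=.
change (mu `]c, d] = `|a|%:E * mu ((fun x => a * x + b)%R @^-1` `]c, d])).
have [a_gt0|a_lt0|aE] := ltgtP 0%R a; last by rewrite -aE eqxx in a0.
- rewrite (_ : _ @^-1` _ = `]((c - b) / a)%R, ((d - b) / a)%R]%classic).
    rewrite !lebesgue_measure_itv/= !lte_fin ltr_pM2r ?invr_gt0// ltrD2r.
    case: ifPn => cd; last by rewrite mule0.
    rewrite gtr0_norm// -EFinB -EFinM -mulrBl mulrC divfK//.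
    by rewrite opprB addrA subrK.
  apply/seteqP; split => x /=; rewrite !in_itv/= ltr_pdivrMr// ler_pdivlMr//.
    by rewrite ltrBlDr lerBrDr mulrC.
  by rewrite ltrBlDr lerBrDr mulrC.
- rewrite (_ : _ @^-1` _ = `[((d - b) / a)%R, ((c - b) / a)%R[%classic).
    rewrite !lebesgue_measure_itv/= !lte_fin ltr_nM2r ?invr_lt0// ltrD2r.
    case: ifPn => cd; last by rewrite mule0.
    rewrite ltr0_norm// -EFinB -EFinM -mulrBl mulrC mulrN divfK ?lt_eqF//.
    by congr EFin; ring.
  apply/seteqP; split => x /=; rewrite !in_itv/= ltr_ndivlMr// ler_ndivrMr//.
    by rewrite ltrBlDr lerBrDr mulrC andbC.
  by rewrite ltrBlDr lerBrDr mulrC andbC.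
Qed.

Lemma ge0_integral_affine (a b : R) (f : R -> \bar R) : a != 0%R ->
  measurable_fun setT f -> (forall x, 0 <= f x) ->
  \int[mu]_x f x = `|a|%:E * \int[mu]_x f (a * x + b)%R.
Proof.
move=> a0 mf f0.
rewrite (@ge0_integral_transfer _ _ _ _ R mu mu (fun x => a * x + b)%R (fun=> `|a|%R))//.
- rewrite ge0_integralZl//; first exact: measurableT_comp (measurable_affine a b).
- exact: measurable_affine.
- move=> A mA; rewrite [LHS](lebesgue_measure_affine b a0)//.
  under eq_integral do rewrite EFinM.
  have mA' : measurable (((fun x => a * x + b)%R : measurableTypeR R -> measurableTypeR R) @^-1` A).
    by rewrite -[X in measurable X]setTI; exact: measurable_affine.
  rewrite ge0_integralZl//; last first.
    apply/measurable_EFinP; apply: measurableT_comp => //; exact: measurable_affine.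
  congr (_ * _).
  by have := integral_indic mu measurableT mA'; rewrite setIT => <-.
Qed.
End real_line.

Section weighted_pushforward.
Local Open Scope ereal_scope.
Context d1 d2 (X : measurableType d1) (Y : measurableType d2) (R : realType).
Variables (mu : {measure set X -> \bar R}).
Variables (phi : X -> Y) (g : X -> R).
Hypotheses (mphi : measurable_fun setT phi) (mg : measurable_fun setT g).
Hypothesis g0 : forall x, (0 <= g x)%R.

Let nu (A : set Y) := \int[mu]_(x in phi @^-1` A) (g x)%:E.

Let nu0 : nu set0 = 0.
Proof. by rewrite /nu preimage_set0 integral_set0. Qed.

Let nu_ge0 A : 0 <= nu A.
Proof. by apply: integral_ge0 => x _; rewrite lee_fin. Qed.

Let nu_sigma_additive : semi_sigma_additive nu.
Proof.
move=> F mF tF mUF; rewrite /nu preimage_bigcup.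
apply: (@semi_sigma_additive_nng_induced _ _ _ _ (fun x => (g x)%:E)).
- exact/measurable_EFinP.
- by move=> x; rewrite lee_fin.
- by move=> k; rewrite -[X in measurable X]setTI; exact: mphi.
- apply/trivIsetP => i j _ _ ij; rewrite -preimage_setI.
  by move/trivIsetP : tF => /(_ _ _ _ _ ij) ->//; rewrite preimage_set0.
- by rewrite -preimage_bigcup -[X in measurable X]setTI; exact: mphi.
Qed.

(** Packages a density along a map as a measure, in the shape that [ge0_integral_transfer] expects.
    It provides the comparison measure for substitution and the model measure of [radial_exists]. *)
Lemma weighted_pushforward : exists m : {measure set Y -> \bar R},
  forall A, measurable A -> m A = \int[mu]_x (g x * \1_A (phi x))%:E.
Proof.
pose mixin := isMeasure.Build _ _ _ nu nu0 nu_ge0 nu_sigma_additive.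
pose m : {measure set Y -> \bar R} := HB.pack nu mixin.
exists m => A mA.
rewrite [LHS]integral_mkcond; apply: eq_integral => x _.
rewrite patchE indicE/=; case: ifPn => [/set_mem xA|].
  by rewrite mem_set ?mulr1.
by rewrite notin_setE => xA; rewrite memNset ?mulr0.
Qed.
End weighted_pushforward.

(** * Substitution along an increasing map *)

Section substitution.
Local Open Scope ereal_scope.
Context (R : realType).
Notation mu := (@lebesgue_measure R).
Variables (phi psi : R -> R) (a b : R).
Hypothesis ab : (a <= b)%R.
Hypothesis cpsi : continuous psi.
Hypothesis dphi : forall x : R, is_derive x 1%R phi (psi x).
Hypothesis psi0 : forall x : R, (a <= x <= b -> 0 <= psi x)%R.
Hypothesis incr : {in `[a, b]%R &, {homo phi : x y / (x < y)%R}}.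

Let cphi : continuous phi.
Proof.
by move=> x; apply: differentiable_continuous; apply/derivable1_diffP; exact: ex_derive.
Qed.

Let FTC (x : R) : (a <= x <= b)%R ->
  \int[mu]_(t in `[a, x]) (psi t)%:E = (phi x - phi a)%:E.
Proof.
move=> /andP[]; rewrite le_eqVlt => /predU1P[<- _|ax xb].
  by rewrite set_itv1 integral_set1 subrr.
rewrite (@continuous_FTC2 _ psi phi)//.
- exact: continuous_subspaceT.
- by split=> [y _||]; [exact: ex_derive|apply: cvg_at_right_filter; exact: cphi|apply: cvg_at_left_filter; exact: cphi].
- by move=> y _; rewrite derive1E; exact: derive_val.
Qed.

Let g (x : R) : R := psi x * \1_`[a, b] x.

Let mpsi : measurable_fun setT psi.
Proof. exact: continuous_measurable_fun. Qed.

Let mphi : measurable_fun setT phi.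
Proof. exact: continuous_measurable_fun. Qed.

Let mg : measurable_fun setT g.
Proof. exact: measurable_funM. Qed.

Let g0 (x : R) : (0 <= g x)%R.
Proof.
rewrite /g indicE; have [|_] := boolP (x \in _); last by rewrite mulr0.
by rewrite inE/= in_itv/= => /psi0; rewrite mulr1.
Qed.

(** For c between phi a and phi b the intermediate value theorem gives c = phi x0, and both sides
    equal phi x0 - phi a by the fundamental theorem. Rays that miss [[phi a, phi b]] or cover it are
    treated apart. *)
Let ray (c : R) : mu (`]-oo, c[ `&` `[phi a, phi b]) =
  \int[mu]_x (g x * \1_`]-oo, c[ (phi x))%:E.
Proof.
have mono (x y : R) : (a <= x <= b)%R -> (a <= y <= b)%R -> (phi x < phi y)%R = (x < y)%R.
  by move=> xab yab; exact: (leW_mono_in (le_mono_in incr)).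
have mono' (x y : R) : (a <= x <= b)%R -> (a <= y <= b)%R -> (phi x <= phi y)%R = (x <= y)%R.
  by move=> xab yab; exact: (le_mono_in incr).
have phiab : (phi a <= phi b)%R by rewrite mono' ?lexx ?ab.
have [c_a|a_c] := leP c (phi a).
  rewrite (_ : _ `&` _ = set0) ?measure0; last first.
    apply/seteqP; split => x //=; rewrite !in_itv/= => -[xc /andP[ax _]].
    by move: (lt_le_trans xc c_a); rewrite ltNge ax.
  rewrite integral0_eq// => x _; rewrite /g !indicE.
  have [|] := boolP (x \in _); last by rewrite mulr0 mul0r.
  rewrite inE/= in_itv/= => xab; rewrite memNset ?mulr0//= in_itv/=.
  apply/negP; rewrite -leNgt (le_trans c_a)// mono' ?lexx ?ab//.
  by case/andP : xab.
have [b_c|c_b] := ltP (phi b) c.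
  rewrite setIidr; last first.
    by move=> x /=; rewrite !in_itv/= => /andP[_ /le_lt_trans]; exact.
  rewrite lebesgue_measure_itv/= lte_fin ltNge.
  transitivity (phi b - phi a)%:E.
    by case: leP => //; rewrite EFinB// => ba; rewrite (@le_anti _ _ (phi a) (phi b)) ?phiab// subee.
  rewrite -FTC ?lexx ?ab// [LHS]integral_mkcond; apply: eq_integral => x _.
  rewrite patchE /g !indicE; have [|] := boolP (x \in _); last by rewrite mulr0 mul0r.
  rewrite inE/= in_itv/= => xab; rewrite mem_set ?mulr1//= in_itv/=.
  apply: le_lt_trans b_c.
  by rewrite mono' ?lexx ?ab ?xab//; case/andP : xab.
have [x0 x0ab px0] : exists2 x, x \in `[a, b]%R & phi x = c.
  apply: IVT => //; first exact: continuous_subspaceT.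
  by rewrite min_l// max_r// (ltW a_c).
move: x0ab; rewrite in_itv/= => x0ab.
rewrite (_ : _ `&` _ = `[phi a, c[%classic); last first.
  apply/seteqP; split=> x /=; rewrite !in_itv/=; first by move=> [-> /andP[->]].
  by move=> /andP[-> xc]; split=> //=; rewrite (le_trans (ltW xc)).
rewrite lebesgue_measure_itv/= lte_fin a_c -px0 -EFinB -FTC//.
rewrite -integral_itv_bndo_bndc; last by apply/measurable_EFinP; exact: measurable_funTS.
rewrite [LHS]integral_mkcond; apply: eq_integral => x _.
rewrite patchE /g !indicE/=; case: ifPn.
  rewrite inE/= in_itv/= => /andP[ax xx0].
  have xab : (a <= x <= b)%R by rewrite ax (ltW (lt_le_trans xx0 _))//; case/andP: x0ab.
  by rewrite !mem_set ?mulr1//= in_itv//= mono.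
rewrite notin_setE/= in_itv/=  => /negP xx0.
have [|] := boolP (x \in _); last by rewrite mulr0 mul0r.
rewrite inE/= in_itv/= => xab; rewrite memNset ?mulr0//= in_itv/= mono//.
by move=> xlt; apply/negP/negPn : xx0; rewrite xlt; case/andP: xab => ->.
Qed.

(** The rays []-oo, c[] are closed under intersection and generate the Borel sets, so agreement on
    them gives equality of measures. The derivative may vanish at the ends, as it does at a = 0 for
    sqrt (a^2 + rho2) and at 0 and pi for - cos, the two maps to which this is applied. *)
Lemma ge0_integral_substitution (h : R -> \bar R) :
  measurable_fun setT h -> (forall x, 0 <= h x) ->
  \int[mu]_(y in `[phi a, phi b]) h y =
  \int[mu]_(x in `[a, b]) ((psi x)%:E * h (phi x)).
Proof.
move=> mh h0.
have [m mE] := @weighted_pushforward _ _ (measurableTypeR R) (measurableTypeR R) R mu phi g mphi mg g0.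
have mitv : measurable (`[phi a, phi b]%classic : set R) by [].
transitivity (\int[m]_y h y).
  transitivity (\int[mrestr mu mitv]_y h y).
    rewrite (@ge0_integral_transfer _ _ _ _ R mu (mrestr mu mitv) idfun (\1_`[phi a, phi b]))//; last 2 first.
    - exact: measurable_id.
    - move=> A mA; transitivity (\int[mu]_(x in `[phi a, phi b]) (\1_A x)%:E).
        by rewrite (integral_indic mu mitv mA).
      rewrite [LHS]integral_mkcond; apply: eq_integral => x _.
      rewrite patchE [X in (X * _)%R]indicE; case: ifPn; first by rewrite mul1r.
      by rewrite mul0r.
    - rewrite [LHS]integral_mkcond; apply: eq_integral => x _.
      rewrite patchE indicE; case: ifPn; first by rewrite mul1e.
      by rewrite mul0e.
  apply: eq_measure_integral => A mA _.
  have H := @measure_unique _ R (measurableTypeR R) (@RGenInftyO.G R)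
    (fun n => `]-oo, n%:R[%classic) (RGenInftyO.measurableE R) _ _ _ (mrestr mu mitv) m.
  apply: H => //.
  - move=> _ _ [x ->] [y ->]; exists (Num.min x y).
    by apply/seteqP; split=> z /=; rewrite !in_itv/= lt_min => /andP.
  - by move=> n; exists n%:R.
  - apply/seteqP; split=> // x _; exists (Num.trunc `|x|).+1 => //=.
    by rewrite in_itv/= (le_lt_trans (ler_norm x))// truncnS_gt.
  - by move=> _ [c ->]; rewrite mE//; exact: ray.
  - move=> k; apply: (@le_lt_trans _ _ (mu `[phi a, phi b])).
      by apply: le_measure; rewrite ?inE//; apply: measurableI.
    by rewrite lebesgue_measure_itv/=; case: ifP => _; rewrite ?ltry// -EFinB ltry.
rewrite (@ge0_integral_transfer _ _ (measurableTypeR R) (measurableTypeR R) R mu m phi g mphi mg g0 mE)//.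
rewrite [RHS]integral_mkcond; apply: eq_integral => x _.
rewrite patchE /g !indicE/=; case: ifPn; first by rewrite mulr1.
by rewrite mulr0 mul0e.
Qed.
End substitution.

(** * Lebesgue measure on tuples: Fubini and dilations *)

Section lebesgue_tuple.
Local Open Scope ereal_scope.
Context (R : realType).
Notation mu := (@lebesgue_measure R).

Let mcons n : measurable_fun setT
  (@cons_pair R n : (measurableTypeR R * n.-tuple R)%type -> _).
Proof. exact: measurable_cons_pair. Qed.

Lemma measurable_cons_pairl n (a : R) :
  measurable_fun setT (fun t : n.-tuple R => cons_pair (a, t)).
Proof. by apply: (measurable_cons (measurable_cst a)); exact: measurable_id. Qed.

Let mcomp n (g : n.+1.-tuple R -> \bar R) : measurable_fun setT g ->
  measurable_fun setT
    (g \o @cons_pair R n : (measurableTypeR R * n.-tuple R)%type -> _).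
Proof. by move=> mg; exact: (measurableT_comp mg (@mcons n)). Qed.

Lemma measurable_comp_cons_pairl n (g : n.+1.-tuple R -> \bar R) (a : R) :
  measurable_fun setT g -> measurable_fun setT (fun t => g (cons_pair (a, t))).
Proof. by move=> mg; exact: (measurableT_comp mg (measurable_cons_pairl a)). Qed.

Lemma measurable_integral_lebesgue_tuple n (g : n.+1.-tuple R -> \bar R) :
  measurable_fun setT g -> (forall x, 0 <= g x) ->
  measurable_fun setT (fun a : measurableTypeR R => \int[lebesgue_tuple R n]_t g (cons_pair (a, t))).
Proof.
move=> mg g0.
exact: (measurable_fun_fubini_tonelli_F _ (mcomp mg) (fun z => g0 _)).
Qed.

Lemma ge0_integral_lebesgue_tupleS n (g : n.+1.-tuple R -> \bar R) :
  measurable_fun setT g -> (forall x, 0 <= g x) ->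
  \int[lebesgue_tuple R n.+1]_x g x =
  \int[mu]_a \int[lebesgue_tuple R n]_t g (cons_pair (a, t)).
Proof.
move=> mg g0; have mc := @mcons n.
transitivity (\int[mu \x lebesgue_tuple R n]_z (g \o @cons_pair R n) z).
  exact: (@ge0_integral_pushforward _ _ (measurableTypeR R * n.-tuple R)%type _ R _ mc (mu \x lebesgue_tuple R n)%E setT _ measurableT mg (fun y _ => g0 y)).
exact: (fubini_tonelli1 _ (mcomp mg) (fun z => g0 _)).
Qed.

Lemma ge0_integral_lebesgue_tupleS2 n (g : n.+1.-tuple R -> \bar R) :
  measurable_fun setT g -> (forall x, 0 <= g x) ->
  \int[lebesgue_tuple R n.+1]_x g x =
  \int[lebesgue_tuple R n]_t \int[mu]_a g (cons_pair (a, t)).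
Proof.
move=> mg g0; have mc := @mcons n.
transitivity (\int[mu \x lebesgue_tuple R n]_z (g \o @cons_pair R n) z).
  exact: (@ge0_integral_pushforward _ _ (measurableTypeR R * n.-tuple R)%type _ R _ mc (mu \x lebesgue_tuple R n)%E setT _ measurableT mg (fun y _ => g0 y)).
exact: (fubini_tonelli2 _ (mcomp mg) (fun z => g0 _)).
Qed.

Definition scale n (r : R) (x : n.-tuple R) : n.-tuple R := [tuple of map ( *%R r) x].

Lemma scale_cons n (r a : R) (t : n.-tuple R) :
  scale r (cons_pair (a, t)) = cons_pair ((r * a)%R, scale r t).
Proof. exact: val_inj. Qed.

Lemma measurable_scale n (r : R) : measurable_fun setT (@scale n r).
Proof.
apply/measurable_fun_tnthP => i.
rewrite (_ : _ \o _ = (fun x => r * tnth x i))%R.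
  by apply: measurable_funM => //; exact: measurable_tnth.
by apply/funext => x /=; rewrite tnth_map.
Qed.

Lemma ge0_integral_scale n (r : R) (g : n.-tuple R -> \bar R) : (r != 0)%R ->
  measurable_fun setT g -> (forall x, 0 <= g x) ->
  \int[lebesgue_tuple R n]_x g x = (`|r| ^+ n)%:E * \int[lebesgue_tuple R n]_x g (scale r x).
Proof.
move=> r0; elim: n g => [|n IHn] g mg g0.
  by rewrite expr0 mul1e; apply: eq_integral => x _; rewrite [x]tuple0 [scale _ _]tuple0.
have mgs : measurable_fun setT (g \o scale r).
  by apply: measurableT_comp => //; exact: measurable_scale.
rewrite (ge0_integral_lebesgue_tupleS mg g0) [in RHS](ge0_integral_lebesgue_tupleS mgs (fun x => g0 _)).
rewrite (@ge0_integral_affine R r 0 _ r0); last 2 first.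
- exact: measurable_integral_lebesgue_tuple.
- by move=> a; apply: integral_ge0 => t ?; exact: g0.
rewrite exprS EFinM -muleA; congr (_ * _).
rewrite -ge0_integralZl//; last 2 first.
- exact: (measurable_integral_lebesgue_tuple mgs (fun x => g0 _)).
- by move=> a ?; apply: integral_ge0 => t ?; exact: g0.
apply: eq_integral => a _; rewrite addr0 IHn//; last exact: measurable_comp_cons_pairl.
by congr (_ * _); apply: eq_integral => t _; rewrite /= scale_cons.
Qed.
End lebesgue_tuple.

(** * Maps that preserve Lebesgue measure *)

Section preserves_lebesgue.
Local Open Scope ereal_scope.
Context (R : realType).
Notation mu := (@lebesgue_measure R).

(** Stated for integrals of nonnegative functions rather than for sets, so that composition and
    Fubini apply directly. *)
Definition preserves_lebesgue n (T : n.-tuple R -> n.-tuple R) : Prop :=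
  measurable_fun setT T /\
  forall g : n.-tuple R -> \bar R, measurable_fun setT g -> (forall x, 0 <= g x) ->
    \int[lebesgue_tuple R n]_x g (T x) = \int[lebesgue_tuple R n]_x g x.

Definition ttail n (x : n.+1.-tuple R) : n.-tuple R := [tuple of behead x].

Lemma measurable_ttail n : measurable_fun setT (@ttail n).
Proof. exact: measurable_behead. Qed.

Lemma cons_pair_eta n (x : n.+1.-tuple R) : cons_pair (thead x, ttail x) = x.
Proof. by rewrite [RHS]tuple_eta; exact: val_inj. Qed.

Lemma ttail_cons n (a : R) (t : n.-tuple R) : ttail (cons_pair (a, t)) = t.
Proof. exact: val_inj. Qed.

Lemma thead_cons n (a : R) (t : n.-tuple R) : thead (cons_pair (a, t)) = a.
Proof. by []. Qed.

Lemma measurable_fun_cons_pair d (T : measurableType d) n (h : T -> R)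
    (k : T -> n.-tuple R) : measurable_fun setT h -> measurable_fun setT k ->
  measurable_fun setT (fun x => cons_pair (h x, k x)).
Proof. by move=> mh mk; exact: (measurable_cons mh mk). Qed.

Lemma measurable_thead n : measurable_fun setT (fun x : n.+1.-tuple R => thead x).
Proof. exact: measurable_tnth. Qed.

Lemma preserves_lebesgue_comp n (S T : n.-tuple R -> n.-tuple R) :
  preserves_lebesgue S -> preserves_lebesgue T -> preserves_lebesgue (S \o T).
Proof.
move=> [mS iS] [mT iT]; split; first exact: measurableT_comp.
move=> g mg g0; rewrite -[RHS]iS// -[RHS](iT (g \o S))//.
  exact: measurableT_comp.
by move=> x; exact: g0.
Qed.

(** For a fixed tail this is an affine map of slope e on the head. The case e = -1 covers
    reflections. *)
Lemma preserves_lebesgue_shear n (e : R) (phi : n.-tuple R -> R) :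
  (`|e| = 1)%R -> measurable_fun setT phi ->
  preserves_lebesgue
    (fun x : n.+1.-tuple R => cons_pair ((e * thead x + phi (ttail x))%R, ttail x)).
Proof.
move=> e1 mphi; set T := fun x => _.
have mT : measurable_fun setT T.
  apply: measurable_fun_cons_pair; last exact: measurable_ttail.
  apply: measurable_funD.
    by apply: measurable_funM; [exact: measurable_cst|exact: measurable_thead].
  exact: (measurableT_comp mphi (@measurable_ttail n)).
split; first exact: mT.
move=> g mg g0.
have mgT : measurable_fun setT (g \o T) := measurableT_comp mg mT.
transitivity (\int[lebesgue_tuple R n]_t \int[mu]_a (g \o T) (cons_pair (a, t))).
  exact: (ge0_integral_lebesgue_tupleS2 mgT (fun x => g0 _)).
transitivity (\int[lebesgue_tuple R n]_t \int[mu]_a g (cons_pair (a, t))); last first.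
  exact/esym/(ge0_integral_lebesgue_tupleS2 mg g0).
apply: eq_integral => t _.
have mgt : measurable_fun setT (fun a : R => g (cons_pair (a, t))).
  apply: (measurableT_comp mg); apply: measurable_fun_cons_pair.
    exact: measurable_id.
  exact: measurable_cst.
have e0 : e != 0%R by rewrite -normr_gt0 e1.
rewrite [RHS](ge0_integral_affine (phi t) e0 mgt (fun x => g0 _)).
by rewrite e1 mul1e; apply: eq_integral => a _; rewrite /= /T ttail_cons thead_cons.
Qed.

Lemma preserves_lebesgue_cons n (T : n.-tuple R -> n.-tuple R) :
  preserves_lebesgue T ->
  preserves_lebesgue (fun x : n.+1.-tuple R => cons_pair (thead x, T (ttail x))).
Proof.
move=> [mT iT]; set S := fun x => _.
have mS : measurable_fun setT S.
  apply: measurable_fun_cons_pair; first exact: measurable_thead.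
  exact: (measurableT_comp mT (@measurable_ttail n)).
split; first exact: mS.
move=> g mg g0.
have mgS : measurable_fun setT (g \o S) := measurableT_comp mg mS.
transitivity (\int[mu]_a \int[lebesgue_tuple R n]_t (g \o S) (cons_pair (a, t))).
  exact: (ge0_integral_lebesgue_tupleS mgS (fun x => g0 _)).
transitivity (\int[mu]_a \int[lebesgue_tuple R n]_t g (cons_pair (a, t))); last first.
  exact/esym/(ge0_integral_lebesgue_tupleS mg g0).
apply: eq_integral => a _.
rewrite -[RHS](iT _ (measurable_comp_cons_pairl a mg) (fun x => g0 _)).
by apply: eq_integral => t _; rewrite /= /S ttail_cons thead_cons.
Qed.

Definition rotate n (c s : R) (x : n.+2.-tuple R) : n.+2.-tuple R :=
  cons_pair ((c * thead x + s * thead (ttail x))%R,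
    cons_pair ((- s * thead x + c * thead (ttail x))%R, ttail (ttail x))).

(** A plane rotation is a product of three shears, two along the first axis around one along the
    second. *)
Lemma preserves_lebesgue_rotate n (c s : R) : (c ^+ 2 + s ^+ 2 = 1)%R ->
  preserves_lebesgue (@rotate n c s).
Proof.
have shear1 (k : R) : preserves_lebesgue (fun x : n.+2.-tuple R =>
    cons_pair ((thead x + k * thead (ttail x))%R, ttail x)).
  have mk : measurable_fun setT (fun t : n.+1.-tuple R => k * thead t)%R.
    by apply: measurable_funM; [exact: measurable_cst|exact: measurable_thead].
  have := preserves_lebesgue_shear (normr1 R) mk.
  by congr preserves_lebesgue; apply/funext => x; rewrite mul1r.
have shear2 (k : R) : preserves_lebesgue (fun x : n.+2.-tuple R =>
    cons_pair (thead x, cons_pair ((thead (ttail x) + k * thead x)%R, ttail (ttail x)))).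
  have mS : measurable_fun setT (fun x : n.+2.-tuple R =>
    cons_pair (thead x, cons_pair ((thead (ttail x) + k * thead x)%R, ttail (ttail x)))).
    apply: measurable_fun_cons_pair; first exact: measurable_thead.
    apply: measurable_fun_cons_pair.
      apply: measurable_funD.
        exact: (measurableT_comp (@measurable_thead n) (@measurable_ttail _)).
      by apply: measurable_funM; [exact: measurable_cst|exact: measurable_thead].
    exact: (measurableT_comp (@measurable_ttail n) (@measurable_ttail _)).
  split; first exact: mS.
  move=> g mg g0.
  have mgS := measurableT_comp mg mS.
  rewrite (ge0_integral_lebesgue_tupleS mgS (fun x => g0 _)).
  rewrite [RHS](ge0_integral_lebesgue_tupleS mg g0); apply: eq_integral => a _.
  have [_ iS] := preserves_lebesgue_shear (normr1 R)
    (measurable_cst (k * a)%R : measurable_fun setT (fun _ : n.-tuple R => (k * a)%R)).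
  rewrite -[RHS](iS _ (measurable_comp_cons_pairl a mg) (fun x => g0 _)).
  by apply: eq_integral => t _; rewrite /= thead_cons ttail_cons mul1r.
(* For the angle a with cosine c' and sine s', the factor t = s' / (1 + c') is tan (a / 2); the
   middle shear has factor - s'. *)
have base (c' s' : R) : (c' ^+ 2 + s' ^+ 2 = 1)%R -> c' != (-1)%R -> preserves_lebesgue (@rotate n c' s').
  move=> cs c1; pose t := (s' / (1 + c'))%R.
  have := preserves_lebesgue_comp (shear1 t) (preserves_lebesgue_comp (shear2 (- s')%R) (shear1 t)).
  congr (preserves_lebesgue _); apply/funext => x /=.
  have c1' : (1 + c' != 0)%R by rewrite addrC addr_eq0.
  have tc : (t * (1 + c') = s')%R by rewrite /t divfK.
  have ts : (t * s' = 1 - c')%R.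
    apply: (mulIf c1'); rewrite mulrAC tc -expr2.
    rewrite -(addKr (c' ^+ 2) (s' ^+ 2))%R cs; ring.
  rewrite /rotate !(thead_cons, ttail_cons).
  set A := thead x; set B := thead (ttail x).
  have -> : (A + t * B + t * (B + - s' * (A + t * B)) = c' * A + s' * B)%R.
    transitivity (A * (1 - t * s') + B * (2 * t - t * (t * s')))%R; first by ring.
    by rewrite ts -tc; ring.
  have -> // : (B + - s' * (A + t * B) = - s' * A + c' * B)%R.
  transitivity (- s' * A + B * (1 - t * s'))%R; first by ring.
  by rewrite ts; ring.
(* The half-turn, where t has no meaning, is the square of the quarter-turn. *)
move=> cs; have [cE|] := eqVneq c (-1)%R; last exact: base.
have s0 : s = 0%R.
  by apply/eqP; rewrite -sqrf_eq0; apply/eqP; move: cs; rewrite cE sqrrN expr1n; lra.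
have b : (0 ^+ 2 + 1 ^+ 2 = 1 :> R)%R by rewrite expr0n expr1n add0r.
have n1 : (0 != -1 :> R)%R by rewrite eq_sym oppr_eq0 oner_eq0.
have := preserves_lebesgue_comp (base 0 1 b n1)%R (base 0 1 b n1)%R.
congr preserves_lebesgue; apply/funext => x /=.
rewrite /rotate !(thead_cons, ttail_cons) cE s0.
by congr cons_pair; congr pair; [ring|congr cons_pair; congr pair; ring].
Qed.
End preserves_lebesgue.

(** * Linear isometries *)

Section isometry.
Context (R : realType).

Lemma dotp_cons n (a b : R) (t u : n.-tuple R) :
  dotp (cons_pair (a, t)) (cons_pair (b, u)) = a * b + dotp t u.
Proof.
rewrite /dotp big_ord_recl !tnth0; congr +%R.
by apply: eq_bigr => i _; rewrite !tnthS.
Qed.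

Lemma dotp_eta n (x y : n.+1.-tuple R) :
  dotp x y = thead x * thead y + dotp (ttail x) (ttail y).
Proof. by rewrite -{1}(cons_pair_eta x) -{1}(cons_pair_eta y) dotp_cons. Qed.

Lemma dotpC n (x y : n.-tuple R) : dotp x y = dotp y x.
Proof. by apply: eq_bigr => i _; rewrite mulrC. Qed.

Lemma dotp_ge0 n (x : n.-tuple R) : 0 <= dotp x x.
Proof. by apply: sumr_ge0 => i _; rewrite -expr2 sqr_ge0. Qed.

Lemma dotpZl n (r : R) (x y : n.-tuple R) : dotp (scale r x) y = r * dotp x y.
Proof.
by rewrite /dotp mulr_sumr; apply: eq_bigr => i _; rewrite tnth_map mulrA.
Qed.

Lemma dotpZr n (r : R) (x y : n.-tuple R) : dotp x (scale r y) = r * dotp x y.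
Proof. by rewrite dotpC dotpZl dotpC. Qed.

Definition ztuple n : n.-tuple R := [tuple of nseq n 0].

Lemma ztupleS n : ztuple n.+1 = cons_pair (0, ztuple n).
Proof. exact: val_inj. Qed.

Lemma dotp0l n (x : n.-tuple R) : dotp (ztuple n) x = 0.
Proof. by rewrite /dotp big1// => i _; rewrite tnth_nseq mul0r. Qed.

Lemma dotp_eq0 n (x : n.-tuple R) : dotp x x = 0 -> x = ztuple n.
Proof.
move=> x0; apply: eq_from_tnth => i; rewrite tnth_nseq; apply/eqP.
rewrite -sqrf_eq0 expr2; apply/eqP; move: x0.
by move/psumr_eq0P => /(_ (fun j _ => sqr_ge0 (tnth x j)) i isT).
Qed.

(** The first clause keeps the sphere and the ball invariant, homogeneity makes T commute with the
    radial projection [normalize], and the third clause gives invariance of the cone measure. *)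
Definition linear_isometry n (T : n.-tuple R -> n.-tuple R) : Prop :=
  [/\ forall x y, dotp (T x) (T y) = dotp x y,
      forall r x, T (scale r x) = scale r (T x) & preserves_lebesgue T].

Lemma isometry_id n : linear_isometry (@id (n.-tuple R)).
Proof. by split=> //; split=> //; exact: measurable_id. Qed.

Lemma isometry_comp n (S T : n.-tuple R -> n.-tuple R) :
  linear_isometry S -> linear_isometry T -> linear_isometry (S \o T).
Proof.
move=> [dS hS pS] [dT hT pT]; split; last exact: preserves_lebesgue_comp.
  by move=> x y /=; rewrite dS dT.
by move=> r x /=; rewrite hT hS.
Qed.

Lemma thead_scale n (r : R) (x : n.+1.-tuple R) : thead (scale r x) = r * thead x.
Proof. by rewrite -(cons_pair_eta x) scale_cons !thead_cons. Qed.

Lemma ttail_scale n (r : R) (x : n.+1.-tuple R) : ttail (scale r x) = scale r (ttail x).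
Proof. by rewrite -(cons_pair_eta x) scale_cons !ttail_cons. Qed.

Lemma isometry_cons n (T : n.-tuple R -> n.-tuple R) : linear_isometry T ->
  linear_isometry (fun x : n.+1.-tuple R => cons_pair (thead x, T (ttail x))).
Proof.
move=> [dT hT pT]; split; last exact: preserves_lebesgue_cons.
  by move=> x y; rewrite dotp_cons dT -dotp_eta.
by move=> r x; rewrite thead_scale ttail_scale hT scale_cons.
Qed.

Lemma isometry_neg n :
  linear_isometry (fun x : n.+1.-tuple R => cons_pair (- thead x, ttail x)).
Proof.
split.
- by move=> x y; rewrite dotp_cons mulrNN -dotp_eta.
- by move=> r x; rewrite thead_scale ttail_scale scale_cons mulrN.
- have := @preserves_lebesgue_shear R n (-1) (fun=> 0) (normrN1 _) (measurable_cst _).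
  by congr preserves_lebesgue; apply/funext => x; rewrite mulN1r addr0.
Qed.

Lemma isometry_rotate n (c s : R) : c ^+ 2 + s ^+ 2 = 1 -> linear_isometry (@rotate R n c s).
Proof.
move=> cs; split; last exact: preserves_lebesgue_rotate.
- move=> x y; rewrite !dotp_cons [RHS]dotp_eta [X in _ = _ + X]dotp_eta !addrA.
  congr +%R; set a := thead x; set b := thead _; set a' := thead y; set b' := thead _.
  transitivity ((c ^+ 2 + s ^+ 2) * (a * a' + b * b')); first by ring.
  by rewrite cs mul1r.
- move=> r x; rewrite /rotate !(ttail_scale, thead_scale, scale_cons).
  by congr cons_pair; congr pair; [ring|congr cons_pair; congr pair; ring].
Qed.

(** Induction: align the tail with its first axis, which gives (a, b, 0, ...), then rotate the first
    two coordinates with cosine a / r and sine b / r. In dimension one a reflection corrects the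
    sign. *)
Lemma isometry_align n (w : n.+1.-tuple R) :
  exists2 T : n.+1.-tuple R -> n.+1.-tuple R, linear_isometry T &
    T w = cons_pair (Num.sqrt (dotp w w), ztuple n).
Proof.
elim: n w => [|n IHn] w.
  have -> : dotp w w = thead w ^+ 2.
    by rewrite dotp_eta expr2 /dotp big_ord0 addr0.
  have tl (t : 0.-tuple R) : t = ztuple 0 by rewrite [LHS]tuple0 [RHS]tuple0.
  rewrite sqrtr_sqr; have [w0|w0] := leP 0 (thead w).
    exists id; first exact: isometry_id.
    by rewrite (ger0_norm w0) -(tl (ttail w)) cons_pair_eta.
  exists (fun x => cons_pair (- thead x, ttail x)); first exact: isometry_neg.
  by rewrite (ltr0_norm w0) -(tl (ttail w)).
have [T iT Tw] := IHn (ttail w).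
set b := Num.sqrt _ in Tw; set a := thead w; set r := Num.sqrt (dotp w w).
have ab : dotp w w = a ^+ 2 + b ^+ 2.
  by rewrite dotp_eta -expr2 /b sqr_sqrtr// dotp_ge0.
have rr : r ^+ 2 = a ^+ 2 + b ^+ 2 by rewrite -ab sqr_sqrtr// dotp_ge0.
have iT' := isometry_cons iT.
have [r0|r0] := eqVneq r 0.
  have w0 : w = ztuple n.+2.
    by apply: dotp_eq0; rewrite ab -rr r0 expr0n.
  exists id; first exact: isometry_id.
  by rewrite r0 -ztupleS w0.
exists (@rotate R n (a / r) (b / r) \o (fun x => cons_pair (thead x, T (ttail x)))).
  apply: isometry_comp => //; apply: isometry_rotate.
  by rewrite !expr_div_n -mulrDl -rr divff// expf_neq0.
rewrite /= /rotate !(thead_cons, ttail_cons) Tw !(thead_cons, ttail_cons) -/a ztupleS.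
congr cons_pair; congr pair.
  by rewrite mulrAC (mulrAC b) -mulrDl -!expr2 -rr expr2 mulfK.
by have -> : - (b / r) * a + a / r * b = 0 by rewrite mulNr (mulrAC a) (mulrC a) (mulrAC b) addNr.
Qed.
End isometry.

(** The matrix determinant lemma: the block matrix M is eliminated in two ways and the triangular
    factorisations are compared. *)
Lemma det_1D (F : comNzRingType) n (u : 'cV[F]_n) (v : 'rV[F]_n) :
  \det (1%:M + u *m v) = 1 + (v *m u) 0 0.
Proof.
pose M : 'M[F]_(1 + n) := block_mx 1%:M (- v) u 1%:M.
have M1 : M = block_mx 1%:M 0 u 1%:M *m block_mx 1%:M (- v) 0 (1%:M + u *m v).
  rewrite mulmx_block !(mul1mx, mulmx1, mul0mx, mulmx0, addr0, add0r).
  by rewrite mulmxN addrC addrK.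
have M2 : M = block_mx 1%:M (- v) 0 1%:M *m block_mx (1%:M + v *m u) 0 u 1%:M.
  rewrite mulmx_block !(mul1mx, mulmx1, mul0mx, mulmx0, addr0, add0r).
  by rewrite mulNmx addrK.
have := congr1 determinant M1; rewrite M2 !det_mulmx !det_ublock !det_lblock.
rewrite !det1 !mul1r mulr1 => <-.
by rewrite det_mx11 !mxE eqxx.
Qed.

Lemma measurable_to_sphere (R : realType) n d (T : measurableType d)
    (f : T -> sphere R n) :
  measurable_fun setT (fun x => \val (f x)) -> measurable_fun setT f.
Proof.
move=> mf _ A [B mB <-]; rewrite !setTI -comp_preimage.
by rewrite -[X in measurable X]setTI; exact: mf.
Qed.

Lemma measurable_sphere_val (R : realType) n :
  measurable_fun setT (\val : sphere R n -> n.+1.-tuple R).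
Proof. by move=> _ B mB; exists B. Qed.

(** * Integration in the hemisphere charts *)

Section chart.
Context (R : realType) (n : nat).
Notation L := (lebesgue_tuple R n).

(** The metric is the identity plus a matrix of rank one, so the determinant is 1 + |x|^2 / (1 -
    |x|^2). *)
Lemma det_metric_mx (x : n.-tuple R) : dotp x x < 1 ->
  \det (metric_mx x) = (1 - dotp x x)^-1.
Proof.
move=> x1; have nz : 1 - dotp x x != 0 by rewrite subr_eq0 gt_eqF.
pose k := (1 - dotp x x)^-1.
have -> : metric_mx x = 1%:M + (k *: \col_i tnth x i) *m (\row_i tnth x i).
  by apply/matrixP => i j; rewrite !mxE big_ord1 !mxE; congr +%R; rewrite -/k mulrC mulrA.
rewrite det_1D mxE (eq_bigr (fun i => k * (tnth x i * tnth x i))); last first.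
  by move=> i _; rewrite !mxE mulrCA.
rewrite -mulr_sumr -/(dotp x x) -[1 in LHS](mulVf nz) -/k -mulrDr subrK mulr1//.
Qed.

(* Junk value outside the open unit ball: the north pole. *)
Definition chart (s : bool) (x : n.-tuple R) : sphere R n :=
  insubd (Sub (north_tuple R n) (north_on_sphere R n) : sphere R n)
    (cons_pair ((-1) ^+ s * Num.sqrt (1 - dotp x x), x)).

Lemma val_chart s (x : n.-tuple R) : dotp x x < 1 ->
  \val (chart s x) = cons_pair ((-1) ^+ s * Num.sqrt (1 - dotp x x), x).
Proof.
move=> x1; rewrite val_insubd ifT// /on_sphere dotp_cons mulrACA -expr2 sqrr_sign.
by rewrite mul1r -expr2 sqr_sqrtr ?subrK// subr_ge0 ltW.
Qed.

(** The volume density of the chart, extended by 0 so that integrals run over the whole of R^n. *)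
Definition weight (x : n.-tuple R) : R :=
  \1_[set y : n.-tuple R | dotp y y < 1] x * (Num.sqrt (1 - dotp x x))^-1.

Lemma measurable_dotp_lt1 : measurable [set y : n.-tuple R | dotp y y < 1].
Proof.
rewrite -[X in measurable X]setTI.
rewrite (_ : setT `&` _ = setT `&` (fun x => dotp x x) @^-1` `]-oo, 1[).
  exact: (@measurable_dotp R n measurableT _ (measurable_itv _)).
by rewrite !setTI; apply/seteqP; split => x /=.
Qed.

Lemma measurable_weight : measurable_fun setT weight.
Proof.
apply: measurable_funM.
  exact: (measurable_indic measurable_dotp_lt1).
apply: (measurableT_comp (@measurable_inv R)).
apply: (measurableT_comp (@measurable_sqrt R)).
by apply: measurable_funB => //; exact: measurable_dotp.
Qed.

Lemma weight_ge0 x : 0 <= weight x.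
Proof. by rewrite mulr_ge0// invr_ge0 sqrtr_ge0. Qed.

Lemma hemisphereP s (q : sphere R n) : hemisphere s q ->
  dotp (Defs.proj q) (Defs.proj q) < 1 /\ q = chart s (Defs.proj q).
Proof.
move=> sq; have q1 : dotp (Defs.proj q) (Defs.proj q) < 1.
  rewrite -subr_gt0 -proj_dotp exprn_even_gt0//=.
  by apply/eqP => q0; move: sq; rewrite /hemisphere/= q0 mulr0 ltxx.
split=> //; apply: val_inj; rewrite val_chart// -(hemisphere_height sq).
exact: sphere_eq.
Qed.

Lemma hemisphere_chart s (x : n.-tuple R) : dotp x x < 1 ->
  hemisphere s (chart s x) /\ Defs.proj (chart s x) = x.
Proof.
move=> x1; split; last by apply: val_inj; rewrite /Defs.proj/= val_chart.
rewrite /hemisphere/= val_chart// tnth0 mulrA -expr2 sqrr_sign mul1r.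
by rewrite sqrtr_gt0 subr_gt0.
Qed.

Lemma measurable_chart s : measurable_fun setT (chart s).
Proof.
apply: measurable_to_sphere.
(* The bound is not strict: for |x| = 1 the lifted point (0, x) is still on the sphere. The default
   is taken only beyond, where the square root is 0. *)
rewrite (_ : (fun _ => _) = fun x => if dotp x x <= 1
    then cons_pair ((-1) ^+ s * Num.sqrt (1 - dotp x x), x) else north_tuple R n).
  apply: measurable_fun_ifT.
  - apply: measurable_fun_ler => //; exact: measurable_dotp.
  - apply: measurable_fun_cons_pair; last exact: measurable_id.
    apply: measurable_funM => //; apply: (measurableT_comp (@measurable_sqrt R)).
    by apply: measurable_funB => //; exact: measurable_dotp.
  - exact: measurable_cst.
apply/funext => x; rewrite val_insubd /on_sphere dotp_cons mulrACA -expr2 sqrr_sign.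
rewrite mul1r -expr2; have [x1|x1] := leP.
  by rewrite sqr_sqrtr ?subr_ge0// subrK eqxx.
by rewrite ler0_sqrtr ?subr_le0 ?ltW// expr0n add0r gt_eqF.
Qed.

Lemma hemisphere_volumeE s (A : set (sphere R n)) : measurable A ->
  (hemisphere_volume s A = \int[L]_x (weight x * \1_A (chart s x))%:E)%E.
Proof.
move=> mA; rewrite [LHS]integral_mkcond; apply: eq_integral => x _.
rewrite patchE /weight; case: ifPn => [|].
  rewrite inE => -[q [Aq sq] <-].
  have [q1 qE] := hemisphereP sq.
  rewrite det_metric_mx// sqrtrV// ?subr_ge0 ?ltW// -qE.
  by rewrite !indicE !mem_set// mul1r mulr1.
rewrite notin_setE => xA; rewrite !indicE.
have [|_] := boolP (x \in [set y : n.-tuple R | dotp y y < 1]); last by rewrite !mul0r.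
rewrite inE/= => x1; rewrite (_ : (_ \in A) = false) ?mulr0//.
apply/negP; rewrite inE => Ax; apply: xA; exists (chart s x).
  by have [] := hemisphere_chart s x1.
by have [] := hemisphere_chart s x1.
Qed.

Local Open Scope ereal_scope.

Lemma ge0_integral_sphere_volume (g : sphere R n -> \bar R) :
  measurable_fun setT g -> (forall x, 0 <= g x) ->
  \int[sphere_volume R n]_q g q =
  \int[L]_x ((weight x)%:E * g (chart false x)) +
  \int[L]_x ((weight x)%:E * g (chart true x)).
Proof.
move=> mg g0; rewrite ge0_integral_measure_add//.
have H s := ge0_integral_transfer (measurable_chart s) measurable_weight weight_ge0
  (hemisphere_volumeE s) mg g0.
by rewrite !H.
Qed.
End chart.

(** * Derivative rules in explicit pointwise form *)

Section real_derive.
Context (R : realType).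
Implicit Types (f g : R -> R) (x a b : R).

Lemma is_derive_continuous f x a :
  is_derive x 1 f a -> {for x, continuous f}.
Proof.
by move=> H; apply: differentiable_continuous; apply/derivable1_diffP; exact: ex_derive.
Qed.

Lemma derive_add f g x a b : is_derive x 1 f a -> is_derive x 1 g b ->
  is_derive x 1 (fun t => f t + g t) (a + b).
Proof. exact: is_deriveD. Qed.

Lemma derive_opp f x a : is_derive x 1 f a -> is_derive x 1 (fun t => - f t) (- a).
Proof. exact: is_deriveN. Qed.

Lemma derive_sub f g x a b : is_derive x 1 f a -> is_derive x 1 g b ->
  is_derive x 1 (fun t => f t - g t) (a - b).
Proof. exact: is_deriveB. Qed.

Lemma derive_mul f g x a b : is_derive x 1 f a -> is_derive x 1 g b ->
  is_derive x 1 (fun t => f t * g t) (a * g x + f x * b).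
Proof.
move=> df dg; have H := is_deriveM df dg.
rewrite (_ : (fun t => _) = f * g)//.
by apply: (is_derive_eq H); rewrite /GRing.scale/= addrC mulrC.
Qed.

Lemma derive_exp f (n : nat) x a : is_derive x 1 f a ->
  is_derive x 1 (fun t => f t ^+ n) (n%:R * f x ^+ n.-1 * a).
Proof.
move=> df; have H := is_deriveX n df.
rewrite (_ : (fun t => _) = f ^+ n)//; first by apply/funext => t; rewrite exprfctE.
Qed.

Lemma derive_inv f x a : f x != 0 -> is_derive x 1 f a ->
  is_derive x 1 (fun t => (f t)^-1) (- a / f x ^+ 2).
Proof.
move=> fx df; apply: (is_derive_eq (is_deriveV fx df)).
by rewrite /GRing.scale/= mulNr mulrC mulNr.
Qed.

Lemma derive_comp f g x a b : is_derive (g x) 1 f a -> is_derive x 1 g b ->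
  is_derive x 1 (fun t => f (g t)) (a * b).
Proof. exact: is_derive1_comp. Qed.

Lemma derive_const x a : is_derive x 1 (fun _ : R => a) 0.
Proof. exact: is_derive_cst. Qed.

Lemma derive_id x : is_derive x 1 (fun t : R => t) 1.
Proof. exact: is_derive_id. Qed.

Lemma derive_sqrt_sqrD (c : R) a : 0 < c ->
  is_derive a 1 (fun x => Num.sqrt (x ^+ 2 + c)) (a / Num.sqrt (a ^+ 2 + c)).
Proof.
move=> c0; have p : 0 < a ^+ 2 + c by rewrite ltr_wpDl// sqr_ge0.
have D := derive_add (derive_exp 2 (derive_id a)) (derive_const a c).
have H := derive_comp (f := Num.sqrt) (g := fun t => t ^+ 2 + c) (is_derive1_sqrt p) D.
apply: (is_derive_eq H).
rewrite addr0 expr1 mulr1.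
by rewrite invfM mulrACA mulVf ?mul1r 1?mulrC// pnatr_eq0.
Qed.
End real_derive.

Lemma ge0_integral_halves (R : realType) (h : R -> \bar R) :
  measurable_fun setT h -> (forall x, (0 <= h x)%E) ->
  (\int[@lebesgue_measure R]_a h a = \int[@lebesgue_measure R]_(a in `]0%R, +oo[) h a +
   \int[@lebesgue_measure R]_(a in `]0%R, +oo[) h (- a)%R)%E.
Proof.
move=> mh h0.
have mhN : measurable_fun setT (fun a : R => h (- a)%R).
  by apply: (measurableT_comp mh); exact: oppr_measurable.
rewrite -[X in (\int[_]_(a in X) _)%E](setUv `]0%R, +oo[%classic).
rewrite ge0_integral_setU//=; last 3 first.
- by apply: measurableC.
- by rewrite setUv.
- exact/disj_setPCl.
congr (_ + _)%E; rewrite setCitvr.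
rewrite [RHS]integral_itv_obnd_cbnd; last exact: measurable_funTS.
rewrite (ge0_integration_by_substitution0 mhN (fun r => h0 _)).
by apply: eq_integral => r _; rewrite opprK.
Qed.

(** * The chart volume as a cone measure *)

Section cone.
Context (R : realType) (n : nat).
Local Open Scope ereal_scope.
Notation mu := (@lebesgue_measure R).
Notation L := (lebesgue_tuple R n).

Definition normalize (v : n.+1.-tuple R) : sphere R n :=
  insubd (Sub (north_tuple R n) (north_on_sphere R n) : sphere R n)
    (scale (Num.sqrt (dotp v v))^-1 v).

Lemma val_normalize (v : n.+1.-tuple R) : (0 < dotp v v)%R ->
  \val (normalize v) = scale (Num.sqrt (dotp v v))^-1 v.
Proof.
move=> v0; rewrite val_insubd ifT// /on_sphere dotpZl dotpZr mulrA -expr2.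
by rewrite exprVn sqr_sqrtr ?ltW// mulVf// gt_eqF.
Qed.

Lemma measurable_fun_scale d (T : measurableType d) m (h : T -> R) (k : T -> m.-tuple R) :
  measurable_fun setT h -> measurable_fun setT k ->
  measurable_fun setT (fun x => scale (h x) (k x)).
Proof.
move=> mh mk; apply/measurable_fun_tnthP => i.
rewrite (_ : _ \o _ = (fun x => h x * tnth (k x) i))%R.
  by apply: measurable_funM => //; exact: (measurableT_comp (measurable_tnth i) mk).
by apply/funext => x /=; rewrite tnth_map.
Qed.

Lemma measurable_normalize : measurable_fun setT normalize.
Proof.
apply: measurable_to_sphere.
rewrite (_ : (fun _ => _) = fun v => if (0 < dotp v v)%R
    then scale (Num.sqrt (dotp v v))^-1 v else north_tuple R n).
  apply: measurable_fun_ifT.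
  - apply: measurable_fun_ltr => //; exact: measurable_dotp.
  - apply: measurable_fun_scale; last exact: measurable_id.
    apply: (measurableT_comp (@measurable_inv R)).
    by apply: (measurableT_comp (@measurable_sqrt R)); exact: measurable_dotp.
  - exact: measurable_cst.
apply/funext => v; case: ifPn => [v0|]; first by rewrite val_normalize.
rewrite lt_neqAle dotp_ge0 andbT negbK eq_sym => /eqP v0.
rewrite val_insubd ifF// /on_sphere dotpZl dotpZr v0 !mulr0.
by apply/negbTE; rewrite eq_sym oner_eq0.
Qed.

Let ht (rho2 a : R) : R := Num.sqrt (a ^+ 2 + rho2).

Variable g : sphere R n -> \bar R.
Hypotheses (mg : measurable_fun setT g) (g0 : forall q, 0 <= g q).

Let W s (x : n.-tuple R) : \bar R := (weight x)%:E * g (chart s x).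

Let mW s : measurable_fun setT (W s).
Proof.
apply: emeasurable_funM; first by apply/measurable_EFinP; exact: measurable_weight.
exact: (measurableT_comp mg (@measurable_chart R n s)).
Qed.

Let W0 s x : 0 <= W s x.
Proof. by rewrite mule_ge0// lee_fin weight_ge0. Qed.

(** The ray through (+- a, z) meets the sphere in hemisphere s, above the chart point z / |(a,
    z)|. *)
Lemma normalize_chart (s : bool) (z : n.-tuple R) (a : R) : (0 < a)%R ->
  normalize (cons_pair ((-1) ^+ s * a, z)%R) =
  chart s (scale (Num.sqrt (a ^+ 2 + dotp z z))^-1 z).
Proof.
move=> a0; have p : (0 < a ^+ 2 + dotp z z)%R.
  by rewrite ltr_pwDl ?exprn_gt0// dotp_ge0.
set r : R := Num.sqrt _.
have r0 : (0 < r)%R by rewrite sqrtr_gt0.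
have rr : (r ^+ 2 = a ^+ 2 + dotp z z)%R by rewrite sqr_sqrtr// ltW.
have E : dotp (cons_pair ((-1) ^+ s * a, z)%R) (cons_pair ((-1) ^+ s * a, z)%R) = (a ^+ 2 + dotp z z)%R.
  by rewrite dotp_cons mulrACA -!expr2 sqrr_sign mul1r.
have E2 : (1 - dotp (scale r^-1 z) (scale r^-1 z) = (a / r) ^+ 2)%R.
  rewrite dotpZl dotpZr mulrA -expr2 expr_div_n exprVn rr.
  by field; rewrite gt_eqF.
apply: val_inj; rewrite val_normalize E// -/r val_chart; last first.
  by rewrite -subr_gt0 E2 exprn_gt0// divr_gt0.
rewrite scale_cons E2 sqrtr_sqr ger0_norm ?divr_ge0 ?ltW//.
by rewrite mulrCA (mulrC r^-1)%R.
Qed.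

Let chart_height (z : n.-tuple R) (a : R) : (0 < a)%R ->
  (weight (scale (ht (dotp z z) a)^-1 z) * (a / ht (dotp z z) a) = 1)%R.
Proof.
move=> a0; have p : (0 < a ^+ 2 + dotp z z)%R.
  by rewrite ltr_pwDl ?exprn_gt0// dotp_ge0.
rewrite /ht; set r : R := Num.sqrt _.
have r0 : (0 < r)%R by rewrite sqrtr_gt0.
have rr : (r ^+ 2 = a ^+ 2 + dotp z z)%R by rewrite sqr_sqrtr// ltW.
have E2 : (1 - dotp (scale r^-1 z) (scale r^-1 z) = (a / r) ^+ 2)%R.
  rewrite dotpZl dotpZr mulrA -expr2 expr_div_n exprVn rr.
  by field; rewrite gt_eqF.
rewrite /weight indicE mem_set/=; last first.
  by rewrite -subr_gt0 E2 exprn_gt0// divr_gt0.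
by rewrite E2 sqrtr_sqr ger0_norm ?divr_ge0 ?ltW// mul1r mulVf// gt_eqF// divr_gt0.
Qed.

(** For fixed z the radius r is exchanged for the height a by r = sqrt (a^2 + |z|^2): the Jacobian a
    / r cancels against the weight r / a of the chart at z / r, as [chart_height] states. *)
Let line (s : bool) (z : n.-tuple R) :
  \int[mu]_r ((\1_(`]0%R, 1%R[%classic : set R) r)%:E * W s (scale r^-1 z)) =
  \int[mu]_(a in `]0%R, +oo[) ((\1_[set v : n.+1.-tuple R | 0 < dotp v v < 1]%R (cons_pair (a, z)))%:E *
     g (normalize (cons_pair ((-1) ^+ s * a, z)%R))).
Proof.
rewrite [RHS]integral_mkcond.
have lt1 (a : R) : ((cons_pair (a, z) : n.+1.-tuple R) \in [set v : n.+1.-tuple R | 0 < dotp v v < 1]%R) =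
    (0 < a ^+ 2 + dotp z z < 1)%R.
  by apply/idP/idP; rewrite inE/= dotp_cons -expr2.
(* For z = 0 the substitution would be r = |a|, not differentiable at 0; on a > 0 it is the
   identity. *)
have [z0|z0] := eqVneq (dotp z z) 0%R.
  apply: eq_integral => r _; rewrite patchE !indicE lt1 !mem_setE !in_itv/= andbT.
  have [r0|r0] := ltP 0%R r; last by rewrite mul0e.
  rewrite z0 addr0 /= exprn_gt0//= -[(r < 1)%R](expr_lt1 (n := 2)) ?ltW//; congr (_ * _).
  rewrite normalize_chart// z0 addr0 sqrtr_sqr (gtr0_norm r0) /W.
  have := chart_height z r0; rewrite /ht z0 addr0 sqrtr_sqr (gtr0_norm r0).
  by rewrite divff ?gt_eqF// mulr1 => ->; rewrite mul1e.
have zpos : (0 < dotp z z)%R by rewrite lt_neqAle dotp_ge0 eq_sym z0.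
set rho2 := dotp z z; pose phi := ht rho2.
have pp (a : R) : (0 < a ^+ 2 + rho2)%R by rewrite ltr_wpDl// sqr_ge0.
have phi0 (a : R) : (0 < phi a)%R by rewrite sqrtr_gt0.
have phi2 (a : R) : (phi a ^+ 2 = a ^+ 2 + rho2)%R by rewrite sqr_sqrtr// ltW.
pose psi (a : R) := (a / phi a)%R.
have dphi (a : R) : is_derive a 1%R phi (psi a) by exact: derive_sqrt_sqrD.
have cpsi : continuous psi.
  move=> a; have nz : phi a != 0%R by rewrite gt_eqF.
  exact: is_derive_continuous (derive_mul (derive_id a) (derive_inv nz (dphi a))).
pose h (r : R) := (\1_(`]0%R, 1%R[%classic : set R) r)%:E * W s (scale r^-1 z).
have mh : measurable_fun setT h.
  apply: emeasurable_funM; first by apply/measurable_EFinP; exact: measurable_indic.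
  apply: (measurableT_comp (@mW s)); apply: measurable_fun_scale; last exact: measurable_cst.
  exact: measurable_inv.
have h0 r : 0 <= h r by rewrite mule_ge0// lee_fin.
have phi00 : (phi 0 = Num.sqrt rho2)%R by rewrite /phi /ht expr0n add0r.
have phi1 : (1 < phi 1)%R.
  by rewrite -[X in (X < _)%R]sqrtr1 ltr_sqrt// expr1n ltrDl.
(* Nothing is lost: for r < phi 0 = |z| the point z / r is outside the unit ball and has weight 0,
   and phi 1 > 1. *)
transitivity (\int[mu]_(r in `[phi 0%R, phi 1%R]) h r).
  rewrite [RHS]integral_mkcond; apply: eq_integral => r _; rewrite patchE.
  case: ifPn => //; rewrite mem_setE in_itv/= negb_and -!ltNge => out.
  rewrite /h indicE mem_setE in_itv/=.
  case/boolP: (0 < r < 1)%R => [/andP[r0 r1]|_]; last by rewrite mul0e.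
  have {out} rphi : (r < phi 0)%R.
    by case/orP : out => // /lt_trans /(_ (r1)) /(lt_trans phi1); rewrite ltxx.
  rewrite /W /weight indicE memNset ?mul0r ?mul0e ?mule0//= dotpZl dotpZr.
  apply/negP; rewrite -leNgt mulrA -expr2 exprVn -/rho2 ler_pdivlMl ?exprn_gt0//.
  rewrite mulr1 -[leRHS]sqr_sqrtr ?ltW// -phi00.
  by rewrite ltr_pXn2r ?nnegrE // ltW.
rewrite (@ge0_integral_substitution R phi psi 0 1 ler01 cpsi dphi _ _ h mh h0); last 2 first.
- by move=> a /andP[a0 _]; rewrite divr_ge0// ltW.
- move=> a b; rewrite !in_itv/= => /andP[a0 _] /andP[b0 _] ab.
  by rewrite ltr_sqrt// ltrD2r ltr_pXn2r.
rewrite [LHS]integral_mkcond; apply: eq_integral => a _; rewrite !patchE.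
rewrite !mem_setE !in_itv/= andbT.
have [a0|a0|<-] := ltgtP 0%R a; last first.
- by rewrite ler01 /psi mul0r mul0e.
- by [].
rewrite indicE lt1 -/rho2 -phi2 exprn_gt0//= expr_lt1// ?(ltW (phi0 a))//.
have [a1|a1] := leP a 1%R; last first.
  rewrite (_ : (_ < _)%R = false) ?mul0e//; apply/negbTE; rewrite -leNgt.
  rewrite (le_trans (ltW phi1))// ltW// ltr_sqrt// ltrD2r.
  by rewrite ltr_pXn2r ?nnegrE// ltW.
rewrite /h indicE mem_setE in_itv/= phi0/= muleCA; congr (_ * _).
rewrite normalize_chart// -/rho2 -/(ht _ _) -/phi /W muleA -EFinM mulrC.
by rewrite chart_height// mul1e.
Qed.

(** The radial factor of the cone, equal to 1 / (n + 1); what matters is that it is positive and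
    finite. *)
Definition kappa : \bar R := \int[mu]_r ((\1_(`]0%R, 1%R[%classic : set R) r * r ^+ n)%:E).

Lemma measurable_punctured_ball : measurable [set v : n.+1.-tuple R | 0 < dotp v v < 1]%R.
Proof.
rewrite -[X in measurable X]setTI.
rewrite (_ : setT `&` _ = setT `&` (fun x => dotp x x) @^-1` `]0%R, 1%R[).
  exact: (@measurable_dotp R n.+1 measurableT _ (measurable_itv _)).
by rewrite !setTI; apply/seteqP; split => x /=; rewrite ?in_itv.
Qed.

Let ball_g (v : n.+1.-tuple R) : \bar R :=
  (\1_[set v : n.+1.-tuple R | 0 < dotp v v < 1]%R v)%:E * g (normalize v).

Let mball_g : measurable_fun setT ball_g.
Proof.
apply: emeasurable_funM.
  by apply/measurable_EFinP; apply: measurable_indic; exact: measurable_punctured_ball.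
exact: (measurableT_comp mg measurable_normalize).
Qed.

Let ball_g0 v : 0 <= ball_g v.
Proof. by rewrite mule_ge0// lee_fin. Qed.

(** Fubini for r^n dr dx: the substitution x = z / r absorbs r^n, after which [line] applies for
    each z. *)
Let hemi (s : bool) : kappa * \int[L]_x W s x =
  \int[L]_z \int[mu]_(a in `]0%R, +oo[) ball_g (cons_pair ((-1) ^+ s * a, z)%R).
Proof.
have mI : measurable_fun setT (fun r : R => (\1_(`]0%R, 1%R[%classic : set R) r * r ^+ n)%R).
  by apply: measurable_funM; [exact: measurable_indic|exact: exprn_measurable].
have I0 (r : R) : (0 <= \1_(`]0%R, 1%R[%classic : set R) r * r ^+ n)%R.
  rewrite indicE mem_setE in_itv/=; case/boolP: (_ < _ < _)%R; last by rewrite mul0r.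
  by move=> /andP[r0 _]; rewrite mul1r exprn_ge0// ltW.
pose H (w : measurableTypeR R * n.-tuple R) : \bar R :=
  (\1_(`]0%R, 1%R[%classic : set R) w.1)%:E * W s (scale w.1^-1 w.2).
have mH : measurable_fun setT H.
  apply: emeasurable_funM.
    apply/measurable_EFinP.
    have mi : measurable_fun setT (\1_(`]0%R, 1%R[%classic : set R) : measurableTypeR R -> R).
      exact: measurable_indic.
    exact: (measurableT_comp mi measurable_fst).
  apply: (measurableT_comp (@mW s)); apply: measurable_fun_scale; last exact: measurable_snd.
  exact: (measurableT_comp (@measurable_inv R : measurable_fun setT (_ : measurableTypeR R -> R)) measurable_fst).
have H0 w : 0 <= H w by rewrite mule_ge0// lee_fin.
transitivity (\int[L]_z \int[mu]_r H (r, z)); last first.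
  apply: eq_integral => z _; rewrite line; apply: eq_integral => a.
  rewrite inE/= in_itv/= andbT => a0; congr (_ * _); congr (_%:E).
  rewrite !indicE; congr (_%:R); congr nat_of_bool.
  by apply/idP/idP; rewrite !inE/= !dotp_cons -!expr2 exprMn sqrr_sign mul1r.
transitivity (\int[mu]_r \int[L]_z H (r, z)); last exact: (fubini_tonelli H mH H0).
rewrite /kappa -ge0_integralZr//; last 3 first.
- by apply/measurable_EFinP.
- by move=> r _; rewrite lee_fin.
- by apply: integral_ge0.
apply: eq_integral => r _.
transitivity ((\1_(`]0%R, 1%R[%classic : set R) r)%:E *
    \int[L]_z W s (scale r^-1 z)); last first.
  rewrite -ge0_integralZl//.
  by apply: (measurableT_comp (@mW s)); exact: measurable_scale.
rewrite indicE mem_setE in_itv/=; case/boolP: (_ < _ < _)%R => [/andP[r0 _]|_]; last first.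
  by rewrite mul0r !mul0e.
have rn : (r^-1 != 0)%R by rewrite invr_eq0 gt_eqF.
rewrite (ge0_integral_scale rn (@mW s) (@W0 s)) muleA; congr (_ * _).
rewrite -EFinM mul1r gtr0_norm ?invr_gt0// -exprMn mulfV ?expr1n//.
by rewrite gt_eqF.
Qed.

(* The chart volume is the cone measure of the Lebesgue measure of the ball;
   isometries preserve the latter, hence also the volume of the sphere. *)
Lemma cone_formula : kappa * \int[sphere_volume R n]_q g q =
  \int[lebesgue_tuple R n.+1]_v
    ((\1_[set v : n.+1.-tuple R | 0 < dotp v v < 1]%R v)%:E * g (normalize v)).
Proof.
have W_ge0 s : 0 <= \int[L]_x W s x by apply: integral_ge0.
rewrite ge0_integral_sphere_volume// ge0_muleDr ?W_ge0//.
rewrite (hemi false) (hemi true).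
rewrite (ge0_integral_lebesgue_tupleS2 mball_g ball_g0).
pose G (s : bool) (w : measurableTypeR R * n.-tuple R) : \bar R :=
  (\1_(`]0%R, +oo[%classic : set R) w.1)%:E * ball_g (cons_pair ((-1) ^+ s * w.1, w.2)%R).
have mG s : measurable_fun setT (G s).
  apply: emeasurable_funM.
    apply/measurable_EFinP.
    have mi : measurable_fun setT (\1_(`]0%R, +oo[%classic : set R) : measurableTypeR R -> R).
      exact: measurable_indic.
    exact: (measurableT_comp mi measurable_fst).
  apply: (measurableT_comp mball_g); apply: measurable_fun_cons_pair; last exact: measurable_snd.
  by apply: measurable_funM; [exact: measurable_cst|exact: measurable_fst].
have G0 s w : 0 <= G s w by rewrite mule_ge0// lee_fin.
have GE (s : bool) z : \int[mu]_(a in `]0%R, +oo[) ball_g (cons_pair ((-1) ^+ s * a, z)%R) =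
    fubini_G mu (G s) z.
  rewrite [LHS]integral_mkcond; apply: eq_integral => a _.
  rewrite patchE /G/= indicE; case: ifPn; first by rewrite mul1e.
  by rewrite mul0e.
rewrite -ge0_integralD//.
- apply: eq_integral => z _.
  have mbz : measurable_fun setT (fun a : R => ball_g (cons_pair (a, z))).
    apply: (measurableT_comp mball_g); apply: measurable_fun_cons_pair.
      exact: measurable_id.
    exact: measurable_cst.
  rewrite [RHS](ge0_integral_halves mbz (fun a => ball_g0 _)).
  by congr (_ + _); apply: eq_integral => a _; rewrite ?mul1r ?mulN1r.
- by move=> z _; exact: integral_ge0.
- rewrite (_ : (fun z => _) = fubini_G mu (G false)); last by apply/funext => z; exact: GE.
  exact: (measurable_fun_fubini_tonelli_G _ (mG _) (G0 _)).
- by move=> z _; exact: integral_ge0.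
- rewrite (_ : (fun z => _) = fubini_G mu (G true)); last by apply/funext => z; exact: GE.
  exact: (measurable_fun_fubini_tonelli_G _ (mG _) (G0 _)).
Qed.
End cone.

(** * Invariance of the volume under isometries *)

Section sphere_isometry.
Context (R : realType) (n : nat).
Notation mu := (@lebesgue_measure R).

Lemma kappa_gt0 : (0 < @kappa R n)%E.
Proof.
rewrite /kappa; apply: (@lt_le_trans _ _ (\int[mu]_(r in `[2^-1%R, 1%R[) ((2^-1 ^+ n)%:E))%E).
  rewrite integral_cst//= lebesgue_measure_itv/= lte_fin.
  rewrite ifT; last by rewrite invf_lt1 ?ltr1n.
  rewrite -EFinB -EFinM lte_fin mulr_gt0 ?exprn_gt0 ?invr_gt0//.
  by rewrite subr_gt0 invf_lt1 ?ltr1n.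
rewrite [leLHS]integral_mkcond; apply: ge0_le_integral => //.
- by move=> r _; rewrite patchE; case: ifP => // _; rewrite lee_fin exprn_ge0.
- apply/(measurable_restrictT _ _).1 => //.
- apply/measurable_EFinP; apply: measurable_funM => //; exact: exprn_measurable.
move=> r _; rewrite patchE indicE !mem_setE !in_itv/=; case: ifPn => [/andP[r0 r1]|_].
  have r0' : 0 < r by rewrite (lt_le_trans _ r0).
  by rewrite r0' r1 mul1r lee_fin lerXn2r// nnegrE ltW.
rewrite lee_fin; case/boolP: (_ < _ < _); last by rewrite mul0r.
by move=> /andP[r0 _]; rewrite mul1r exprn_ge0// ltW.
Qed.

Lemma kappa_lty : (@kappa R n < +oo)%E.
Proof.
rewrite /kappa; apply: (@le_lt_trans _ _ (\int[mu]_(r in `]0%R, 1%R[) (cst 1%E r))%E).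
  rewrite [leRHS]integral_mkcond; apply: ge0_le_integral => //.
  - move=> r _; rewrite indicE mem_setE in_itv lee_fin/=; case/boolP: (_ < _ < _); last by rewrite mul0r.
    by move=> /andP[r0 _]; rewrite mul1r exprn_ge0// ltW.
  - apply/measurable_EFinP; apply: measurable_funM => //; exact: exprn_measurable.
  - apply/(measurable_restrictT _ _).1 => //.
  - move=> r _; rewrite patchE indicE mem_setE in_itv/=; case: ifPn => [/andP[r0 r1]|_]; last by rewrite mul0r.
    by rewrite mul1r lee_fin exprn_ile1// ltW.
rewrite integral_cst//= lebesgue_measure_itv/= lte_fin ltr01 oppr0 adde0 mul1e.
exact: ltry.
Qed.

Definition smap (T : n.+1.-tuple R -> n.+1.-tuple R) (q : sphere R n) : sphere R n :=
  insubd q (T (\val q)).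

Lemma val_smap T q : linear_isometry T -> \val (smap T q) = T (\val q).
Proof.
by move=> [dT _ _]; rewrite val_insubd ifT// /on_sphere dT; exact: (valP q).
Qed.

Lemma measurable_smap T : linear_isometry T -> measurable_fun setT (smap T).
Proof.
move=> iT; apply: measurable_to_sphere.
rewrite (_ : (fun _ => _) = fun q => T (\val q)); last first.
  by apply/funext => q; rewrite val_smap.
by case: iT => _ _ [mT _]; exact: (measurableT_comp mT (@measurable_sphere_val R n)).
Qed.

Lemma smap_normalize T v : linear_isometry T -> 0 < dotp v v ->
  smap T (normalize v) = normalize (T v).
Proof.
move=> iT v0; have [dT hT _] := iT.
by apply: val_inj; rewrite val_smap// !val_normalize ?dT// hT.
Qed.

Local Open Scope ereal_scope.

Lemma ge0_integral_smap T (g : sphere R n -> \bar R) : linear_isometry T ->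
  measurable_fun setT g -> (forall q, 0 <= g q) ->
  \int[sphere_volume R n]_q g (smap T q) = \int[sphere_volume R n]_q g q.
Proof.
move=> iT mg g0; have [dT _ [mT pT]] := iT.
have k0 := kappa_gt0; have koo := kappa_lty.
have kfin : @kappa R n \is a fin_num by rewrite ge0_fin_numE// ltW.
(* Being positive and finite, [kappa] can be cancelled once the cone formula has been used on both
   sides. *)
suff : @kappa R n * \int[sphere_volume R n]_q g (smap T q) = @kappa R n * \int[sphere_volume R n]_q g q.
  move/(congr1 (fun x => ((fine (@kappa R n))^-1)%:E * x)).
  have kK : ((fine (@kappa R n))^-1)%:E * @kappa R n = 1.
    by rewrite -[X in _ * X](fineK kfin) -EFinM mulVf// gt_eqF// fine_gt0// k0.
  by rewrite !muleA kK !mul1e.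
have mgT := measurableT_comp mg (measurable_smap iT).
rewrite (cone_formula mgT (fun q => g0 _)) (cone_formula mg g0).
set B := [set v | _]; pose F v := (\1_B v)%:E * g (normalize v).
rewrite -[RHS](pT F); last 2 first.
- apply: emeasurable_funM.
    by apply/measurable_EFinP; apply: measurable_indic; exact: measurable_punctured_ball.
  exact: (measurableT_comp mg (@measurable_normalize R n)).
- by move=> v; rewrite mule_ge0// lee_fin.
apply: eq_integral => v _; rewrite /F !indicE.
have -> : (T v \in B) = (v \in B) by apply/idP/idP; rewrite !inE /B/= dT.
case/boolP: (v \in B); last by rewrite !mul0e.
by rewrite inE/= => /andP[v0 _]; rewrite /= smap_normalize.
Qed.
End sphere_isometry.

(** * Polar coordinates *)

Section polar.
Context (R : realType) (m : nat).
Local Open Scope ereal_scope.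
Notation mu := (@lebesgue_measure R).

Lemma sphere_volumeT n : sphere_volume R n [set: sphere R n] =
  2%:E * \int[lebesgue_tuple R n]_x (weight x)%:E.
Proof.
rewrite -[LHS]mul1e -integral_cst//.
rewrite (@ge0_integral_sphere_volume R n (cst 1)) ?lee01//.
by rewrite mule_natl mule2n; congr (_ + _); apply: eq_integral => x _; rewrite mule1.
Qed.

Let K (h : R -> \bar R) (s : R) : \bar R :=
  ((\1_(`](-1)%R, 1%R[%classic : set R) s * (Num.sqrt (1 - s ^+ 2) ^+ m / Num.sqrt (1 - s ^+ 2)))%:E * h s)%E.

(** The slice of the unit ball at height s is a ball of radius rho = sqrt (1 - s^2): rescaling z by
    rho gives rho^m, and the weight itself gains 1 / rho. *)
Let slice (s : R) : \int[lebesgue_tuple R m]_z (weight (cons_pair (s, z)))%:E =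
  (\1_(`](-1)%R, 1%R[%classic : set R) s * (Num.sqrt (1 - s ^+ 2) ^+ m / Num.sqrt (1 - s ^+ 2)))%:E *
  \int[lebesgue_tuple R m]_z (weight z)%:E.
Proof.
rewrite indicE mem_setE in_itv/= -ltr_norml.
have -> : (`|s| < 1 = (s ^+ 2 < 1))%R.
  by rewrite -real_normK ?num_real// expr_lt1.
have [s1|s1] := ltP (s ^+ 2)%R 1%R; last first.
  rewrite !mul0r mul0e integral0_eq// => z _.
  rewrite /weight indicE memNset ?mul0r//= dotp_cons -expr2.
  by apply/negP; rewrite -leNgt (le_trans s1)// lerDl dotp_ge0.
set rho : R := Num.sqrt _.
have p : (0 < 1 - s ^+ 2)%R by rewrite subr_gt0.
have rho0 : (0 < rho)%R by rewrite sqrtr_gt0.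
have rho2 : (rho ^+ 2 = 1 - s ^+ 2)%R by rewrite sqr_sqrtr// ltW.
have mw := @measurable_weight R m.
rewrite mul1r (@ge0_integral_scale R m rho^-1 (fun z => (weight z)%:E)); last 3 first.
- by rewrite invr_eq0 gt_eqF.
- exact/measurable_EFinP.
- by move=> z; rewrite lee_fin weight_ge0.
rewrite muleA -EFinM gtr0_norm ?invr_gt0// mulrAC -exprMn mulfV ?gt_eqF// expr1n mul1r.
rewrite -ge0_integralZl//; last 3 first.
- by apply/measurable_EFinP; apply: (measurableT_comp mw); exact: measurable_scale.
- by move=> z _; rewrite lee_fin weight_ge0.
- by rewrite lee_fin invr_ge0 ltW.
apply: eq_integral => z _; rewrite -EFinM; congr EFin.
rewrite /weight !indicE.
have E : (1 - dotp (scale rho^-1 z) (scale rho^-1 z) =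
    (1 - dotp (cons_pair (s, z)) (cons_pair (s, z))) / rho ^+ 2)%R.
  rewrite dotpZl dotpZr dotp_cons -expr2 mulrA -expr2 exprVn opprD addrA -rho2.
  by field; rewrite gt_eqF.
have -> : (scale rho^-1 z \in [set y : m.-tuple R | dotp y y < 1]%R) =
    ((cons_pair (s, z) : m.+1.-tuple R) \in [set y : m.+1.-tuple R | dotp y y < 1]%R).
  apply/idP/idP; rewrite !inE/= -[in X in _ -> X]subr_gt0 -[in X in X -> _]subr_gt0 E.
    by rewrite pmulr_lgt0// invr_gt0 exprn_gt0.
  by rewrite pmulr_lgt0// invr_gt0 exprn_gt0.
case/boolP: (_ \in _); last by rewrite !mul0r mulr0.
rewrite inE/= -subr_gt0 !mul1r => q0; rewrite E sqrtrM ?ltW//.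
rewrite -exprVn sqrtr_sqr ger0_norm ?invr_ge0 ?ltW// invfM invrK.
by rewrite mulrCA mulVf ?mulr1// gt_eqF.
Qed.

Let mK (h : R -> \bar R) : measurable_fun setT h -> measurable_fun setT (K h).
Proof.
move=> mh; apply: emeasurable_funM => //; apply/measurable_EFinP.
apply: measurable_funM; first exact: measurable_indic.
have mr : measurable_fun setT (fun s : R => Num.sqrt (1 - s ^+ 2)).
  apply: (measurableT_comp (@measurable_sqrt R)); exact: measurable_funB.
apply: measurable_funM; first exact: measurable_funX.
exact: (measurableT_comp (@measurable_inv R)).
Qed.

Let K0 (h : R -> \bar R) : (forall x, 0 <= h x) -> forall s, 0 <= K h s.
Proof.
by move=> h0 s; rewrite mule_ge0// lee_fin mulr_ge0// divr_ge0 ?exprn_ge0// sqrtr_ge0.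
Qed.

(** The charts project along the first coordinate, so the second one is a plain coordinate of the
    chart. Both charts contribute equally, and twice the integral of the weight is the volume of
    S^m. *)
Lemma polar_chart (h : R -> \bar R) : measurable_fun setT h -> (forall x, 0 <= h x) ->
  \int[sphere_volume R m.+1]_q h (thead (ttail (\val q))) =
  sphere_volume R m setT * \int[mu]_s K h s.
Proof.
move=> mh h0.
pose g (q : sphere R m.+1) := h (thead (ttail (\val q))).
have mg : measurable_fun setT g.
  apply: (measurableT_comp mh).
  apply: (measurableT_comp (@measurable_thead R m)).
  apply: (measurableT_comp (@measurable_ttail R _)).
  exact: measurable_sphere_val.
rewrite (ge0_integral_sphere_volume mg (fun q => h0 _)).
have E (s : bool) : \int[lebesgue_tuple R m.+1]_x ((weight x)%:E * g (chart s x)) =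
    (\int[lebesgue_tuple R m]_z (weight z)%:E) * \int[mu]_s K h s.
  pose G (x : m.+1.-tuple R) := (weight x)%:E * h (thead x).
  have mG : measurable_fun setT G.
    apply: emeasurable_funM; first by apply/measurable_EFinP; exact: measurable_weight.
    by apply: (measurableT_comp mh); exact: measurable_thead.
  have G0 x : 0 <= G x by rewrite mule_ge0// lee_fin weight_ge0.
  transitivity (\int[lebesgue_tuple R m.+1]_x G x).
    apply: eq_integral => x _; rewrite /G /weight indicE.
    case/boolP: (x \in _); last by rewrite !mul0r !mul0e.
    by rewrite inE/= => x1; rewrite /g val_chart// ttail_cons.
  rewrite (ge0_integral_lebesgue_tupleS mG G0).
  have mw : measurable_fun setT (fun x : m.+1.-tuple R => (weight x)%:E).
    by apply/measurable_EFinP; exact: measurable_weight.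
  transitivity (\int[mu]_s ((\int[lebesgue_tuple R m]_z (weight z)%:E) * K h s)).
    apply: eq_integral => s' _; rewrite /G/=.
    under eq_integral do rewrite thead_cons.
    rewrite ge0_integralZr//; last 2 first.
    - exact: (measurable_comp_cons_pairl s' mw).
    - by move=> z _; rewrite lee_fin weight_ge0.
    by rewrite slice /K muleAC muleC.
  rewrite ge0_integralZl//.
  - exact: mK.
  - by move=> s' _; exact: K0.
  - by apply: integral_ge0 => z _; rewrite lee_fin weight_ge0.
by rewrite !E sphere_volumeT -mule2n -mule_natl muleA.
Qed.

Hypothesis m0 : (0 < m)%N.

Let K_cos (h : R -> \bar R) : measurable_fun setT h -> (forall x, 0 <= h x) ->
  \int[mu]_s K h s = \int[mu]_(phi in `[0%R, pi]) (h (cos phi) * (sin phi ^+ m)%:E).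
Proof.
move=> mh h0.
(* The reflection s -> - s lets the substitution be the increasing map - cos. *)
rewrite (@ge0_integral_affine R (-1) 0 _ _ (mK mh) (K0 h0)); last by rewrite oppr_eq0 oner_eq0.
rewrite normrN1 mul1e.
under eq_integral do rewrite addr0 mulN1r.
have mKN : measurable_fun setT (fun s : R => K h (- s)%R).
  by apply: (measurableT_comp (mK mh)); exact: oppr_measurable.
transitivity (\int[mu]_(s in `[(-1)%R, 1%R]) K h (- s)%R).
  rewrite [RHS]integral_mkcond; apply: eq_integral => s _; rewrite patchE.
  case: ifPn => //; rewrite mem_setE in_itv/= => out.
  rewrite /K indicE mem_setE in_itv/= ltrNl opprK ltrNl.
  case/boolP: (_ < _ < _)%R; last by rewrite mul0r mul0e.
  by move=> /andP[s1 s2]; move: out; rewrite (ltW s1) (ltW s2).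
have dcos (x : R) : is_derive x 1%R (fun t : R => - cos t)%R (sin x).
  have H := derive_opp (is_derive_cos x).
  by apply: (is_derive_eq H); rewrite opprK.
have csin : continuous (@sin R) by exact: continuous_sin.
have := @ge0_integral_substitution R (fun t => - cos t)%R (@sin R) 0 pi (pi_ge0 R) csin
  dcos _ _ _ mKN (fun s => K0 h0 _).
rewrite cos0 cospi opprK => ->; last 2 first.
- by move=> x /andP[x0 xpi]; apply: sin_ge0_pi; rewrite x0.
- move=> x y xI yI xy; rewrite ltrN2; rewrite ltr_cos//.
apply: eq_integral => phi; rewrite inE/= in_itv/= => /andP[p0 ppi].
rewrite opprK /K -sin2cos2 sqrtr_sqr ger0_norm; last by apply: sin_ge0_pi; rewrite p0.
rewrite indicE mem_setE in_itv/=.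
(* At the ends of [[0, pi]] both sides vanish; on the right this is where m > 0 enters. *)
have [s0|s0] := eqVneq (sin phi) 0%R.
  by rewrite s0 mul0e expr0n gtn_eqF// mule0.
have -> : (-1 < cos phi < 1)%R.
  rewrite -ltr_norml -[X in (X < _)%R]ger0_norm// -(expr_lt1 (n := 2))// normr_id.
  by rewrite real_normK ?num_real// cos2sin2 ltrBlDr ltrDl exprn_even_gt0.
by rewrite mul1r muleA -EFinM mulrC divfK// muleC.
Qed.

(** A quarter-turn brings the first coordinate to the place of the second, for which the formula is
    [polar_chart]. *)
Lemma ge0_integral_polar (h : R -> \bar R) : measurable_fun setT h -> (forall x, 0 <= h x) ->
  \int[sphere_volume R m.+1]_q h (thead (\val q)) =
  sphere_volume R m setT * \int[mu]_(phi in `[0%R, pi]) (h (cos phi) * (sin phi ^+ m)%:E).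
Proof.
move=> mh h0; rewrite -K_cos// -polar_chart//.
have cs : (0 ^+ 2 + 1 ^+ 2 = 1 :> R)%R by rewrite expr0n expr1n add0r.
have iT := @isometry_rotate R m 0 1 cs.
have mg : measurable_fun setT (fun q : sphere R m.+1 => h (thead (\val q))).
  apply: (measurableT_comp mh); apply: (measurableT_comp (@measurable_thead R _)).
  exact: measurable_sphere_val.
rewrite -(ge0_integral_smap iT mg (fun q => h0 _)).
apply: eq_integral => q _.
by rewrite val_smap// /rotate thead_cons mul0r add0r mul1r.
Qed.
End polar.

Section tuple_vectors.
Context (R : realType) (n : nat).
Implicit Types x y z : n.-tuple R.

Definition tadd x y : n.-tuple R := [tuple tnth x i + tnth y i | i < n].

Lemma dotpDl x y z : dotp (tadd x y) z = dotp x z + dotp y z.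
Proof.
by rewrite /dotp -big_split/=; apply: eq_bigr => i _; rewrite tnth_mktuple mulrDl.
Qed.

Lemma dotpDr x y z : dotp x (tadd y z) = dotp x y + dotp x z.
Proof. by rewrite dotpC dotpDl !(dotpC _ x). Qed.

(** Expand |x - <x, y> y|^2 >= 0. *)
Lemma dotp_cauchy x y : dotp y y = 1 -> dotp x y ^+ 2 <= dotp x x.
Proof.
move=> y1; have := dotp_ge0 (tadd x (scale (- dotp x y) y)).
rewrite !(dotpDl, dotpDr, dotpZl, dotpZr) y1 (dotpC y x).
set b := dotp x y; set a := dotp x x; lra.
Qed.

Lemma dotp_unit_itv x y : dotp x x = 1 -> dotp y y = 1 -> -1 <= dotp x y <= 1.
Proof.
move=> x1 y1; rewrite -ler_norml -(expr_le1 (n := 2))// real_normK ?num_real//.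
by rewrite -x1; exact: dotp_cauchy.
Qed.
End tuple_vectors.

Section acos.
Context (R : realType).

Lemma acos_out (x : R) : ~~ (-1 <= x <= 1) -> acos x = 0.
Proof.
move=> x1; rewrite unlock /acos; case: xgetP => //= y _ [_ yx].
by move: x1; rewrite -yx cos_geN1 cos_le1.
Qed.

Lemma measurable_acos : measurable_fun setT (@acos R).
Proof.
rewrite -(setUv (`]-1, 1[%classic : set R)).
apply/measurable_funU => //; first exact: measurableC.
split.
  apply: open_continuous_measurable_fun => // x; rewrite inE/= in_itv/=.
  exact: continuous_acos.
(* Away from ]-1, 1[ the value is pi at -1 and 0 at every other point: at 1 by computation, outside
   [-1, 1] by default. *)
apply: (@eq_measurable_fun _ _ _ _ _ (fun x : R => if x == -1 then pi else 0)).
  move=> x; rewrite inE/= in_itv/= => /negP x1.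
  have [->|xN1] := eqVneq x (-1); first by rewrite acosN1.
  have [->|x1'] := eqVneq x 1; first by rewrite acos1.
  rewrite acos_out//; apply: contra x1.
  by rewrite !le_eqVlt (eq_sym (-1)) (negbTE xN1) (negbTE x1').
apply: measurable_funTS; apply: measurable_fun_ifT => //.
exact: measurable_fun_eqr.
Qed.
End acos.

(** * Measures with a radial density *)

Section radial_measure.
Context (R : realType) (m : nat).
Hypothesis m0 : (0 < m)%N.
Variable f : R -> R.
Hypothesis f_meas : measurable_fun (`[0, pi] : set R) f.
Hypothesis f_ge0 : forall phi : R, 0 <= phi <= pi -> 0 <= f phi.
Notation S := (sphere R m.+1).
Notation V := (sphere_volume R m.+1).
Notation mu := (@lebesgue_measure R).

(* The density as a function of the cosine of the distance; [f] is measurable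
   only on [0, pi], whence the restriction. *)
Definition dens (u : R) : R := (f \_ `[0, pi]) (acos u).

Lemma measurable_dens : measurable_fun setT dens.
Proof.
apply: (measurableT_comp _ (@measurable_acos R)).
exact/(measurable_restrictT _ _).1.
Qed.

Lemma dens_ge0 u : 0 <= dens u.
Proof.
rewrite /dens patchE; case: ifPn => //; rewrite inE/= in_itv/=; exact: f_ge0.
Qed.

Lemma dens_cos phi : 0 <= phi <= pi -> dens (cos phi) = f phi.
Proof. by move=> p; rewrite /dens cosK ?in_itv// patchE mem_set//= in_itv. Qed.

Lemma sphere_unit (q : S) : dotp (\val q) (\val q) = 1.
Proof. exact/eqP/(valP q). Qed.

Lemma dens_sdist (p q : S) : dens (dotp (\val p) (\val q)) = f (sdist p q).
Proof.
have pq := dotp_unit_itv (sphere_unit p) (sphere_unit q).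
by rewrite /dens patchE mem_set//= in_itv/= acos_ge0// acos_lepi.
Qed.

Lemma measurable_dotpl n (x : n.-tuple R) : measurable_fun setT (dotp x).
Proof.
rewrite /dotp; apply: measurable_sum => i.
by apply: measurable_funM => //; exact: measurable_tnth.
Qed.

Lemma measurable_dotp_sphere n (x : n.+1.-tuple R) :
  measurable_fun setT (fun q : sphere R n => dotp x (\val q)).
Proof. exact: (measurableT_comp (measurable_dotpl x) (@measurable_sphere_val R n)). Qed.

Definition north : m.+2.-tuple R := cons_pair (1, ztuple R m.+1).

Lemma dotp_north x : dotp north x = thead x.
Proof. by rewrite dotp_eta thead_cons ttail_cons dotp0l mul1r addr0. Qed.

(** A normal form for a pair of unit vectors that depends on <p, x> only, so pairs with equal inner
    products are congruent. *)
Lemma align_pair (p x : m.+2.-tuple R) : dotp p p = 1 -> dotp x x = 1 ->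
  exists T, [/\ linear_isometry T, T p = north &
    T x = cons_pair (dotp p x, cons_pair (Num.sqrt (1 - dotp p x ^+ 2), ztuple R m))].
Proof.
move=> p1 x1; have [T iT Tp] := isometry_align p.
rewrite p1 sqrtr1 in Tp.
have a : thead (T x) = dotp p x.
  by case: iT => dT _ _; rewrite -(dT p) Tp dotp_north.
have [U iU Ux] := isometry_align (ttail (T x)).
exists ((fun y => cons_pair (thead y, U (ttail y))) \o T); split.
- apply: isometry_comp => //; exact: isometry_cons.
- have : dotp (U (ztuple R m.+1)) (U (ztuple R m.+1)) = 0.
    by case: iU => dU _ _; rewrite dU dotp0l.
  by rewrite /= Tp thead_cons ttail_cons => /dotp_eq0 ->.
- rewrite /= Ux a; congr cons_pair; congr pair; congr cons_pair; congr pair; congr Num.sqrt.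
  apply/eqP; rewrite eq_sym subr_eq addrC; apply/eqP.
  by case: iT => dT _ _; rewrite -[LHS]x1 -a -[LHS]dT expr2 -dotp_eta.
Qed.

Local Open Scope ereal_scope.

Definition radial (p : m.+2.-tuple R) (nu : set S -> \bar R) : Prop :=
  forall A, measurable A ->
    nu A = \int[V]_q (dens (dotp p (\val q)) * \1_A q)%:E.

Lemma radial_integral p (nu : {measure set S -> \bar R}) (k : S -> \bar R) :
  radial p nu -> measurable_fun setT k -> (forall q, 0 <= k q) ->
  \int[nu]_q k q = \int[V]_q ((dens (dotp p (\val q)))%:E * k q).
Proof.
move=> rnu mk k0.
have md : measurable_fun setT (fun q : S => dens (dotp p (\val q))).
  exact: (measurableT_comp measurable_dens (measurable_dotp_sphere p)).
have mid : measurable_fun setT (@id S) by exact: measurable_id.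
exact: (@ge0_integral_transfer _ _ S S R V nu id _ mid md (fun q => dens_ge0 _) rnu).
Qed.

Lemma radial_align p x T (nu : {measure set S -> \bar R}) (k : R -> \bar R) :
  radial p nu -> linear_isometry T -> measurable_fun setT k -> (forall u, 0 <= k u) ->
  \int[nu]_q k (dotp x (\val q)) =
  \int[V]_q ((dens (dotp (T p) (\val q)))%:E * k (dotp (T x) (\val q))).
Proof.
move=> rnu iT mk k0.
have mkx y : measurable_fun setT (fun q : S => k (dotp y (\val q))).
  exact: (measurableT_comp mk (measurable_dotp_sphere y)).
rewrite (radial_integral rnu (mkx x) (fun q => k0 _)).
have mg : measurable_fun setT (fun q : S => (dens (dotp (T p) (\val q)))%:E * k (dotp (T x) (\val q))).
  apply: emeasurable_funM => //; apply/measurable_EFinP.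
  exact: (measurableT_comp measurable_dens (measurable_dotp_sphere (T p))).
rewrite -(ge0_integral_smap iT mg) => [|q]; last by rewrite mule_ge0// lee_fin dens_ge0.
by apply: eq_integral => q _; rewrite val_smap//; case: iT => dT _ _; rewrite !dT.
Qed.

(** Both integrals are computed on the common normal form. Positive and negative parts are moved
    separately, so that k may have an infinite integral. *)
Lemma radial_transport p x p' x' (nu nu' : {measure set S -> \bar R}) (k : R -> R) :
  radial p nu -> radial p' nu' ->
  dotp p p = 1%R -> dotp x x = 1%R -> dotp p' p' = 1%R -> dotp x' x' = 1%R ->
  dotp p x = dotp p' x' -> measurable_fun setT k ->
  \int[nu]_q (k (dotp x (\val q)))%:E = \int[nu']_q (k (dotp x' (\val q)))%:E.
Proof.
move=> rnu rnu' p1 x1 p1' x1' pxE mk.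
have [T [iT Tp Tx]] := align_pair p1 x1.
have [U [iU Up Ux]] := align_pair p1' x1'.
have H (k' : R -> \bar R) : measurable_fun setT k' -> (forall u, 0 <= k' u) ->
    \int[nu]_q k' (dotp x (\val q)) = \int[nu']_q k' (dotp x' (\val q)).
  move=> mk' k0; rewrite (radial_align x rnu iT mk' k0) (radial_align x' rnu' iU mk' k0).
  by rewrite Tp Tx Up Ux pxE.
have mkE : measurable_fun setT (EFin \o k) by exact/measurable_EFinP.
have Ep y : (fun q : S => (k (dotp y (\val q)))%:E)^\+ =
    fun q : S => ((EFin \o k)^\+)%E (dotp y (\val q)).
  by apply/funext => q; rewrite !funeposE.
have En y : (fun q : S => (k (dotp y (\val q)))%:E)^\- =
    fun q : S => ((EFin \o k)^\-)%E (dotp y (\val q)).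
  by apply/funext => q; rewrite !funenegE.
rewrite integralE [RHS]integralE !Ep !En; congr (_ - _).
  by apply: (H _ (measurable_funepos mkE)) => u; exact: funepos_ge0.
by apply: (H _ (measurable_funeneg mkE)) => u; exact: funeneg_ge0.
Qed.

Lemma radial_exists p : exists nu : {measure set S -> \bar R}, radial p nu.
Proof.
apply: (weighted_pushforward V (phi := id) (g := fun q : S => dens (dotp p (\val q)))).
- exact: measurable_id.
- exact: (measurableT_comp measurable_dens (measurable_dotp_sphere p)).
- by move=> q; exact: dens_ge0.
Qed.

Lemma radial_polar (nu : {measure set S -> \bar R}) (k : R -> \bar R) :
  radial north nu -> measurable_fun setT k -> (forall u, 0 <= k u) ->
  \int[nu]_q k (thead (\val q)) =
  sphere_volume R m setT * \int[mu]_(phi in `[0%R, pi])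
    ((f phi * sin phi ^+ m)%:E * k (cos phi)).
Proof.
move=> rnu mk k0.
have mkn : measurable_fun setT (fun q : S => k (thead (\val q))).
  have := measurableT_comp mk (measurable_dotp_sphere north).
  by congr measurable_fun; apply/funext => q/=; rewrite dotp_north.
rewrite (radial_integral rnu mkn (fun q => k0 _)).
have mh : measurable_fun setT (fun u => (dens u)%:E * k u).
  by apply: emeasurable_funM => //; apply/measurable_EFinP; exact: measurable_dens.
have h0 u : 0 <= (dens u)%:E * k u by rewrite mule_ge0// lee_fin dens_ge0.
under eq_integral do rewrite dotp_north.
rewrite (ge0_integral_polar m0 mh h0); congr (_ * _); apply: eq_integral => phi; rewrite inE/= in_itv/= => p0.
by rewrite dens_cos// EFinM -!muleA; congr (_ * _); rewrite muleC.
Qed.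

(** The exceptional points x and - x sit at sin phi = 0 in polar coordinates around x, where sin^m
    phi vanishes. The derivative formulas hold on ]-1, 1[ and are used outside such null sets. *)
Lemma radial_ae_lt1 p x (nu : {measure set S -> \bar R}) : radial p nu ->
  dotp x x = 1%R -> {ae nu, forall q, (-1 < dotp x (\val q) < 1)%R}.
Proof.
move=> rnu x1; pose k (u : R) : \bar R := ((1 <= u ^+ 2)%R%:R : R)%:E.
have mk : measurable_fun setT k.
  apply/measurable_EFinP; rewrite (_ : (fun _ => _) = fun u : R => if (1 <= u ^+ 2)%R then 1 else 0)%R.
    by apply: measurable_fun_ifT => //; exact: measurable_fun_ler.
  by apply/funext => u; case: leP.
have k0 u : 0 <= k u by rewrite lee_fin.
have [T iT Tx] := isometry_align x; rewrite x1 sqrtr1 -/north in Tx.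
have mkn : measurable_fun setT (fun q : S => k (thead (\val q))).
  have := measurableT_comp mk (measurable_dotp_sphere north).
  by congr measurable_fun; apply/funext => q/=; rewrite dotp_north.
have Vk : \int[V]_q k (thead (\val q)) = 0.
  rewrite (ge0_integral_polar m0 mk k0).
  rewrite [X in _ * X]integral0_eq ?mule0// => phi _.
  rewrite /k -EFinM; congr EFin; case: leP => c1; last by rewrite mul0r.
  have -> : (sin phi = 0)%R.
    by apply/eqP; rewrite -sqrf_eq0 eq_le sqr_ge0 andbT sin2cos2 subr_le0.
  by rewrite expr0n gtn_eqF// mulr0.
have nu0 : \int[nu]_q k (dotp x (\val q)) = 0.
  apply/eqP; rewrite eq_le; apply/andP; split; last first.
    by apply: integral_ge0.
  rewrite (radial_align x rnu iT mk k0) Tx.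
  (* The density may be unbounded, but even + oo times a nonnegative function of zero integral has
     integral 0. *)
  apply: (@le_trans _ _ (\int[V]_q (+oo * k (thead (\val q))))); last first.
    by rewrite ge0_integralZl// Vk mule0.
  apply: ge0_le_integral => //.
  - by move=> q _; rewrite mule_ge0// lee_fin dens_ge0.
  - apply: emeasurable_funM.
      apply/measurable_EFinP.
      exact: (measurableT_comp measurable_dens (measurable_dotp_sphere (T p))).
    exact: (measurableT_comp mk (measurable_dotp_sphere north)).
  - by apply: emeasurable_funM.
  - by move=> q _; rewrite dotp_north; apply: lee_wpmul2r => //; exact: leey.
pose A : set S := [set q | (1 <= dotp x (\val q) ^+ 2)%R].
have mA : measurable A.
  have m2 : measurable_fun setT (fun q : S => (1 <= dotp x (\val q) ^+ 2)%R).
    by apply: measurable_fun_ler => //; apply: measurable_funX; exact: measurable_dotp_sphere.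
  by rewrite -[A]setTI; exact: (m2 measurableT [set true]).
exists A; split => //.
  rewrite -[RHS]nu0 -[LHS]mul1e -integral_cst// integral_mkcond.
  apply: eq_integral => q _; rewrite patchE /k.
  have [Aq|Aq] := boolP (q \in A).
    by rewrite inE in Aq; rewrite Aq.
  by rewrite notin_setE in Aq; move/negP/negbTE : Aq => ->.
move=> q /=; apply: contra_notP => /negP.
rewrite -ltNge => H; rewrite -ltr_norml -(expr_lt1 (n := 2))// real_normK//.
exact: num_real.
Qed.
End radial_measure.

(** * Estimates in one variable *)

Section trigonometric_inequalities.
Context (R : realType).
Implicit Types (x u : R).

Lemma ge0_from0 (F dF : R -> R) x : 0 <= x ->
  (forall t : R, is_derive t 1 F (dF t)) -> (forall t, 0 <= t <= x -> 0 <= dF t) ->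
  F 0 = 0 -> 0 <= F x.
Proof.
move=> x0 dFE dF0 F0.
have cF : {within `[0, x], continuous F}.
  by apply: continuous_subspaceT => t; exact: is_derive_continuous (dFE t).
have [c] := MVT_segment x0 (fun t _ => dFE t) cF.
by rewrite in_itv/= F0 !subr0 => cx ->; rewrite mulr_ge0// dF0.
Qed.

Lemma mulx_cos_le_sin x : 0 <= x <= pi -> x * cos x <= sin x.
Proof.
move=> /andP[x0 xpi]; rewrite -subr_ge0.
apply: (@ge0_from0 (fun t => sin t - t * cos t) (fun t => t * sin t)) => //.
- move=> t; apply: is_derive_eq.
  by rewrite /GRing.scale/=; ring.
- by move=> t /andP[t0 tx]; rewrite mulr_ge0// sin_ge0_pi// t0 (le_trans tx).
- by rewrite sin0 mul0r subr0.
Qed.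

Lemma sin_cos_le x : 0 <= x -> sin x * cos x <= x.
Proof.
move=> x0; rewrite -subr_ge0.
apply: (@ge0_from0 (fun t => t - sin t * cos t) (fun t => 2 * sin t ^+ 2)) => //.
- move=> t; apply: is_derive_eq.
  by rewrite /GRing.scale/= -[X in X - _](cos2Dsin2 t); ring.
- by move=> t _; rewrite mulr_ge0// sqr_ge0.
- by rewrite sin0 mul0r subr0.
Qed.

(** Up to sign the numerator of [ddxcot]: it makes [xcot] concave in u, which bounds its second
    differences from above. *)
Lemma sin_cubic_ge0 x : 0 <= x <= pi -> 0 <= 3 * sin x - sin x ^+ 3 - 3 * (x * cos x).
Proof.
move=> /andP[x0 xpi].
apply: (@ge0_from0 (fun t => 3 * sin t - sin t ^+ 3 - 3 * (t * cos t))
  (fun t => 3 * sin t * (t - sin t * cos t))) => //.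
- move=> t; apply: is_derive_eq.
  by rewrite /GRing.scale/=; rewrite /=; ring.
- move=> t /andP[t0 tx]; rewrite mulr_ge0// ?subr_ge0 ?sin_cos_le//.
  by rewrite mulr_ge0// sin_ge0_pi// t0 (le_trans tx).
- by rewrite sin0 expr0n /= !mulr0 mul0r mulr0 !subr0.
Qed.

Lemma one_sub_cos_le x : 1 - cos x <= x ^+ 2 / 2.
Proof.
wlog x0 : x / 0 <= x.
  move=> H; have [/H//|x0] := leP 0 x.
  by rewrite -cosN -(sqrrN x) H// oppr_ge0 ltW.
rewrite -subr_ge0 opprB.
apply: (@ge0_from0 (fun t => t ^+ 2 / 2 + (cos t - 1)) (fun t => t - sin t)) => //.
- move=> t; apply: is_derive_eq.
  by rewrite /GRing.scale/=; rewrite /=; field.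
- move=> t /andP[t0 _]; rewrite -(_ : (fun t => t - sin t) t = t - sin t)//.
  apply: (@ge0_from0 (fun t => t - sin t) (fun t => 1 - cos t)) => //.
  by rewrite sin0 subr0.
- by rewrite cos0 expr0n mul0r subrr addr0.
Qed.

Lemma sin_sqr_le x : sin x ^+ 2 <= x ^+ 2.
Proof.
have := one_sub_cos_le x; have := cos2Dsin2 x; have := cos_le1 x; have := cos_geN1 x.
nra.
Qed.
End trigonometric_inequalities.

(** * Second differences along great circles *)

Section second_difference.
Context (R : realType).
Implicit Types (f q dq : R -> R).

Lemma is_derive_eps f (x a e : R) : is_derive x 1 f a -> 0 < e ->
  exists2 d : R, 0 < d & forall h : R, h != 0 -> `|h| < d -> `|(f (x + h) - f x) / h - a| <= e.
Proof.
move=> df e0; have [D Dv] := df.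
have : h^-1 *: ((f \o shift x) (h *: 1) - f x) @[h --> 0^'] --> a by rewrite -Dv.
move=> /cvgrPdist_le /(_ _ e0) [d /= d0 H].
exists d => // h h0 hd.
have /= := H h; rewrite sub0r normrN => /(_ hd h0).
by rewrite distrC [h *: 1]mulr1 [h + x]addrC [_ *: _]mulrC.
Qed.

(** A second-order Taylor formula with a second derivative at 0 only: the derivative of q - c h^2 is
    o(h), and the mean value theorem turns this into o(h^2). *)
Lemma second_difference_eps q dq (c d : R) : 0 < d ->
  (forall h : R, `|h| < d -> is_derive h 1 q (dq h)) -> q 0 = 0 -> dq 0 = 0 ->
  is_derive (0 : R) 1 dq (2 * c) ->
  forall e : R, 0 < e -> exists2 d' : R, 0 < d' &
    forall h : R, h != 0 -> `|h| < d' -> `|q h / h ^+ 2 - c| <= e.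
Proof.
move=> d0 Dq q0 dq0 Ddq e e0.
have [d1 d10 H] := is_derive_eps Ddq e0.
exists (Num.min d d1); first by rewrite lt_min d0.
move=> h h0; rewrite lt_min => /andP[hd hd1].
pose p (t : R) := q t - c * t ^+ 2.
pose dp (t : R) := dq t - 2 * c * t.
have Dp (t : R) : `|t| < d -> is_derive t 1 p (dp t).
  move=> td; have Dt := Dq t td.
  have H' := derive_sub Dt (derive_mul (derive_const t c) (derive_exp 2 (derive_id t))).
  by apply: (is_derive_eq H'); rewrite /dp; ring.
have cp (a b : R) : -d < a -> b < d -> {within `[a, b], continuous p}.
  move=> da bd; apply: continuous_in_subspaceT => t; rewrite inE/= in_itv/= => /andP[ta tb].
  apply: (is_derive_continuous (Dp t _)).
  by rewrite ltr_norml (lt_le_trans da ta) (le_lt_trans tb bd).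
have dpb (t : R) : t != 0 -> `|t| < d1 -> `|dp t| <= e * `|t|.
  move=> t0 td1; have := H t t0 td1; rewrite add0r dq0 subr0.
  rewrite -(ler_pM2r (_ : 0 < `|t|)) ?normr_gt0// -normrM mulrBl divfK//.
have p0 : p 0 = 0 by rewrite /p q0 expr0n mulr0 subrr.
suff E : `|p h| <= e * h ^+ 2.
  have h2 : 0 < h ^+ 2 by rewrite exprn_even_gt0.
  rewrite -(ler_pM2r h2) -[X in _ * X <= _]gtr0_norm// -normrM mulrBl divfK ?gt_eqF//.
move: hd hd1; rewrite !ltr_norml => /andP[hdl hdr] /andP[hd1l hd1r].
have [hlt|hgt|hE] := ltgtP 0 h; last by rewrite -hE eqxx in h0.
- have D' (t : R) : t \in `]0, h[ -> is_derive t 1 p (dp t).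
    rewrite in_itv/= => /andP[t0 th]; apply: Dp.
    by rewrite gtr0_norm// (lt_trans th).
  have d0' : - d < 0 by rewrite oppr_lt0.
  have [t tI] := MVT hlt D' (cp 0 h d0' hdr).
  move: tI; rewrite in_itv/= p0 !subr0 => /andP[t0 th] ->.
  rewrite normrM (gtr0_norm hlt) expr2 mulrA ler_pM2r//.
  have td1 : `|t| < d1 by rewrite gtr0_norm// (lt_trans th).
  have tn0 : t != 0 by rewrite gt_eqF.
  by rewrite (le_trans (dpb t tn0 td1))// ler_pM2l// gtr0_norm// ltW.
- have D' (t : R) : t \in `]h, 0[ -> is_derive t 1 p (dp t).
    rewrite in_itv/= => /andP[t0 th]; apply: Dp.
    by rewrite ltr0_norm// ltrNl (lt_trans hdl).
  have [t tI] := MVT hgt D' (cp h 0 hdl d0).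
  move: tI; rewrite in_itv/= p0 !sub0r => /andP[t0 th] E.
  rewrite -normrN E normrM normrN (ltr0_norm hgt) -(sqrrN h) expr2 mulrA ler_pM2r ?oppr_gt0//.
  have td1 : `|t| < d1 by rewrite ltr0_norm// ltrNl (lt_trans hd1l).
  have tn0 : t != 0 by rewrite lt_eqF.
  by rewrite (le_trans (dpb t tn0 td1))// ler_pM2l// ltr0_norm// lerN2 ltW.
Qed.

(** On the great circle from x with unit velocity e, the inner product with q is u cos h + v sin h,
    where u = <x, q> and v = <e, q>. The term - u k' in the limit comes from the curvature of the
    circle. *)
Lemma second_difference_circle (k dk : R -> R) (ddk u v : R) :
  (forall t : R, -1 < t < 1 -> is_derive t 1 k (dk t)) -> -1 < u < 1 ->
  is_derive u 1 dk ddk -> forall e : R, 0 < e -> exists2 d : R, 0 < d &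
    forall h : R, h != 0 -> `|h| < d ->
    `|(k (u * cos h + v * sin h) + k (u * cos h - v * sin h) - 2 * k u) / h ^+ 2
      - (v ^+ 2 * ddk - u * dk u)| <= e.
Proof.
move=> Dk u1 Ddk.
(* For small h the argument stays in ]-1, 1[, where k is differentiable. *)
have inI (w : R) : exists2 d : R, 0 < d & forall h : R, `|h| < d -> -1 < u * cos h + w * sin h < 1.
  have D : is_derive (0 : R) (1 : R) (fun h => u * cos h + w * sin h) w.
    apply: is_derive_eq; rewrite /GRing.scale/= sin0 cos0; ring.
  have C := is_derive_continuous D.
  have : \forall y \near (u * cos 0 + w * sin 0), y \in `]-1, 1[.
    apply: near_in_itvoo; rewrite sin0 cos0 mulr0 addr0 mulr1 in_itv//.
  move=> /C [d /= d0 H]; exists d => // h hd.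
  by have := H h; rewrite /= sub0r normrN => /(_ hd); rewrite in_itv.
have [d1 d10 H1] := inI v; have [d2 d20 H2] := inI (- v).
pose A h := u * cos h + v * sin h; pose B h := u * cos h + (- v) * sin h.
have DA h : is_derive (h : R) (1 : R) A (- u * sin h + v * cos h).
  by apply: is_derive_eq; rewrite /GRing.scale/=; ring.
have DB h : is_derive (h : R) (1 : R) B (- u * sin h - v * cos h).
  by apply: is_derive_eq; rewrite /GRing.scale/=; ring.
have A0 : A 0 = u by rewrite /A sin0 cos0 mulr0 addr0 mulr1.
have B0 : B 0 = u by rewrite /B sin0 cos0 mulr0 addr0 mulr1.
have mainlem := @second_difference_eps
  (fun h => k (A h) + k (B h) - 2 * k u)
  (fun h => dk (A h) * (- u * sin h + v * cos h) + dk (B h) * (- u * sin h - v * cos h))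
  (v ^+ 2 * ddk - u * dk u) (Num.min d1 d2).
move=> e e0; have [||||| d d0 H] := mainlem _ _ _ _ _ e e0.
- by rewrite lt_min d10.
- move=> h; rewrite lt_min => /andP[hd1 hd2].
  have H' := derive_sub (derive_add (derive_comp (f := k) (g := A) (Dk (A h) (H1 h hd1)) (DA h))
    (derive_comp (f := k) (g := B) (Dk (B h) (H2 h hd2)) (DB h))) (derive_const h (2 * k u)).
  by apply: (is_derive_eq H'); rewrite subr0.
- by rewrite A0 B0; ring.
- by rewrite A0 B0 sin0 cos0; ring.
- have DkA : is_derive (A 0) 1 dk ddk by rewrite A0.
  have DkB : is_derive (B 0) 1 dk ddk by rewrite B0.
  have DP (w : R) : is_derive (0 : R) (1 : R) (fun h => - u * sin h + w * cos h) (- u).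
    by apply: is_derive_eq; rewrite /GRing.scale/= sin0 cos0; ring.
  have H' := derive_add (derive_mul (derive_comp (f := dk) (g := A) DkA (DA 0)) (DP v))
    (derive_mul (derive_comp (f := dk) (g := B) DkB (DB 0)) (DP (- v))).
  have -> : (fun h => dk (A h) * (- u * sin h + v * cos h) + dk (B h) * (- u * sin h - v * cos h)) =
     (fun h => dk (A h) * (- u * sin h + v * cos h) + dk (B h) * (- u * sin h + (- v) * cos h)).
    by apply/funext => h; rewrite -(mulNr v).
  by apply: (is_derive_eq H'); rewrite A0 B0 sin0 cos0; ring.
exists d => // h h0 hd; have := H h h0 hd.
by rewrite /A /B mulNr.
Qed.
End second_difference.

Section distance_profile.
Context (R : realType).
Implicit Types (u v h : R).

(* For u = cos phi these are sin phi, phi^2 / 2 and phi cot phi; the prefixes d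
   and dd stand for the first two derivatives in u. *)
Definition sinac u : R := Num.sqrt (1 - u ^+ 2).
Definition halfsq u : R := 2^-1 * acos u ^+ 2.
Definition dhalfsq u : R := - acos u / sinac u.
Definition ddhalfsq u : R := (sinac u - u * acos u) / sinac u ^+ 3.
Definition xcot u : R := u * acos u / sinac u.
Definition dxcot u : R := (acos u - u * sinac u) / sinac u ^+ 3.
Definition ddxcot u : R :=
  - (3 * sinac u - sinac u ^+ 3 - 3 * (u * acos u)) / sinac u ^+ 5.

Lemma sqr_lt1 u : -1 < u < 1 -> u ^+ 2 < 1.
Proof. by rewrite -ltr_norml -real_normK ?num_real// expr_lt1. Qed.

Lemma sinac_gt0 u : -1 < u < 1 -> 0 < sinac u.
Proof. by move=> /sqr_lt1 u1; rewrite sqrtr_gt0 subr_gt0. Qed.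

Lemma sinac_sqr u : -1 < u < 1 -> sinac u ^+ 2 = 1 - u ^+ 2.
Proof. by move=> /sqr_lt1 u1; rewrite sqr_sqrtr// subr_ge0 ltW. Qed.

Let lt_le u : -1 < u < 1 -> -1 <= u <= 1.
Proof. by move=> /andP[/ltW -> /ltW ->]. Qed.

Lemma acos_itv u : -1 < u < 1 -> 0 <= acos u <= pi.
Proof. by move=> /lt_le ui; rewrite acos_ge0// acos_lepi. Qed.

Lemma mul_acos_le u : -1 < u < 1 -> u * acos u <= sinac u.
Proof.
move=> u1; have := mulx_cos_le_sin (acos_itv u1).
by rewrite sin_acos ?lt_le// acosK ?in_itv ?lt_le// mulrC.
Qed.

Lemma mul_sinac_le u : -1 < u < 1 -> u * sinac u <= acos u.
Proof.
move=> u1; have /andP[a0 _] := acos_itv u1; have := sin_cos_le a0.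
by rewrite sin_acos ?lt_le// acosK ?in_itv ?lt_le// mulrC.
Qed.

Lemma sinac_le_acos u : -1 < u < 1 -> sinac u <= acos u.
Proof.
move=> u1; rewrite /sinac -sin_acos ?lt_le//.
have /andP[a0 _] := acos_itv u1.
have := sin_sqr_le (acos u).
have s0 : 0 <= sin (acos u) by rewrite sin_acos ?lt_le// sqrtr_ge0.
by rewrite ler_pXn2r.
Qed.

Lemma cubic_acos_ge0 u : -1 < u < 1 ->
  0 <= 3 * sinac u - sinac u ^+ 3 - 3 * (u * acos u).
Proof.
move=> u1; have := sin_cubic_ge0 (acos_itv u1).
by rewrite sin_acos ?lt_le// acosK ?in_itv ?lt_le// (mulrC (acos u)).
Qed.

Lemma derive_sinac u : -1 < u < 1 -> is_derive u 1 sinac (- u / sinac u).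
Proof.
move=> u1; have p : 0 < 1 - u ^+ 2 by rewrite subr_gt0 sqr_lt1.
have D := derive_sub (derive_const u 1) (derive_exp 2 (derive_id u)).
have H := derive_comp (f := Num.sqrt) (g := fun t => 1 - t ^+ 2) (is_derive1_sqrt p) D.
apply: (is_derive_eq H); rewrite -/(sinac u).
by have := sinac_gt0 u1 => r0; rewrite /=; field; rewrite gt_eqF.
Qed.

Lemma derive_halfsq u : -1 < u < 1 -> is_derive u 1 halfsq (dhalfsq u).
Proof.
move=> u1; have Da := is_derive1_acos u1.
have H := derive_mul (derive_const u 2^-1) (derive_exp 2 Da).
apply: (is_derive_eq H); rewrite -/(sinac u) /dhalfsq.
by have := sinac_gt0 u1 => r0; rewrite /=; field; rewrite gt_eqF.
Qed.

Lemma derive_dhalfsq u : -1 < u < 1 -> is_derive u 1 dhalfsq (ddhalfsq u).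
Proof.
move=> u1; have Da := is_derive1_acos u1; have Dr := derive_sinac u1.
have r0 := sinac_gt0 u1; have r0' : sinac u != 0 by rewrite gt_eqF.
have H := derive_mul (derive_opp Da) (derive_inv r0' Dr).
apply: (is_derive_eq H); rewrite -/(sinac u) /ddhalfsq.
by field.
Qed.

Lemma derive_xcot u : -1 < u < 1 -> is_derive u 1 xcot (dxcot u).
Proof.
move=> u1; have Da := is_derive1_acos u1; have Dr := derive_sinac u1.
have r0 := sinac_gt0 u1; have r0' : sinac u != 0 by rewrite gt_eqF.
have H := derive_mul (derive_mul (derive_id u) Da) (derive_inv r0' Dr).
apply: (is_derive_eq H); rewrite -/(sinac u) /dxcot.
transitivity ((acos u * (sinac u ^+ 2 + u ^+ 2) - u * sinac u) / sinac u ^+ 3).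
  by field.
by rewrite sinac_sqr// subrK mulr1.
Qed.

Lemma derive_dxcot u : -1 < u < 1 -> is_derive u 1 dxcot (ddxcot u).
Proof.
move=> u1; have Da := is_derive1_acos u1; have Dr := derive_sinac u1.
have r0 := sinac_gt0 u1; have r0' : sinac u != 0 by rewrite gt_eqF.
have r3 : sinac u ^+ 3 != 0 by rewrite expf_neq0.
have H := derive_mul (derive_sub Da (derive_mul (derive_id u) Dr)) (derive_inv (f := fun t => sinac t ^+ 3) r3 (derive_exp 3 Dr)).
apply: (is_derive_eq H); rewrite -/(sinac u) /ddxcot.
have E := sinac_sqr u1; set r := sinac u in r0 r0' r3 E *; set a := acos u.
transitivity ((- (1 - u ^+ 2) * r ^+ 2 - r ^+ 4 + 3 * u * a * r - 3 * u ^+ 2 * r ^+ 2) / r ^+ 6).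
  by field.
rewrite -E (_ : u ^+ 2 = 1 - r ^+ 2); last by rewrite E; ring.
by field.
Qed.

Lemma laplacian_halfsq (m : nat) u : -1 < u < 1 ->
  (1 - u ^+ 2) * ddhalfsq u - m.+1%:R * (u * dhalfsq u) = 1 + m%:R * xcot u.
Proof.
move=> u1; have r0 := sinac_gt0 u1.
rewrite -sinac_sqr// /ddhalfsq /dhalfsq /xcot -natr1.
by field; rewrite gt_eqF.
Qed.

(* The only use of d < 4. *)
Lemma laplacian_xcot (m : nat) u : (m <= 2)%N -> -1 < u < 1 ->
  (1 - u ^+ 2) * ddxcot u - m.+1%:R * (u * dxcot u) <= - m%:R.
Proof.
move=> m2 u1; have r0 := sinac_gt0 u1; have r0' : sinac u != 0 by rewrite gt_eqF.
have E := sinac_sqr u1; have E2 : u ^+ 2 = 1 - sinac u ^+ 2 by rewrite E; ring.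
(* Apart from - m there remains - (2 - m) times [ddhalfsq u]. As [ddhalfsq u] >= 0, its sign is
   decided by m <= 2, that is d <= 3. *)
have -> : (1 - u ^+ 2) * ddxcot u - m.+1%:R * (u * dxcot u) =
    - (2 - m%:R) * ((sinac u - u * acos u) / sinac u ^+ 3) - m%:R.
  rewrite -E /ddxcot /dxcot -natr1.
  transitivity ((- (3 * sinac u - sinac u ^+ 3 - 3 * (u * acos u)) - (m%:R + 1) * (u * acos u - u ^+ 2 * sinac u)) / sinac u ^+ 3).
    by field.
  by rewrite E2; field.
rewrite gerDr mulNr oppr_le0 mulr_ge0//.
  by rewrite subr_ge0 (ler_nat _ _ 2).
by rewrite divr_ge0 ?subr_ge0 ?mul_acos_le// exprn_ge0// ltW.
Qed.
End distance_profile.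

(** * Bounds on second differences *)

Section second_difference_bounds.
Context (R : realType).
Implicit Types (u v h l : R).

Lemma convex_tangent (k dk ddk : R -> R) l : -1 <= l ->
  (forall t : R, l < t < 1 -> is_derive t 1 k (dk t)) ->
  (forall t : R, l < t < 1 -> is_derive t 1 dk (ddk t)) ->
  (forall t : R, l < t < 1 -> 0 <= ddk t) ->
  forall u b : R, l < u < 1 -> l < b < 1 -> dk u * (b - u) <= k b - k u.
Proof.
move=> l1 Dk Ddk ddk0.
have MV (F dF : R -> R) (a b : R) : (forall t : R, l < t < 1 -> is_derive t 1 F (dF t)) ->
    l < a < 1 -> l < b < 1 -> a < b -> exists2 c, a < c < b & F b - F a = dF c * (b - a).
  move=> DF /andP[la _] /andP[_ b1] ab.
  have DF' (t : R) : t \in `]a, b[ -> is_derive t 1 F (dF t).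
    by rewrite in_itv/= => /andP[ta tb]; apply: DF; rewrite (lt_trans la) ?(lt_trans tb).
  have cF : {within `[a, b], continuous F}.
    apply: continuous_in_subspaceT => t; rewrite inE/= in_itv/= => /andP[ta tb].
    by apply: (is_derive_continuous (DF t _)); rewrite (lt_le_trans la)// (le_lt_trans tb).
  have [c] := MVT ab DF' cF; rewrite in_itv/= => cI E; by exists c.
have mono a b : l < a < 1 -> l < b < 1 -> a < b -> dk a <= dk b.
  move=> aI bI ab; have [c /andP[ac cb] E] := MV dk ddk a b Ddk aI bI ab.
  rewrite -subr_ge0 E mulr_ge0 ?subr_ge0 ?(ltW ab)// ddk0//.
  by case/andP: aI => la _; case/andP: bI => _ b1; rewrite (lt_trans la)//= (lt_trans cb).
move=> u b uI bI; have [ub|bu|->] := ltgtP u b; last by rewrite !subrr mulr0.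
- have [c /andP[uc cb] ->] := MV k dk u b Dk uI bI ub.
  rewrite ler_pM2r ?subr_gt0// mono//.
  by case/andP: uI => lu _; case/andP: bI => _ b1; rewrite (lt_trans lu)//= (lt_trans cb).
- have [c /andP[bc cu] E] := MV k dk b u Dk bI uI bu.
  rewrite -[leRHS]opprB E -[b - u]opprB mulrN lerN2 ler_pM2r ?subr_gt0// mono//.
  by case/andP: bI => lb _; case/andP: uI => _ u1; rewrite (lt_trans lb)//= (lt_trans cu).
Qed.

Definition sdiff (k : R -> R) u v h : R :=
  k (u * cos h + v * sin h) + k (u * cos h - v * sin h) - 2 * k u.

(** Add the tangent line inequalities at u for the two end points: the terms in v sin h cancel, and
    k'(u) times 2 u (cos h - 1) is left. *)
Lemma convex_sdiff (k dk ddk : R -> R) l u v h : -1 <= l ->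
  (forall t : R, l < t < 1 -> is_derive t 1 k (dk t)) ->
  (forall t : R, l < t < 1 -> is_derive t 1 dk (ddk t)) ->
  (forall t : R, l < t < 1 -> 0 <= ddk t) ->
  l < u < 1 -> l < u * cos h + v * sin h < 1 -> l < u * cos h - v * sin h < 1 ->
  - (2 * (1 - cos h)) * (u * dk u) <= sdiff k u v h.
Proof.
move=> l1 Dk Ddk ddk0 uI AI BI.
have HA := convex_tangent l1 Dk Ddk ddk0 uI AI.
have HB := convex_tangent l1 Dk Ddk ddk0 uI BI.
rewrite /sdiff -subr_ge0; move: (lerD HA HB); rewrite -subr_ge0.
by congr (_ <= _); ring.
Qed.

Lemma one_sub_cos_itv h : 0 <= 2 * (1 - cos h) <= h ^+ 2.
Proof.
by have := one_sub_cos_le h; have := cos_le1 h; move=> H1 H2; apply/andP; split; lra.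
Qed.

(* Minorant of the second differences of [halfsq], needed for Fatou: unlike a
   constant, it survives the singularity of [xcot] at the antipode. *)
Definition cotbound u : R := if u < 0 then pi / sinac u else 0.

Lemma cotbound_ge0 u : 0 <= cotbound u.
Proof. by rewrite /cotbound; case: ifP => // _; rewrite divr_ge0// ?pi_ge0// sqrtr_ge0. Qed.

Lemma xcot_ge u : -1 < u < 1 -> - cotbound u <= xcot u.
Proof.
move=> u1; have r0 := sinac_gt0 u1; have /andP[a0 api] := acos_itv u1.
rewrite /cotbound /xcot; case: ltP => u0; last by rewrite oppr0 divr_ge0 ?mulr_ge0// ltW.
rewrite -mulNr ler_pM2r ?invr_gt0//; have /andP[uN1 _] := u1.
rewrite -[- pi]mulN1r; apply: (@le_trans _ _ (- 1 * acos u)).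
  by rewrite !mulN1r lerN2.
by rewrite ler_wpM2r// ltW.
Qed.

Lemma xcot_le1 u : -1 < u < 1 -> xcot u <= 1.
Proof. by move=> u1; rewrite /xcot ler_pdivrMr ?sinac_gt0// mul1r mul_acos_le. Qed.

Lemma ddhalfsq_ge0 u : -1 < u < 1 -> 0 <= ddhalfsq u.
Proof.
move=> u1; have r0 := sinac_gt0 u1.
by rewrite divr_ge0 ?subr_ge0 ?mul_acos_le// exprn_ge0// ltW.
Qed.

(** Half the squared distance is convex as a function of u on the whole of ]-1, 1[, and - u
    [dhalfsq u] = [xcot u]. The bound holds up to the antipode, as part 1 requires. *)
Lemma sdiff_halfsq_ge u v h : -1 < u < 1 -> -1 < u * cos h + v * sin h < 1 ->
  -1 < u * cos h - v * sin h < 1 -> - (h ^+ 2 * cotbound u) <= sdiff (@halfsq R) u v h.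
Proof.
move=> uI AI BI.
have := convex_sdiff (lexx (-1)) (@derive_halfsq R) (@derive_dhalfsq R) ddhalfsq_ge0 uI AI BI.
apply: le_trans.
have -> : - (2 * (1 - cos h)) * (u * dhalfsq u) = 2 * (1 - cos h) * xcot u.
  by rewrite /dhalfsq /xcot; ring.
have /andP[c0 c1] := one_sub_cos_itv h.
apply: (@le_trans _ _ (2 * (1 - cos h) * - cotbound u)).
  by rewrite mulrN lerN2 ler_wpM2r// cotbound_ge0.
by rewrite ler_wpM2l// xcot_ge.
Qed.

Section away_from_antipode.
Variable dl : R.
Hypothesis dl01 : 0 < dl <= 1.

Let in11 u : -1 + dl < u < 1 -> -1 < u < 1.
Proof. by case/andP: dl01 => d0 _ /andP[u0 ->]; rewrite andbT; lra. Qed.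

(** 1 - u^2 > 1 - (1 - dl)^2 = dl (2 - dl) >= dl^2, as dl <= 1. *)
Lemma sinac_ge u : -1 + dl < u -> u < 0 -> dl <= sinac u.
Proof.
case/andP: dl01 => d0 d1 uN u0; have uI : -1 < u < 1 by apply/andP; split; lra.
rewrite -(ler_pXn2r (n := 2)) ?nnegrE ?(ltW d0) ?(ltW (sinac_gt0 uI))//.
rewrite sinac_sqr//; nra.
Qed.

Let pi0 : 0 <= pi :> R. Proof. exact: pi_ge0. Qed.

Lemma dxcot_itv u : -1 + dl < u < 1 -> u < 0 -> 0 <= dxcot u <= (pi + 1) / dl ^+ 3.
Proof.
move=> uI u0; have /andP[d0 d1] := dl01; have u1 := in11 uI; have r0 := sinac_gt0 u1.
have /andP[a0 api] := acos_itv u1; have /andP[uN _] := uI.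
apply/andP; split; first by rewrite divr_ge0 ?subr_ge0 ?mul_sinac_le// exprn_ge0// ltW.
have r1 : sinac u <= 1.
  by rewrite -(expr_le1 (n := 2)) ?(ltW r0)// sinac_sqr// lerBlDr lerDl sqr_ge0.
have /andP[uN1 _] := u1.
apply: ler_pM; rewrite ?subr_ge0 ?mul_sinac_le ?invr_ge0 ?exprn_ge0// ?(ltW r0)//.
  suff : - u * sinac u <= 1 by lra.
  by rewrite -[leRHS]mulr1 ler_pM ?oppr_ge0 ?(ltW r0) ?(ltW u0)//; lra.
by rewrite lef_pV2 ?posrE ?exprn_gt0// lerXn2r ?nnegrE ?(ltW r0) ?(ltW d0)// sinac_ge.
Qed.

Lemma ddxcot_le0 u : -1 < u < 1 -> 0 <= - ddxcot u.
Proof.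
move=> u1; have r0 := sinac_gt0 u1.
by rewrite /ddxcot mulNr opprK divr_ge0 ?cubic_acos_ge0// exprn_ge0// ltW.
Qed.

(** [convex_sdiff] is applied to the convex function - [xcot]. The resulting term - u [dxcot u] can
    be positive only for u < 0, where sin phi >= dl bounds it. *)
Lemma sdiff_xcot_le u v h : -1 + dl < u < 1 -> -1 + dl < u * cos h + v * sin h < 1 ->
  -1 + dl < u * cos h - v * sin h < 1 ->
  sdiff (@xcot R) u v h <= h ^+ 2 * ((pi + 1) / dl ^+ 3).
Proof.
move=> uI AI BI; have /andP[d0 d1] := dl01.
have l1 : -1 <= -1 + dl by lra.
have := convex_sdiff l1 (fun t tI => derive_opp (derive_xcot (in11 tI)))
  (fun t tI => derive_opp (derive_dxcot (in11 tI)))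
  (fun t tI => ddxcot_le0 (in11 tI)) uI AI BI.
have /andP[c0 c1] := one_sub_cos_itv h.
have -> : sdiff (fun t => - xcot t) u v h = - sdiff (@xcot R) u v h by rewrite /sdiff; ring.
rewrite lerNr; move/le_trans; apply.
have -> : - (- (2 * (1 - cos h)) * (u * - dxcot u)) = 2 * (1 - cos h) * (- u * dxcot u) by ring.
have B0 : 0 <= (pi + 1) / dl ^+ 3 by rewrite divr_ge0 ?exprn_ge0 ?(ltW d0)// addr_ge0.
have u1 := in11 uI; have r0 := sinac_gt0 u1.
have [u0|u0] := ltP u 0; last first.
  apply: (@le_trans _ _ 0); last by rewrite mulr_ge0// sqr_ge0.
  rewrite mulr_ge0_le0// mulNr oppr_le0 mulr_ge0//.
  by rewrite divr_ge0 ?subr_ge0 ?mul_sinac_le// exprn_ge0// ltW.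
have /andP[x0 x1] := dxcot_itv uI u0; have /andP[uN _] := u1.
apply: ler_pM => //; first by rewrite mulr_ge0// oppr_ge0 ltW.
apply: le_trans x1; rewrite -[leRHS]mul1r ler_wpM2r//; lra.
Qed.

(** An upper bound of [ddhalfsq]: the fraction serves u < 0, where |u| <= 1, phi <= pi and sin phi
    >= dl; the summand 1 serves u >= 0. *)
Definition curvbound : R := 1 + (1 + pi) / dl ^+ 3.

Lemma ddhalfsq_le u : -1 + dl < u < 1 -> ddhalfsq u <= curvbound.
Proof.
move=> uI; have /andP[d0 d1] := dl01; have u1 := in11 uI; have r0 := sinac_gt0 u1.
have /andP[a0 api] := acos_itv u1; have /andP[uN uN1] := uI.
have r1 : sinac u <= 1.
  by rewrite -(expr_le1 (n := 2)) ?(ltW r0)// sinac_sqr// lerBlDr lerDl sqr_ge0.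
have B0 : 0 <= (1 + pi) / dl ^+ 3 by rewrite divr_ge0 ?exprn_ge0 ?(ltW d0)// addr_ge0.
have [u0|u0] := ltP u 0.
  apply: (@le_trans _ _ ((1 + pi) / dl ^+ 3)); last by rewrite lerDr.
  have /andP[uN1' _] := u1.
  apply: ler_pM; rewrite ?subr_ge0 ?mul_acos_le ?invr_ge0 ?exprn_ge0 ?(ltW r0)//.
    suff : - u * acos u <= pi by lra.
    by rewrite -[leRHS]mul1r ler_pM ?oppr_ge0 ?(ltW u0)//; lra.
  by rewrite lef_pV2 ?posrE ?exprn_gt0// lerXn2r ?nnegrE ?(ltW r0) ?(ltW d0)// sinac_ge.
(* For u >= 0, sin^3 phi = sin phi - u^2 sin phi >= sin phi - u sin phi >= sin phi - u phi, because
   u <= 1 and sin phi <= phi. *)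
apply: (@le_trans _ _ 1); last by rewrite lerDl.
rewrite ler_pdivrMr ?exprn_gt0// mul1r.
have ra := sinac_le_acos u1; have E := sinac_sqr u1.
have -> : sinac u ^+ 3 = sinac u * (1 - u ^+ 2) by rewrite -E; ring.
have : u * sinac u <= u * acos u by rewrite ler_wpM2l.
have : u ^+ 2 * sinac u <= u * sinac u by rewrite ler_wpM2r ?(ltW r0)// expr2; nra.
by lra.
Qed.

(** With K = [curvbound] the function K u^2 / 2 - [halfsq u] is convex. The quadratic contributes K
    h^2 through its own second difference and K h^2 through the tangent term; [xcot] <= 1
    contributes h^2. *)
Lemma sdiff_halfsq_le u v h : `|v| <= 1 -> -1 + dl < u < 1 -> -1 + dl < u * cos h + v * sin h < 1 ->
  -1 + dl < u * cos h - v * sin h < 1 ->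
  sdiff (@halfsq R) u v h <= h ^+ 2 * (2 * curvbound + 1).
Proof.
move=> v1 uI AI BI; have /andP[d0 d1] := dl01; set K := curvbound.
have l1 : -1 <= -1 + dl by lra.
have DK (t : R) : is_derive t 1 (fun t : R => K / 2 * t ^+ 2) (K * t).
  have H := derive_mul (derive_const t (K / 2)) (derive_exp 2 (derive_id t)).
  by apply: (is_derive_eq H); rewrite /=; field.
have DK' (t : R) : is_derive t 1 (fun t : R => K * t) K.
  have H := derive_mul (derive_const t K) (derive_id t).
  by apply: (is_derive_eq H); rewrite mul0r add0r mulr1.
have := convex_sdiff l1 (fun t tI => derive_sub (DK t) (derive_halfsq (in11 tI)))
  (fun t tI => derive_sub (DK' t) (derive_dhalfsq (in11 tI))) _ uI AI BI.
have H0 t : -1 + dl < t < 1 -> 0 <= K - ddhalfsq t by move=> tI; rewrite subr_ge0 ddhalfsq_le.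
move=> /(_ H0).
have -> : sdiff (fun t => K / 2 * t ^+ 2 - halfsq t) u v h =
    K * (u ^+ 2 * cos h ^+ 2 + v ^+ 2 * sin h ^+ 2 - u ^+ 2) - sdiff (@halfsq R) u v h.
  by rewrite /sdiff; field.
have -> : - (2 * (1 - cos h)) * (u * (K * u - dhalfsq u)) =
    - (2 * (1 - cos h)) * (K * u ^+ 2) - 2 * (1 - cos h) * xcot u.
  by rewrite /dhalfsq /xcot; ring.
have /andP[c0 c1] := one_sub_cos_itv h; have s1 := sin_sqr_le h.
have u1 := in11 uI; have x1 := xcot_le1 u1; have u2 := sqr_lt1 u1.
have v2 : v ^+ 2 <= 1 by rewrite -real_normK ?num_real// expr_le1.
have K0 : 0 <= K by rewrite /K addr_ge0// divr_ge0 ?exprn_ge0 ?(ltW d0)// addr_ge0.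
have E1 : 2 * (1 - cos h) * (K * u ^+ 2) <= h ^+ 2 * K.
  apply: ler_pM => //; first by rewrite mulr_ge0// sqr_ge0.
  by rewrite -[leRHS]mulr1 ler_wpM2l// ltW.
have E2 : 2 * (1 - cos h) * xcot u <= h ^+ 2.
  apply: (@le_trans _ _ (2 * (1 - cos h) * 1)); first by rewrite ler_wpM2l.
  by rewrite mulr1.
have E3 : K * (u ^+ 2 * cos h ^+ 2 + v ^+ 2 * sin h ^+ 2 - u ^+ 2) <= K * h ^+ 2.
  rewrite ler_wpM2l//.
  have : u ^+ 2 * cos h ^+ 2 <= u ^+ 2 * 1.
    by rewrite ler_wpM2l ?sqr_ge0// -real_normK ?num_real// expr_le1// ler_norml cos_geN1 cos_le1.
  have : v ^+ 2 * sin h ^+ 2 <= 1 * h ^+ 2 by apply: ler_pM; rewrite ?sqr_ge0.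
  lra.
lra.
Qed.

(** A bound of phi / sin phi, the absolute value of [dhalfsq]: for u >= 1/2 the summand 2 comes from
    phi cos phi <= sin phi, for u < 1/2 the other one from sin phi >= dl / 2. *)
Definition slopebound : R := 2 + 2 * pi / dl.

Lemma dhalfsq_le u : -1 + dl < u < 1 -> `|dhalfsq u| <= slopebound.
Proof.
move=> uI; have /andP[d0 d1] := dl01; have u1 := in11 uI; have r0 := sinac_gt0 u1.
have /andP[a0 api] := acos_itv u1; have /andP[uN uN1] := uI.
have P0 : 0 <= 2 * pi / dl by rewrite divr_ge0 ?mulr_ge0// ltW.
rewrite /dhalfsq mulNr normrN ger0_norm ?divr_ge0 ?(ltW r0)//.
have [u2|u2] := ltP u (2^-1).
  apply: (@le_trans _ _ (2 * pi / dl)); last by rewrite lerDr.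
  have rd : dl / 2 <= sinac u.
    rewrite -(ler_pXn2r (n := 2)) ?nnegrE ?divr_ge0 ?(ltW d0) ?(ltW r0)//.
    rewrite sinac_sqr//; nra.
  rewrite ler_pdivrMr//; apply: (le_trans api).
  apply: (@le_trans _ _ (2 * pi / dl * (dl / 2))); last by rewrite ler_wpM2l.
  by rewrite le_eqVlt; apply/orP; left; apply/eqP; field; rewrite gt_eqF.
apply: (@le_trans _ _ 2); last by rewrite lerDl.
rewrite ler_pdivrMr//; have := mul_acos_le u1.
have : 2^-1 * acos u <= u * acos u by rewrite ler_wpM2r.
lra.
Qed.

Lemma halfsq_lipschitz a b : -1 + dl < a < 1 -> -1 + dl < b < 1 ->
  `|halfsq a - halfsq b| <= slopebound * `|a - b|.
Proof.
wlog ab : a b / a < b.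
  move=> H aI bI; have [ab|ba|->] := ltgtP a b; first exact: H.
    by rewrite distrC (distrC a); exact: H.
  by rewrite !subrr normr0 mulr0.
move=> /andP[aN _] /andP[_ b1].
have DF (t : R) : a <= t <= b -> is_derive t 1 (@halfsq R) (dhalfsq t).
  by move=> /andP[ta tb]; apply: derive_halfsq; apply: in11; rewrite (lt_le_trans aN)//= (le_lt_trans tb).
have DF' (t : R) : t \in `]a, b[ -> is_derive t 1 (@halfsq R) (dhalfsq t).
  by rewrite in_itv/= => /andP[ta tb]; apply: DF; rewrite (ltW ta) ltW.
have cF : {within `[a, b], continuous (@halfsq R)}.
  apply: continuous_in_subspaceT => t; rewrite inE/= in_itv/= => tI.
  exact: is_derive_continuous (DF t tI).
have [c] := MVT ab DF' cF; rewrite in_itv/= => /andP[ac cb] E.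
rewrite distrC E normrM (distrC a b) ler_wpM2r// dhalfsq_le//.
by rewrite (lt_trans aN)//= (lt_trans cb).
Qed.

Lemma xcot_bounded u : -1 + dl < u < 1 -> `|xcot u| <= slopebound.
Proof.
move=> uI; have u1 := in11 uI.
have -> : xcot u = - (u * dhalfsq u) by rewrite /dhalfsq /xcot; ring.
rewrite normrN normrM; apply: le_trans (dhalfsq_le uI).
rewrite -[leRHS]mul1r ler_wpM2r// ltW// ltr_norml//.
Qed.
End away_from_antipode.

Lemma halfsq_itv u : 0 <= halfsq u <= pi ^+ 2.
Proof.
have a : 0 <= acos u <= pi.
  have [u1|u1] := boolP (-1 <= u <= 1); first by rewrite acos_ge0// acos_lepi.
  by rewrite acos_out// lexx pi_ge0.
case/andP: a => a0 api; rewrite /halfsq; apply/andP; split.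
  by rewrite mulr_ge0// sqr_ge0.
nra.
Qed.
End second_difference_bounds.

(** * Second differences of spherical means *)

Section fatou.
Local Open Scope ereal_scope.
Context d (T : measurableType d) (R : realType) (mu : {measure set T -> \bar R}).

(** Fatou's lemma for the nonnegative functions s_n + w. Integrability of s comes out of the same
    inequality: the integral of s + w is at most that of w. *)
Let fatou_everywhere (s_ : (T -> R)^nat) (s w : T -> R) :
  measurable_fun setT s -> mu.-integrable setT (EFin \o w) ->
  (forall n, mu.-integrable setT (EFin \o s_ n)) ->
  (forall n x, - w x <= s_ n x)%R -> (forall x, s_ ^~ x @ \oo --> s x) ->
  (forall n, \int[mu]_x (s_ n x)%:E <= 0) -> \int[mu]_x (s x)%:E <= 0.
Proof.
move=> ms iw is_ sw s_s s0.
have mw : measurable_fun setT w by apply/measurable_EFinP; exact: measurable_int iw.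
have ms_ n : measurable_fun setT (s_ n) by apply/measurable_EFinP; exact: measurable_int (is_ n).
pose F n x := (s_ n x + w x)%:E.
have mF n : measurable_fun setT (F n).
  by apply/measurable_EFinP; exact: measurable_funD.
have F0 n x : setT x -> 0 <= F n x by rewrite lee_fin -lerBlDr sub0r.
have sw' x : (0 <= s x + w x)%R.
  rewrite -lerBlDr sub0r -(cvg_lim (@Rhausdorff R) (s_s x)).
  apply: limr_ge; first by apply/cvg_ex; exists (s x); exact: s_s.
  exact: nearW.
have FE x : limn_einf (F ^~ x) = (s x + w x)%:E.
  have H : F n x @[n --> \oo] --> (s x + w x)%:E.
    by apply: cvg_EFin; [exact: nearW|apply: cvgD; [exact: s_s|exact: cvg_cst]].
  by rewrite (cvg_limn_einf_sup H).1.
have wfin : \int[mu]_x (w x)%:E \is a fin_num by exact: integrable_fin_num.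
have upper : limn_einf (fun n => \int[mu]_x F n x) <= \int[mu]_x (w x)%:E.
  rewrite limn_einf_lim; apply: lime_le; first exact: is_cvg_einfs.
  apply: nearW => n; apply: (@le_trans _ _ (\int[mu]_x F n x)).
    by apply: ereal_inf_lbound; exists n => /=.
  under eq_integral do rewrite /F EFinD.
  by rewrite (integralD measurableT (is_ n) iw) -[X in _ <= X]add0e; apply: leeD2r; exact: s0.
have H : \int[mu]_x (s x + w x)%:E <= \int[mu]_x (w x)%:E.
  apply: le_trans upper; apply: le_trans (fatou mu measurableT mF F0).
  by under [leRHS]eq_integral do rewrite FE.
have isw : mu.-integrable setT (EFin \o (fun x => s x + w x)%R).
  apply/integrableP; split; first by apply/measurable_EFinP; exact: measurable_funD.
  under eq_integral do rewrite /= ger0_norm//.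
  by apply: le_lt_trans H _; rewrite ltey_eq wfin.
have is' : mu.-integrable setT (EFin \o s).
  have := integrableB measurableT isw iw.
  by congr (mu.-integrable _ _); apply/funext => x /=; rewrite -EFinB addrK.
have : \int[mu]_x (s x)%:E + \int[mu]_x (w x)%:E <= \int[mu]_x (w x)%:E.
  by rewrite -integralD//; under eq_integral do rewrite -EFinD.
by rewrite -leeBrDr// subee.
Qed.

(** Multiplication by the indicator of the complement of the null set makes the hypotheses hold
    everywhere and changes no integral. *)
Lemma fatou_le0 (s_ : (T -> R)^nat) (s w : T -> R) :
  measurable_fun setT s -> mu.-integrable setT (EFin \o w) ->
  (forall n, mu.-integrable setT (EFin \o s_ n)) ->
  {ae mu, forall x, [/\ forall n, (- w x <= s_ n x)%R & s_ ^~ x @ \oo --> s x]} ->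
  (forall n, \int[mu]_x (s_ n x)%:E <= 0) -> \int[mu]_x (s x)%:E <= 0.
Proof.
move=> ms iw is_ [A [mA A0 HA]] s0.
pose p (f : T -> R) x := (f x * \1_(~` A) x)%R.
have mI : measurable_fun setT (\1_(~` A) : T -> R).
  by apply: measurable_indic; exact: measurableC.
have aep f : ae_eq mu setT (EFin \o f) (EFin \o p f).
  exists A; split=> // x /=; apply: contra_notP => xA _.
  by rewrite /p indicE mem_set ?mulr1.
have mp f : measurable_fun setT f -> measurable_fun setT (EFin \o p f).
  by move=> mf; apply/measurable_EFinP; exact: measurable_funM.
have ip f : mu.-integrable setT (EFin \o f) -> mu.-integrable setT (EFin \o p f).
  move=> fi; apply: (le_integrable measurableT _ _ fi).
    by apply: mp; apply/measurable_EFinP; exact: measurable_int fi.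
  move=> x _; rewrite /p /= lee_fin indicE; case: (x \in _); first by rewrite mulr1.
  by rewrite mulr0 normr0.
have Ep f : measurable_fun setT f -> \int[mu]_x (f x)%:E = \int[mu]_x (p f x)%:E.
  move=> mf; apply: (ae_eq_integral _ _ measurableT _ (mp _ mf) (aep f)).
  exact/measurable_EFinP.
rewrite (Ep s ms); apply: (@fatou_everywhere (fun n => p (s_ n)) (p s) (p w)).
- by apply/measurable_EFinP; exact: mp.
- exact: ip.
- by move=> n; exact: ip.
- move=> n x; rewrite /p indicE; case/boolP: (x \in ~` A); last by rewrite !mulr0 oppr0.
  rewrite inE !mulr1 => xA.
  by have /(_ xA)[] := contra_notP (HA x).
- move=> x; rewrite /p indicE; case/boolP: (x \in ~` A); last first.
    by under eq_fun do rewrite mulr0; move=> _; rewrite mulr0; exact: cvg_cst.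
  rewrite inE mulr1 => xA; under eq_fun do rewrite mulr1.
  by have /(_ xA)[] := contra_notP (HA x).
- move=> n; rewrite -Ep//; apply/measurable_EFinP; exact: measurable_int (is_ n).
Qed.
End fatou.

(** * Orthonormal frames and geodesics *)

Section frame.
Context (R : realType) (m : nat).
Implicit Types (t h s : R) (y : m.+2.-tuple R).

Definition meridian t : m.+2.-tuple R := cons_pair (cos t, cons_pair (sin t, ztuple R m)).

Definition unit_tuple (j : 'I_m) : m.-tuple R := [tuple (i == j)%:R | i < m].

(* An orthonormal basis of the tangent space at [meridian t]; [ord0] points along the meridian. *)
Definition frame t (i : 'I_m.+1) : m.+2.-tuple R :=
  if unlift ord0 i is Some j then cons_pair (0, cons_pair (0, unit_tuple j))
  else cons_pair (- sin t, cons_pair (cos t, ztuple R m)).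

(** For s = 1 the unit-speed great circle from [meridian t] with velocity [frame t i]; for s = -1
    the same circle backwards. *)
Definition geodesic t (i : 'I_m.+1) s h : m.+2.-tuple R :=
  tadd (scale (cos h) (meridian t)) (scale (s * sin h) (frame t i)).

Lemma dotp_unit_tuple (j : 'I_m) (z : m.-tuple R) : dotp (unit_tuple j) z = tnth z j.
Proof.
rewrite /dotp (bigD1 j)//= tnth_mktuple eqxx mul1r big1 ?addr0// => i ij.
by rewrite tnth_mktuple (negbTE ij) mul0r.
Qed.

Lemma dotp_cons2 (a b : R) (z : m.-tuple R) y : dotp (cons_pair (a, cons_pair (b, z))) y =
  a * thead y + (b * thead (ttail y) + dotp z (ttail (ttail y))).
Proof. by rewrite dotp_eta thead_cons ttail_cons dotp_eta thead_cons ttail_cons. Qed.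

Lemma meridian_unit t : dotp (meridian t) (meridian t) = 1.
Proof.
rewrite dotp_cons2 /meridian !(thead_cons, ttail_cons) dotp0l addr0 -!expr2.
exact: cos2Dsin2.
Qed.

Lemma thead_meridian t : thead (meridian t) = cos t. Proof. by []. Qed.

Lemma frame_unit t i : dotp (frame t i) (frame t i) = 1.
Proof.
rewrite /frame; case: unliftP => [j|] _; rewrite dotp_cons2 !(thead_cons, ttail_cons).
  by rewrite dotp_unit_tuple tnth_mktuple eqxx !mul0r !add0r.
by rewrite dotp0l addr0 mulrNN -!expr2 addrC cos2Dsin2.
Qed.

Lemma frame_orth t i : dotp (meridian t) (frame t i) = 0.
Proof.
rewrite /frame; case: unliftP => [j|] _; rewrite dotp_cons2 !(thead_cons, ttail_cons).
  by rewrite dotp0l !mulr0 !addr0.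
by rewrite dotp0l; ring.
Qed.

(** Parseval in the orthonormal basis formed by the point and its frame; it turns the sum of the
    v_i^2 into 1 - u^2. *)
Lemma frame_parseval t y :
  dotp (meridian t) y ^+ 2 + \sum_i dotp (frame t i) y ^+ 2 = dotp y y.
Proof.
rewrite big_ord_recl; under eq_bigr => j _.
  rewrite /frame liftK dotp_cons2 dotp_unit_tuple !mul0r !add0r; over.
rewrite /frame unlift_none !dotp_cons2 !dotp0l !addr0 [RHS]dotp_eta.
rewrite [X in _ = _ + X]dotp_eta [X in _ = _ + (_ + X)]/dotp.
under [X in _ = _ + (_ + X)]eq_bigr do rewrite -expr2.
rewrite !addrA; congr +%R; set a := thead y; set b := thead (ttail y).
transitivity ((cos t ^+ 2 + sin t ^+ 2) * (a * a + b * b)); first by ring.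
by rewrite cos2Dsin2 mul1r.
Qed.

Lemma dotp_geodesic t i s h y : dotp (geodesic t i s h) y =
  dotp (meridian t) y * cos h + s * (dotp (frame t i) y * sin h).
Proof. by rewrite /geodesic dotpDl !dotpZl; ring. Qed.

Lemma geodesic_unit t i s h : s ^+ 2 = 1 -> dotp (geodesic t i s h) (geodesic t i s h) = 1.
Proof.
move=> s1; rewrite dotp_geodesic !(dotpC _ (geodesic t i s h)) !dotp_geodesic.
rewrite meridian_unit frame_unit frame_orth dotpC frame_orth.
transitivity (cos h ^+ 2 + s ^+ 2 * sin h ^+ 2); first by ring.
by rewrite s1 mul1r cos2Dsin2.
Qed.

Lemma thead_tadd n (x y : n.+1.-tuple R) : thead (tadd x y) = thead x + thead y.
Proof. by rewrite /thead tnth_mktuple. Qed.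

Lemma thead_geodesic t i s h : thead (geodesic t i s h) =
  if i == ord0 then cos t * cos h - s * (sin t * sin h) else cos t * cos h.
Proof.
rewrite /geodesic thead_tadd !thead_scale thead_meridian /frame.
case: unliftP => [j ->|->]; rewrite ?thead_cons.
  by rewrite mulr0 addr0 mulrC.
by rewrite eqxx; ring.
Qed.

Lemma geodesic0 t s h : s ^+ 2 = 1 -> thead (geodesic t ord0 s h) = cos (t + s * h).
Proof.
move=> /eqP; rewrite sqrf_eq1 thead_geodesic eqxx => /orP[]/eqP ->.
  by rewrite !mul1r cosD.
by rewrite !mulN1r opprK cosB.
Qed.

Definition sdiff_sum (k : R -> R) t h y : R :=
  \sum_i sdiff k (dotp (meridian t) y) (dotp (frame t i) y) h.

Lemma sdiff_geodesic (k : R -> R) t i h y :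
  sdiff k (dotp (meridian t) y) (dotp (frame t i) y) h =
  k (dotp (geodesic t i 1 h) y) + k (dotp (geodesic t i (-1) h) y) - 2 * k (dotp (meridian t) y).
Proof. by rewrite !dotp_geodesic mul1r mulN1r. Qed.

(* Laplace-Beltrami operator of S^(m+1) on functions k (u) of u = <x, q>. *)
Definition laplacian (dk ddk : R -> R) (u : R) : R :=
  (1 - u ^+ 2) * ddk u - m.+1%:R * (u * dk u).

(** The limits v_i^2 k'' - u k' of the single quotients add up, by Parseval, to (1 - u^2) k'' - (m +
    1) u k'. *)
Lemma cvg_sdiff_sum (k dk ddk : R -> R) t (h_ : nat -> R) y :
  (forall u : R, -1 < u < 1 -> is_derive u 1 k (dk u)) ->
  (forall u : R, -1 < u < 1 -> is_derive u 1 dk (ddk u)) ->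
  (forall n, h_ n != 0) -> h_ @ \oo --> (0 : R) -> dotp y y = 1 ->
  -1 < dotp (meridian t) y < 1 ->
  sdiff_sum k t (h_ n) y / h_ n ^+ 2 @[n --> \oo] --> laplacian dk ddk (dotp (meridian t) y).
Proof.
move=> Dk Ddk h0 hcvg y1 uI; set u := dotp _ _.
have -> : laplacian dk ddk u = \sum_i (dotp (frame t i) y ^+ 2 * ddk u - u * dk u).
  rewrite sumrB -mulr_suml sumr_const card_ord -mulr_natl /laplacian; congr (_ * _ - _).
  by rewrite -y1 -(frame_parseval t y) -/u addrC addKr.
under eq_fun do rewrite /sdiff_sum mulr_suml.
apply: cvg_big => [|i _]; first exact: add_continuous.
apply/cvgrPdist_le => e e0.
have [d d0 H] := second_difference_circle (dotp (frame t i) y) Dk uI (Ddk _ uI) e0.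
have := hcvg; move/cvgrPdist_lt => /(_ d d0); apply: filterS => n.
rewrite sub0r normrN => hd.
by rewrite distrC; apply: H.
Qed.
End frame.

(** * Integrating the Laplacian *)

Section laplacian_integral.
Context (R : realType) (m : nat).
Hypothesis m0 : (0 < m)%N.
Variable f : R -> R.
Hypothesis f_meas : measurable_fun (`[0, pi] : set R) f.
Hypothesis f_ge0 : forall phi : R, 0 <= phi <= pi -> 0 <= f phi.
Notation S := (sphere R m.+1).
Variable sigma : {measure set S -> \bar R}.
Hypothesis sigma_radial : radial f (north R m) sigma.
Hypothesis sigma_fin : (sigma setT < +oo)%E.
Implicit Types (k : R -> R) (x : m.+2.-tuple R).

Definition mean k x : R := fine (\int[sigma]_q (k (dotp x (\val q)))%:E)%E.

Definition mean_integrable k x :=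
  sigma.-integrable setT (EFin \o (fun q => k (dotp x (\val q)))).

Lemma measurable_mean k x : measurable_fun setT k ->
  measurable_fun setT (fun q : S => k (dotp x (\val q))).
Proof. by move=> mk; exact: (measurableT_comp mk (measurable_dotp_sphere x)). Qed.

Lemma ae_bounded_integrable (g : S -> R) (M : R) : measurable_fun setT g ->
  {ae sigma, forall q, `|g q| <= M} -> sigma.-integrable setT (EFin \o g).
Proof.
move=> mg gM; apply/integrableP; split; first exact/measurable_EFinP.
have mM : measurable_fun setT (EFin \o (fun q => `|g q|)).
  by apply/measurable_EFinP; exact: measurableT_comp.
apply: (@le_lt_trans _ _ (\int[sigma]_q (cst `|M|%:E q))%E).
  apply: ae_ge0_le_integral => //.
    by move=> q _; rewrite lee_fin.
  by apply: filterS gM => q gM _; rewrite lee_fin (le_trans gM)// ler_norm.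
by rewrite integral_cst// lte_mul_pinfty// lee_fin.
Qed.

(** Rotation invariance around the pole: here the mean becomes a function of the distance to the
    pole. *)
Lemma mean_eq k x x' : measurable_fun setT k -> dotp x x = 1 -> dotp x' x' = 1 ->
  thead x = thead x' -> mean k x = mean k x'.
Proof.
move=> mk x1 x1' xx'; congr fine.
have n1 : dotp (north R m) (north R m) = 1 by rewrite dotp_north thead_cons.
have E : dotp (north R m) x = dotp (north R m) x' by rewrite !dotp_north.
exact: (radial_transport f_meas f_ge0 sigma_radial sigma_radial n1 x1 n1 x1' E mk).
Qed.

Lemma integral_mean k x : mean_integrable k x ->
  (\int[sigma]_q (k (dotp x (\val q)))%:E = (mean k x)%:E)%E.
Proof. by move=> ik; rewrite fineK//; exact: integrable_fin_num. Qed.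

Section second_differences.
Variables (k : R -> R) (t h : R).
Hypothesis ik : mean_integrable k (meridian m t).
Hypothesis igeo : forall i (s : R), s ^+ 2 = 1 -> mean_integrable k (geodesic t i s h).

Let term i (q : S) : R := (k (dotp (geodesic t i 1 h) (\val q)) + k (dotp (geodesic t i (-1) h) (\val q))
   - 2 * k (dotp (meridian m t) (\val q))).

Let s1 : (1 : R) ^+ 2 = 1. Proof. by rewrite expr1n. Qed.
Let sN1 : (- 1 : R) ^+ 2 = 1. Proof. by rewrite sqrrN expr1n. Qed.

Lemma integrable_term i : sigma.-integrable setT (fun q => (term i q)%:E).
Proof.
have := integrableB measurableT (integrableD measurableT (igeo i s1) (igeo i sN1))
  (integrableZl measurableT 2 ik).
by apply: eq_integrable => // q _; rewrite /= -EFinD -EFinM -EFinB.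
Qed.

Lemma integral_term i : (\int[sigma]_q (term i q)%:E =
  (mean k (geodesic t i 1 h) + mean k (geodesic t i (-1) h) - 2 * mean k (meridian m t))%:E)%E.
Proof.
have iG := integrableD measurableT (igeo i s1) (igeo i sN1).
have iZ := integrableZl measurableT 2 ik.
transitivity (\int[sigma]_q ((((EFin \o (fun q => k (dotp (geodesic t i 1 h) (\val q)))) q +
   (EFin \o (fun q => k (dotp (geodesic t i (-1) h) (\val q)))) q) -
   (2%:E * (EFin \o (fun q => k (dotp (meridian m t) (\val q)))) q))))%E.
  by apply: eq_integral => q _.
rewrite (integralB measurableT iG iZ) (integralD measurableT (igeo i s1) (igeo i sN1)).
rewrite (integralZl measurableT ik) /= !integral_mean//; first exact: igeo.
exact: igeo.
Qed.

Lemma integral_sdiff_sum :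
  sigma.-integrable setT (fun q => (sdiff_sum k t h (\val q))%:E) /\
  (\int[sigma]_q (sdiff_sum k t h (\val q))%:E =
   (\sum_i (mean k (geodesic t i 1 h) + mean k (geodesic t i (-1) h)
     - 2 * mean k (meridian m t)))%:E)%E.
Proof.
have E q : (sdiff_sum k t h (\val q))%:E = (\sum_i (term i q)%:E)%E.
  by rewrite sumEFin; congr EFin; apply: eq_bigr => i _; rewrite sdiff_geodesic.
split.
  have := integrable_sum measurableT _ (fun i _ => integrable_term i).
  move=> /(_ (index_enum _) xpredT); apply: eq_integrable => // q _; by rewrite E.
under eq_integral do rewrite E.
rewrite integral_sum//; last by move=> i; exact: integrable_term.
by rewrite -sumEFin; apply: eq_bigr => i _; rewrite integral_term.
Qed.
End second_differences.

Definition good_point t h (q : S) : Prop :=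
  -1 < dotp (meridian m t) (\val q) < 1 /\
  forall i (s : R), s ^+ 2 = 1 -> -1 < dotp (geodesic t i s h) (\val q) < 1.

Lemma ae_good_point t (h_ : nat -> R) : {ae sigma, forall q, forall n, good_point t (h_ n) q}.
Proof.
have H x : dotp x x = 1 -> {ae sigma, forall q, -1 < dotp x (\val q) < 1}.
  by move=> x1; exact: (radial_ae_lt1 m0 f_meas f_ge0 sigma_radial x1).
apply/ae_foralln => n.
have A0 := H _ (meridian_unit m t).
have A1 : {ae sigma, forall q, forall i, -1 < dotp (geodesic t i 1 (h_ n)) (\val q) < 1 /\
   -1 < dotp (geodesic t i (-1) (h_ n)) (\val q) < 1}.
  apply: filter_forall => i.
  by apply: filterI; apply: H; apply: geodesic_unit; rewrite ?sqrrN expr1n.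
apply: filterS2 A0 A1 => q q0 q1; split => // i s /eqP.
by rewrite sqrf_eq1 => /orP[] /eqP ->; case: (q1 i).
Qed.

(** The Fatou argument for e times the second differences over h_n^2, used with e = 1 and e = -1.
    The function l is a globally measurable version of the Laplacian on ]-1, 1[, and - w is the
    minorant. *)
Lemma laplacian_integral_le0 (k dk ddk l : R -> R) (e t : R) (h_ : nat -> R) (w : S -> R) :
  (forall u : R, -1 < u < 1 -> is_derive u 1 k (dk u)) ->
  (forall u : R, -1 < u < 1 -> is_derive u 1 dk (ddk u)) ->
  (forall u : R, -1 < u < 1 -> laplacian m dk ddk u = l u) -> measurable_fun setT l ->
  (forall n, h_ n != 0) -> h_ @ \oo --> (0 : R) ->
  sigma.-integrable setT (EFin \o w) ->
  mean_integrable k (meridian m t) ->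
  (forall n i (s : R), s ^+ 2 = 1 -> mean_integrable k (geodesic t i s (h_ n))) ->
  {ae sigma, forall q, forall n, good_point t (h_ n) q ->
     - w q * h_ n ^+ 2 <= e * sdiff_sum k t (h_ n) (\val q)} ->
  (forall n, e * \sum_i (mean k (geodesic t i 1 (h_ n)) + mean k (geodesic t i (-1) (h_ n))
     - 2 * mean k (meridian m t)) <= 0) ->
  (\int[sigma]_q (e * l (dotp (meridian m t) (\val q)))%:E <= 0)%E.
Proof.
move=> Dk Ddk Ll ml h0 hcvg iw ik igeo ws les.
have h2 n : 0 < h_ n ^+ 2 by rewrite exprn_even_gt0//= h0.
apply: (@fatou_le0 _ _ _ sigma (fun n q => e * (sdiff_sum k t (h_ n) (\val q) / h_ n ^+ 2)) _ w) => //.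
- by apply: measurable_funM => //; exact: measurable_mean.
- move=> n; have [+ _] := integral_sdiff_sum ik (igeo n).
  move=> /(integrableZl measurableT (e / h_ n ^+ 2)); apply: eq_integrable => // q _ /=.
  by rewrite -EFinM; congr EFin; rewrite -mulrA; congr (_ * _); rewrite mulrC.
- apply: filterS2 (ae_good_point t h_) ws => q gq wq; split.
    move=> n; rewrite mulrA ler_pdivlMr//; exact: wq.
  have [uI _] := gq 0%N.
  by apply: cvgMr; rewrite -Ll//; apply: cvg_sdiff_sum => //; exact: sphere_unit.
- move=> n; have [is_ Es] := integral_sdiff_sum ik (igeo n).
  have -> : (\int[sigma]_q (e * (sdiff_sum k t (h_ n) (\val q) / h_ n ^+ 2))%:E =
      (e / h_ n ^+ 2)%:E * \int[sigma]_q (sdiff_sum k t (h_ n) (\val q))%:E)%E.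
    rewrite -integralZl//; apply: eq_integral => q _ /=.
    by rewrite -EFinM; congr EFin; rewrite -mulrA; congr (_ * _); rewrite mulrC.
  rewrite Es -EFinM lee_fin mulrAC pmulr_lle0 ?invr_gt0//; exact: les.
Qed.
End laplacian_integral.

(** * The integral of the Laplacian and the constant alpha *)

Section radial_mean.
Context (R : realType) (m : nat).
Hypothesis m0 : (0 < m)%N.
Variable f : R -> R.
Hypothesis f_meas : measurable_fun (`[0, pi] : set R) f.
Hypothesis f_ge0 : forall phi : R, 0 <= phi <= pi -> 0 <= f phi.
Notation S := (sphere R m.+1).
Notation leb := (@lebesgue_measure R).
Variable sigma : {measure set S -> \bar R}.
Hypothesis sigma_radial : radial f (north R m) sigma.
Hypothesis sigma1 : sigma setT = 1%E.

Lemma measurable_xcot : measurable_fun setT (@xcot R).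
Proof.
apply: measurable_funM.
  by apply: measurable_funM; [exact: measurable_id|exact: measurable_acos].
apply: (measurableT_comp (@measurable_inv R)); apply: (measurableT_comp (@measurable_sqrt R)).
by apply: measurable_funB => //; exact: measurable_funX.
Qed.

Lemma measurable_halfsq : measurable_fun setT (@halfsq R).
Proof. by apply: measurable_funM => //; apply: measurable_funX; exact: measurable_acos. Qed.

(** The total mass 1 is the volume of S^m times an integral: a zero volume would make the product 0,
    an infinite one 0 or + oo. *)
Lemma sphere_volume_pos : exists2 v : R, 0 < v & sphere_volume R m setT = v%:E.
Proof.
have m1 : measurable_fun setT (cst 1%E : R -> \bar R) by exact: measurable_cst.
have := radial_polar m0 f_meas f_ge0 sigma_radial m1 (fun=> lee01).
rewrite integral_cst// sigma1 mule1; set I := (\int[_]_(_ in _) _)%E => VI.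
have I0 : (0 <= I)%E.
  apply: integral_ge0 => phi /=; rewrite in_itv/= => phi0.
  by rewrite mule1 lee_fin mulr_ge0 ?f_ge0// exprn_ge0// sin_ge0_pi.
move: VI; have : (0 <= sphere_volume R m setT)%E by exact: measure_ge0.
case: (sphere_volume R m setT) => [v||]//.
  rewrite lee_fin le_eqVlt => /orP[/eqP <-|v0 _]; last by exists v.
  by rewrite mul0e => /eqP; rewrite onee_eq0.
move=> _; have [->|I1] := eqVneq I 0%E; first by rewrite mule0 => /eqP; rewrite onee_eq0.
by rewrite gt0_mulye// lt0e I1.
Qed.

(** Positive and negative parts are compared by the formula for nonnegative functions. Only the
    positive part is assumed integrable, since phi cot phi is unbounded below and its integral may
    be - oo. *)
Lemma mean_polar (k : R -> R) (v : R) : sphere_volume R m setT = v%:E -> 0 < v ->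
  measurable_fun setT k -> mean_integrable sigma (fun u => Num.max (k u) 0) (north R m) ->
  (\int[sigma]_q (k (thead (\val q)))%:E =
   v%:E * \int[leb]_(phi in `[0%R, pi]) (f phi * sin phi ^+ m * k (cos phi))%:E)%E.
Proof.
move=> vE v0 mk ik.
have mkE : measurable_fun setT (EFin \o k) by exact/measurable_EFinP.
have P (s : R) : (\int[sigma]_q (Num.max (s * k (thead (\val q))) 0)%:E)%E =
    (v%:E * \int[leb]_(phi in `[0%R, pi]) (Num.max (s * (f phi * sin phi ^+ m * k (cos phi))) 0)%:E)%E.
  have mk' : measurable_fun setT (fun u => (Num.max (s * k u) 0)%:E).
    apply/measurable_EFinP; apply: measurable_maxr => //; exact: measurable_funM.
  have := radial_polar m0 f_meas f_ge0 sigma_radial mk'.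
  move=> -> ; last by move=> u; rewrite lee_fin le_max lexx orbT.
  rewrite vE; congr (_ * _)%E; apply: eq_integral => phi; rewrite inE/= in_itv/= => phi0.
  rewrite -EFinM maxr_pMr ?mulr0 1?mulrCA//.
  by rewrite mulr_ge0 ?f_ge0// exprn_ge0// sin_ge0_pi.
have Pp : (\int[sigma]_q ((fun q => (k (thead (\val q)))%:E)^\+ q) =
    v%:E * \int[leb]_(phi in `[0%R, pi]) ((fun phi => (f phi * sin phi ^+ m * k (cos phi))%:E)^\+ phi))%E.
  have := P 1; under eq_integral do rewrite mul1r.
  under [in X in _ = X -> _]eq_integral do rewrite mul1r.
  move=> H; transitivity (\int[sigma]_q (Num.max (k (thead (\val q))) 0)%:E)%E.
    by apply: eq_integral => q _; rewrite funeposE EFin_max.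
  by rewrite H; congr (_ * _)%E; apply: eq_integral => q _; rewrite funeposE EFin_max.
have Pn : (\int[sigma]_q ((fun q => (k (thead (\val q)))%:E)^\- q) =
    v%:E * \int[leb]_(phi in `[0%R, pi]) ((fun phi => (f phi * sin phi ^+ m * k (cos phi))%:E)^\- phi))%E.
  have := P (-1); under eq_integral do rewrite mulN1r.
  under [in X in _ = X -> _]eq_integral do rewrite mulN1r.
  move=> H; transitivity (\int[sigma]_q (Num.max (- k (thead (\val q))) 0)%:E)%E.
    by apply: eq_integral => q _; rewrite funenegE EFin_max.
  by rewrite H; congr (_ * _)%E; apply: eq_integral => q _; rewrite funenegE EFin_max.
rewrite integralE Pp Pn [in RHS]integralE.
have Pf : (\int[sigma]_q ((fun q => (k (thead (\val q)))%:E)^\+ q))%E \is a fin_num.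
  have := integrable_fin_num measurableT ik; congr (_ \is a fin_num).
  by apply: eq_integral => q _; rewrite /= dotp_north funeposE EFin_max.
rewrite -muleBr//.
have A0 : (0 <= \int[leb]_(phi in `[0%R, pi]) ((fun phi => (f phi * sin phi ^+ m * k (cos phi))%:E)^\+ phi))%E.
  by apply: integral_ge0 => ? _; rewrite ?funepos_ge0 ?funeneg_ge0.
have B0 : (0 <= \int[leb]_(phi in `[0%R, pi]) ((fun phi => (f phi * sin phi ^+ m * k (cos phi))%:E)^\- phi))%E.
  by apply: integral_ge0 => ? _; rewrite ?funepos_ge0 ?funeneg_ge0.
move: Pf; rewrite Pp; move: A0 B0; move: (\int[leb]_(_ in _) _)%E => A.
move: (\int[leb]_(_ in _) _)%E => B.
by case: A => [a||]//; case: B => // _ _; rewrite gt0_muley.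
Qed.

Lemma alpha_weight (phi : R) :
  derive1 (fun t : R => t * sin t ^+ m) phi = sin phi ^+ m + m%:R * phi * cos phi * sin phi ^+ m.-1.
Proof.
rewrite derive1E; apply: derive_val.
have H := derive_mul (derive_id phi) (derive_exp m (is_derive_sin phi)).
apply: (is_derive_eq H); ring.
Qed.

(** The point pi is left out: for m = 1 the left side is 0 there and the right side is - pi. *)
Lemma alpha_weight_cos (phi : R) : 0 <= phi < pi ->
  sin phi ^+ m * (1 + m%:R * xcot (cos phi)) = derive1 (fun t : R => t * sin t ^+ m) phi.
Proof.
rewrite alpha_weight => /andP[]; rewrite le_eqVlt => /orP[/eqP <- _|p0 pp].
  by rewrite sin0 expr0n gtn_eqF// mul0r add0r mulr0 !mul0r.
have s0 : 0 < sin phi by rewrite sin_gt0_pi// p0.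
rewrite /xcot cosK ?in_itv/= ?(ltW p0) ?ltW// /sinac -sin2cos2 sqrtr_sqr gtr0_norm//.
rewrite mulrDr mulr1; congr +%R.
by rewrite -{1}(prednK m0) exprSr; field; rewrite gt_eqF.
Qed.

(** As phi cot phi <= 1, the integrand is at most 1 + m, which gives the one-sided integrability
    that [mean_polar] asks for. *)
Lemma mean_alpha (v : R) : sphere_volume R m setT = v%:E -> 0 < v ->
  (\int[sigma]_q (1 + m%:R * xcot (thead (\val q)))%:E =
   v%:E * \int[leb]_(phi in `[0%R, pi]) (f phi * derive1 (fun t : R => t * sin t ^+ m) phi)%:E)%E.
Proof.
move=> vE v0.
have n1 : dotp (north R m) (north R m) = 1 by rewrite dotp_north thead_cons.
have mk : measurable_fun setT (fun u : R => 1 + m%:R * xcot u).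
  by apply: measurable_funD => //; apply: measurable_funM => //; exact: measurable_xcot.
have mc : measurable_fun setT (@cos R) by apply: continuous_measurable_fun; exact: continuous_cos.
have ms : measurable_fun setT (@sin R) by apply: continuous_measurable_fun; exact: continuous_sin.
have mf : measurable_fun (`[0, pi[ : set R) f.
  apply: measurable_funS f_meas; first exact: measurable_itv.
  by apply: subset_itvl; rewrite bnd_simp.
rewrite (@mean_polar (fun u => 1 + m%:R * xcot u) v vE v0 mk).
  congr (_ * _)%E.
  (* The point pi, excluded in [alpha_weight_cos], is a null set. *)
  rewrite -!integral_itv_bndo_bndc.
  - apply: eq_integral => phi; rewrite inE/= in_itv/= => phi0.
    by rewrite -mulrA alpha_weight_cos.
  - apply/measurable_EFinP; apply: measurable_funM; first exact: mf.
    apply: measurable_funTS.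
    rewrite (funext alpha_weight); apply: measurable_funD; first exact: measurable_funX.
    apply: measurable_funM; last exact: measurable_funX.
    by apply: measurable_funM => //; exact: measurable_funM.
  - apply/measurable_EFinP; apply: measurable_funM.
      apply: measurable_funM; first exact: mf.
      by apply: measurable_funTS; exact: measurable_funX.
    by apply: measurable_funTS; exact: (measurableT_comp mk mc).
apply: (@ae_bounded_integrable _ _ _ _ _ (1 + m%:R)).
- by rewrite sigma1 ltry.
- apply: (@measurable_mean _ _ (fun u => Num.max (1 + m%:R * xcot u) 0)).
  exact: measurable_maxr.
- apply: filterS (radial_ae_lt1 m0 f_meas f_ge0 sigma_radial n1) => q qI.
  rewrite ger0_norm ?le_max ?lexx ?orbT// ge_max addr_ge0 ?ler0n// andbT lerD2l.
  by rewrite -[leRHS]mulr1 ler_wpM2l// xcot_le1.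
Qed.
End radial_mean.

Section sdiff_sum_bounds.
Context (R : realType) (m : nat).
Implicit Types (k : R -> R) (t h c : R) (y : m.+2.-tuple R).

Lemma sdiff_sum_ge k t h y c :
  (forall i, c <= sdiff k (dotp (meridian m t) y) (dotp (frame t i) y) h) ->
  m.+1%:R * c <= sdiff_sum k t h y.
Proof.
move=> H; have -> : m.+1%:R * c = \sum_(i < m.+1) c by rewrite sumr_const card_ord mulr_natl.
by apply: ler_sum => i _; exact: H.
Qed.

Lemma sdiff_sum_le k t h y c :
  (forall i, sdiff k (dotp (meridian m t) y) (dotp (frame t i) y) h <= c) ->
  sdiff_sum k t h y <= m.+1%:R * c.
Proof.
move=> H; have -> : m.+1%:R * c = \sum_(i < m.+1) c by rewrite sumr_const card_ord mulr_natl.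
by apply: ler_sum => i _; exact: H.
Qed.
End sdiff_sum_bounds.

(** * Extrema at the pole *)

Section pole_minimum.
Context (R : realType) (m : nat).
Hypothesis m0 : (0 < m)%N.
Variable f : R -> R.
Hypothesis f_meas : measurable_fun (`[0, pi] : set R) f.
Hypothesis f_ge0 : forall phi : R, 0 <= phi <= pi -> 0 <= f phi.
Notation S := (sphere R m.+1).
Variable sigma : {measure set S -> \bar R}.
Hypothesis sigma_radial : radial f (north R m) sigma.
Hypothesis sigma1 : sigma setT = 1%E.
Local Notation Phi t := (mean sigma (@halfsq R) (meridian m t)).

Let sigma_fin : (sigma setT < +oo)%E. Proof. by rewrite sigma1 ltry. Qed.

Lemma meridian0 : meridian m (0 : R) = north R m.
Proof.
apply: val_inj; rewrite /= cos0 sin0; congr cons.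
Qed.

Lemma halfsq_integrable x : mean_integrable sigma (@halfsq R) x.
Proof.
apply: (ae_bounded_integrable sigma_fin (M := pi ^+ 2)).
  exact: (measurable_mean x (@measurable_halfsq R)).
apply: (@aeW _ _ _ sigma) => q.
by have /andP[h0 hp] := halfsq_itv (dotp x (\val q)); rewrite ger0_norm.
Qed.

(** From the pole every direction leads to the same height cos h, so all second differences of a
    mean coincide there. *)
Lemma mean_geodesic0 (k : R -> R) i (s h : R) : measurable_fun setT k -> s ^+ 2 = 1 ->
  mean sigma k (geodesic 0 i s h : m.+2.-tuple R) = mean sigma k (meridian m h).
Proof.
move=> mk s1; apply: (mean_eq f_meas f_ge0 sigma_radial mk).
- exact: geodesic_unit.
- exact: meridian_unit.
- by rewrite thead_geodesic thead_meridian sin0 cos0 mul0r mulr0 subr0 mul1r; case: ifP.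
Qed.

Lemma cvg_small (h_ : nat -> R) : (forall n, `|h_ n| <= n.+1%:R^-1) -> h_ @ \oo --> (0 : R).
Proof.
move=> hn; apply/norm_cvg0P.
apply: (@squeeze_cvgr _ _ _ _ (cst 0) harmonic); last exact: cvg_harmonic.
  by apply: nearW => n; rewrite normr_ge0 /=; exact: hn.
exact: cvg_cst.
Qed.

Lemma pole_minimum :
  sigma.-integrable setT (EFin \o (fun q => cotbound (thead (\val q)))) ->
  (0 < \int[sigma]_q (1 + m%:R * xcot (thead (\val q)))%:E)%E ->
  exists2 r : R, 0 < r & forall t, 0 <= t < r -> Phi 0 <= Phi t.
Proof.
move=> ic; apply: contraPP => nomin; apply/negP; rewrite -leNgt.
have [h_ hP] : {h_ : nat -> R & forall n, 0 <= h_ n < n.+1%:R^-1 /\ Phi (h_ n) < Phi 0}.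
  apply: (@choice _ _ (fun n t => 0 <= t < n.+1%:R^-1 /\ Phi t < Phi 0)) => n; apply: contra_notP nomin => no.
  exists (n.+1%:R^-1); first by rewrite invr_gt0.
  by move=> t tI; rewrite leNgt; apply/negP => tl; apply: no; exists t.
have h0 n : h_ n != 0.
  by have [_] := hP n; apply: contraTN => /eqP ->; rewrite ltxx.
have hcvg : h_ @ \oo --> (0 : R).
  apply: cvg_small => n; have [/andP[t0 /ltW tn] _] := hP n.
  by rewrite ger0_norm.
have mk : measurable_fun setT (fun u : R => 1 + m%:R * xcot u).
  by apply: measurable_funD => //; apply: measurable_funM => //; exact: measurable_xcot.
have := @laplacian_integral_le0 R m m0 f f_meas f_ge0 sigma sigma_radial (@halfsq R) (@dhalfsq R)
  (@ddhalfsq R) (fun u => 1 + m%:R * xcot u) 1 0 h_ (fun q => m.+1%:R * cotbound (thead (\val q)))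
  (@derive_halfsq R) (@derive_dhalfsq R) (@laplacian_halfsq R m) mk h0 hcvg.
rewrite meridian0; under eq_integral do rewrite mul1r dotp_north; apply.
- have := integrableZl measurableT (m.+1%:R) ic; apply: eq_integrable => // q _.
- exact: halfsq_integrable.
- by move=> *; exact: halfsq_integrable.
- apply: (@aeW _ _ _ sigma) => q n [uI gI]; rewrite mul1r.
  rewrite mulNr -mulrA -mulrN; apply: sdiff_sum_ge => i; rewrite mulrC.
  have -> : thead (\val q) = dotp (meridian m 0) (\val q) by rewrite meridian0 dotp_north.
  apply: sdiff_halfsq_ge => //.
    by have := gI i 1; rewrite dotp_geodesic mul1r expr1n; exact.
  by have := gI i (-1); rewrite dotp_geodesic mulN1r sqrrN expr1n; exact.
- move=> n; rewrite mul1r; apply: sumr_le0 => i _.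
  rewrite !mean_geodesic0 ?sqrrN ?expr1n//; try exact: measurable_halfsq.
  have [_] := hP n; rewrite meridian0; lra.
Qed.
End pole_minimum.

(** Cauchy-Schwarz for x - x', whose squared length is 2 (1 - <x, x'>). *)
Lemma dotp_dist (R : realType) n (x x' y : n.-tuple R) :
  dotp x x = 1 -> dotp x' x' = 1 -> dotp y y = 1 ->
  (dotp x y - dotp x' y) ^+ 2 <= 2 * (1 - dotp x x').
Proof.
move=> x1 x1' y1; have := dotp_cauchy (tadd x (scale (-1) x')) y1.
rewrite !(dotpDl, dotpDr, dotpZl, dotpZr) x1 x1' (dotpC x' x) mulN1r => H.
apply: le_trans H _; lra.
Qed.

Lemma le_cosE (R : realType) (x y : R) : 0 <= x <= pi -> 0 <= y <= pi ->
  (cos x <= cos y) = (y <= x).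
Proof. by move=> xI yI; rewrite !leNgt ltr_cos// in_itv. Qed.

(** * The maximum, with a density vanishing near the antipode *)

Section pole_maximum.
Context (R : realType) (m : nat).
Hypothesis m0 : (0 < m)%N.
Hypothesis m2 : (m <= 2)%N.
Variable f : R -> R.
Hypothesis f_meas : measurable_fun (`[0, pi] : set R) f.
Hypothesis f_ge0 : forall phi : R, 0 <= phi <= pi -> 0 <= f phi.
Notation S := (sphere R m.+1).
Variable sigma : {measure set S -> \bar R}.
Hypothesis sigma_radial : radial f (north R m) sigma.
Hypothesis sigma1 : sigma setT = 1%E.
Variable dl : R.
Hypothesis dl01 : 0 < dl <= 1.
Hypothesis far_antipode : {ae sigma, forall q, -1 + 2 * dl < thead (\val q)}.
Local Notation Phi t := (mean sigma (@halfsq R) (meridian m t)).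
Local Notation G t := (mean sigma (@xcot R) (meridian m t)).

Let sigma_fin : (sigma setT < +oo)%E. Proof. by rewrite sigma1 ltry. Qed.
Let dl0 : 0 < dl. Proof. by case/andP: dl01. Qed.

Lemma integral_ae_le (g : S -> R) (c : R) : sigma.-integrable setT (EFin \o g) ->
  {ae sigma, forall q, g q <= c} -> (\int[sigma]_q (g q)%:E <= c%:E)%E.
Proof.
move=> ig gc.
have ic : sigma.-integrable setT (EFin \o cst c).
  by apply: (ae_bounded_integrable sigma_fin (M := `|c|)) => //; exact: aeW.
have id : sigma.-integrable setT (EFin \o (fun q => c - g q)) by
  have := integrableB measurableT ic ig; apply: eq_integrable.
have md : measurable_fun setT (fun q => c - g q) by apply/measurable_EFinP; exact: measurable_int id.
have E : (\int[sigma]_q (c - g q)%:E = c%:E - \int[sigma]_q (g q)%:E)%E.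
  have cE : (\int[sigma]_q (EFin \o cst c) q = c%:E)%E.
    have := integral_cst sigma measurableT c%:E; rewrite sigma1 mule1 => <-.
    exact: eq_integral.
  have := integralB measurableT ic ig; rewrite cE => <-.
  by apply: eq_integral => q _.
have P : (0 <= \int[sigma]_q (c - g q)%:E)%E.
  rewrite (@ae_eq_integral _ _ _ sigma setT (EFin \o (fun q => Num.max (c - g q) 0))
     (EFin \o (fun q => c - g q)) measurableT).
  - by apply: integral_ge0 => q _; rewrite lee_fin le_max lexx orbT.
  - exact: measurable_int id.
  - by apply/measurable_EFinP; exact: measurable_maxr.
  - apply: filterS gc => q gq _ /=; congr EFin.
    by rewrite max_l// subr_ge0.
have := integrable_fin_num measurableT ig; rewrite /comp => gf.
by move: P; rewrite E -(fineK gf) -EFinB !lee_fin subr_ge0.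
Qed.

(** Replacing the pole by x changes the inner product with q by at most dl, half of the margin 2 dl.
    The quantifier on x stands inside, so one null set serves all x. *)
Lemma ae_near_pole : {ae sigma, forall q, forall x, dotp x x = 1 -> 2 * (1 - thead x) <= dl ^+ 2 ->
  -1 + dl < dotp x (\val q)}.
Proof.
apply: filterS far_antipode => q qP x x1 xn.
have n1 : dotp (north R m) (north R m) = 1 by rewrite dotp_north thead_cons.
have := dotp_dist x1 n1 (sphere_unit q).
rewrite (dotpC x (north R m)) !dotp_north => H.
have : `|dotp x (\val q) - thead (\val q)| <= dl.
  rewrite -(ler_pXn2r (n := 2)) ?nnegrE ?(ltW dl0)// real_normK ?num_real//.
  exact: le_trans xn.
rewrite ler_norml => /andP[+ _]; move: qP; lra.
Qed.

(** The second clause says that the chord from the pole to x has length at most dl. *)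
Definition near_pole (x : m.+2.-tuple R) := dotp x x = 1 /\ 2 * (1 - thead x) <= dl ^+ 2.

Lemma ae_near_pole_itv x : near_pole x -> {ae sigma, forall q, -1 + dl < dotp x (\val q) < 1}.
Proof.
move=> [x1 xn]; apply: filterS2 ae_near_pole (radial_ae_lt1 m0 f_meas f_ge0 sigma_radial x1).
by move=> q /(_ x x1 xn) -> /andP[_ ->].
Qed.

Lemma xcot_integrable x : near_pole x -> mean_integrable sigma (@xcot R) x.
Proof.
move=> xn; apply: (ae_bounded_integrable sigma_fin (M := slopebound dl)).
  exact: (measurable_mean x (@measurable_xcot R)).
by apply: filterS (ae_near_pole_itv xn) => q; exact: xcot_bounded.
Qed.

Lemma near_pole_cos x (t : R) : dotp x x = 1 -> cos t <= thead x -> 0 <= t <= dl -> near_pole x.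
Proof.
move=> x1 xt /andP[t0 tl]; split => //; apply: (@le_trans _ _ (t ^+ 2)).
  have := one_sub_cos_le t; move: xt; lra.
by rewrite ler_pXn2r ?nnegrE// ltW.
Qed.

Lemma near_pole_meridian (t : R) : 0 <= t <= dl -> near_pole (meridian m t).
Proof.
by move=> tI; apply: (near_pole_cos (t := t)) => //; exact: meridian_unit.
Qed.

Lemma near_pole_geodesic0 (h : R) i s : 0 <= h <= dl -> s ^+ 2 = 1 -> near_pole (geodesic 0 i s h).
Proof.
move=> hI s1; apply: (near_pole_cos (t := h)) => //; first exact: geodesic_unit.
by rewrite thead_geodesic sin0 cos0 mul0r mulr0 subr0 mul1r; case: ifP.
Qed.

(** Otherwise G (h_n) >= G 0 along some h_n -> 0; the second differences at the pole are then all >=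
    0, against a Laplacian of [xcot] that is at most - m < 0. *)
Lemma mean_xcot_lt : exists2 r : R, 0 < r & forall t, 0 < t < r -> G t < G 0.
Proof.
apply: contrapT => nor.
have [h_ hP] : {h_ : nat -> R & forall n, 0 < h_ n < Num.min dl n.+1%:R^-1 /\ G 0 <= G (h_ n)}.
  apply: (@choice _ _ (fun n t => 0 < t < Num.min dl n.+1%:R^-1 /\ G 0 <= G t)) => n.
  apply: contra_notP nor => no.
  exists (Num.min dl n.+1%:R^-1); first by rewrite lt_min dl0 invr_gt0 ltr0n.
  by move=> t tI; rewrite ltNge; apply/negP => tl; apply: no; exists t.
have hI n : 0 <= h_ n <= dl.
  by have [/andP[/ltW -> +] _] := hP n; rewrite lt_min => /andP[/ltW ->].
have h0 n : h_ n != 0 by have [/andP[/gt_eqF ->]] := hP n.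
have hcvg : h_ @ \oo --> (0 : R).
  apply: cvg_small => n; have [/andP[/ltW t0]] := hP n.
  by rewrite lt_min => /andP[_ /ltW tn] _; rewrite ger0_norm.
(* The cut-off at - m changes nothing on ]-1, 1[ and makes the bound hold for every argument, so the
   integral is estimated pointwise. *)
pose l (u : R) := Num.min (laplacian m (@dxcot R) (@ddxcot R) u) (- m%:R).
have ml : measurable_fun setT l.
  have mac := @measurable_acos R.
  have msi : measurable_fun setT (@sinac R).
    by apply: (measurableT_comp (@measurable_sqrt R)); apply: measurable_funB => //; exact: measurable_funX.
  have mV j : measurable_fun setT (fun u : R => (sinac u ^+ j)^-1).
    by apply: (measurableT_comp (@measurable_inv R)); exact: measurable_funX.
  have mX : measurable_fun setT (fun u : R => u) by exact: measurable_id.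
  apply: measurable_minr => //; apply: measurable_funB.
    apply: measurable_funM; first by apply: measurable_funB => //; exact: measurable_funX.
    apply: measurable_funM; last exact: mV.
    apply: measurableT_comp; first exact: oppr_measurable.
    apply: measurable_funB.
      by apply: measurable_funB; [exact: measurable_funM|exact: measurable_funX].
    by apply: measurable_funM => //; exact: measurable_funM.
  apply: measurable_funM => //; apply: measurable_funM => //.
  apply: measurable_funM; last exact: mV.
  by apply: measurable_funB => //; exact: measurable_funM.
have Ll u : -1 < u < 1 -> laplacian m (@dxcot R) (@ddxcot R) u = l u.
  by move=> uI; rewrite /l min_l// laplacian_xcot.
have near0 : near_pole (meridian m 0) by apply: near_pole_meridian; rewrite lexx ltW.
have := @laplacian_integral_le0 R m m0 f f_meas f_ge0 sigma sigma_radial (@xcot R) (@dxcot R)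
  (@ddxcot R) l (-1) 0 h_ (fun=> m.+1%:R * ((pi + 1) / dl ^+ 3))
  (@derive_xcot R) (@derive_dxcot R) Ll ml h0 hcvg.
have iw : sigma.-integrable setT (EFin \o (fun q : S => m.+1%:R * ((pi + 1) / dl ^+ 3))).
  by apply: (ae_bounded_integrable sigma_fin (M := `|m.+1%:R * ((pi + 1) / dl ^+ 3)|)) => //; exact: aeW.
move=> /(_ iw (xcot_integrable near0)).
move=> /(_ (fun n i s s1 => xcot_integrable (near_pole_geodesic0 i (hI n) s1))).
move=> K; have : (0 < \int[sigma]_q (-1 * l (dotp (meridian m 0) (\val q)))%:E)%E.
  apply: (@lt_le_trans _ _ (\int[sigma]_q (cst m%:R%:E q))%E).
    by rewrite integral_cst// sigma1 mule1 lte_fin ltr0n.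
  apply: ge0_le_integral => //.
  + by move=> q _; rewrite lee_fin ler0n.
  + apply/measurable_EFinP; apply: measurable_funM => //; exact: (measurable_mean _ ml).
  + by move=> q _; rewrite lee_fin mulN1r lerNr ge_min lexx orbT.
rewrite ltNge => /negP; apply; apply: K.
- apply: filterS ae_near_pole => q qP n [uI gI].
  rewrite mulNr mulN1r lerN2 -mulrA; apply: sdiff_sum_le => i; rewrite mulrC.
  have Q (s : R) : s ^+ 2 = 1 -> -1 + dl < dotp (geodesic 0 i s (h_ n)) (\val q) < 1.
    move=> s1; have /andP[_ ->] := gI i s s1; rewrite andbT.
    by have [] := near_pole_geodesic0 i (hI n) s1; exact: qP.
  apply: (sdiff_xcot_le dl01).
  - by have /andP[_ ->] := uI; rewrite andbT; case: near0; exact: qP.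
  - by have := Q 1; rewrite dotp_geodesic mul1r expr1n; exact.
  - by have := Q (-1); rewrite dotp_geodesic mulN1r sqrrN expr1n; exact.
- move=> n; rewrite mulN1r oppr_le0; apply: sumr_ge0 => i _.
  rewrite !(mean_geodesic0 f_meas f_ge0 sigma_radial) ?sqrrN ?expr1n//; try exact: measurable_xcot.
  have [_] := hP n; move: (G (h_ n)) (G 0) => a b; lra.
Qed.

Lemma dotp_meridian (s t : R) : dotp (meridian m s) (meridian m t) = cos (s - t).
Proof.
by rewrite dotp_cons2 /meridian !(thead_cons, ttail_cons) dotp0l addr0 cosB.
Qed.

Let Phi_le (s t : R) : 0 <= s <= dl -> 0 <= t <= dl ->
  Phi s - Phi t <= slopebound dl * `|s - t|.
Proof.
move=> sI tI.
have is_ := halfsq_integrable sigma1 (meridian m s).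
have it := halfsq_integrable sigma1 (meridian m t).
pose g (q : S) : R := halfsq (dotp (meridian m s) (\val q)) - halfsq (dotp (meridian m t) (\val q)).
have ig : sigma.-integrable setT (EFin \o g).
  have := integrableB measurableT is_ it; apply: eq_integrable => // q _.
have E : (\int[sigma]_q (g q)%:E = (Phi s - Phi t)%:E)%E.
  have := integralB measurableT is_ it.
  rewrite (integral_mean is_) (integral_mean it) EFinB => <-; exact: eq_integral.
rewrite -lee_fin -E; apply: (integral_ae_le ig).
have near_s := near_pole_meridian sI; have near_t := near_pole_meridian tI.
apply: filterS2 (ae_near_pole_itv near_s) (ae_near_pole_itv near_t) => q qs qt.
apply: le_trans (ler_norm _) _; apply: le_trans (halfsq_lipschitz dl01 qs qt) _.
apply: ler_wpM2l.
  by rewrite /slopebound addr_ge0// divr_ge0 ?(ltW dl0)// mulr_ge0// pi_ge0.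
rewrite -(ler_pXn2r (n := 2)) ?nnegrE// !real_normK ?num_real//.
apply: le_trans (dotp_dist (meridian_unit m s) (meridian_unit m t) (sphere_unit q)) _.
have := one_sub_cos_le (s - t); rewrite dotp_meridian; lra.
Qed.

(** Supplies the continuity of W in [pole_maximum]. *)
Lemma mean_halfsq_lipschitz (s t : R) : 0 <= s <= dl -> 0 <= t <= dl ->
  `|Phi s - Phi t| <= slopebound dl * `|s - t|.
Proof.
move=> sI tI; rewrite ler_norml lerNl opprB Phi_le//= andbT distrC.
exact: Phi_le.
Qed.

Lemma sdiff_sum_halfsq_le (t h : R) (q : S) :
  (forall x, dotp x x = 1 -> 2 * (1 - thead x) <= dl ^+ 2 -> -1 + dl < dotp x (\val q)) ->
  near_pole (meridian m t) -> (forall i s, s ^+ 2 = 1 -> near_pole (geodesic t i s h)) ->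
  good_point t h q ->
  sdiff_sum (@halfsq R) t h (\val q) <= m.+1%:R * (h ^+ 2 * (2 * curvbound dl + 1)).
Proof.
move=> qP near_t near_g [uI gI]; apply: sdiff_sum_le => i.
have Q (s : R) : s ^+ 2 = 1 -> -1 + dl < dotp (geodesic t i s h) (\val q) < 1.
  move=> s1; have /andP[_ ->] := gI i s s1; rewrite andbT.
  by have [] := near_g i s s1; exact: qP.
apply: (sdiff_halfsq_le dl01).
- by rewrite ler_norml; apply: dotp_unit_itv; [exact: frame_unit|exact: sphere_unit].
- by have /andP[_ ->] := uI; rewrite andbT; case: near_t; exact: qP.
- by have := Q 1; rewrite dotp_geodesic mul1r expr1n; exact.
- by have := Q (-1); rewrite dotp_geodesic mulN1r sqrrN expr1n; exact.
Qed.

(** At the pole all m + 1 second differences equal 2 (Phi h - Phi 0), so their upper bound controls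
    Phi h - Phi 0 to order h^2. *)
Lemma mean_halfsq_quadratic (h : R) : 0 <= h <= dl ->
  2 * (Phi h - Phi 0) <= h ^+ 2 * (2 * curvbound dl + 1).
Proof.
move=> hI; have near0 : near_pole (meridian m 0) by apply: near_pole_meridian; rewrite lexx ltW.
have [ig E] := integral_sdiff_sum (h := h) (halfsq_integrable sigma1 (meridian m 0))
  (fun i s _ => halfsq_integrable sigma1 (geodesic 0 i s h)).
have := integral_ae_le ig (c := m.+1%:R * (h ^+ 2 * (2 * curvbound dl + 1))).
rewrite E lee_fin => /(_ _)/wrap[].
  apply: filterS2 ae_near_pole (ae_good_point m0 f_meas f_ge0 sigma_radial 0 (cst h)) => q qP /(_ 0%N) gq.
  by apply: sdiff_sum_halfsq_le => // i s; exact: near_pole_geodesic0.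
rewrite (eq_bigr (fun=> 2 * (Phi h - Phi 0))) => [|i _].
  by rewrite sumr_const card_ord -[leLHS]mulr_natl ler_pM2l.
rewrite !(mean_geodesic0 f_meas f_ge0 sigma_radial) ?sqrrN ?expr1n//; try exact: measurable_halfsq.
ring.
Qed.

Lemma integral_laplacian_halfsq (e t : R) : near_pole (meridian m t) ->
(\int[sigma]_q (e * (1 + m%:R * xcot (dotp (meridian m t) (\val q))))%:E = (e * (1 + m%:R * G t))%:E)%E.
Proof.
move=> nt; have ix := xcot_integrable nt.
have i1 : sigma.-integrable setT (EFin \o (fun q : S => 1)).
  by apply: (ae_bounded_integrable sigma_fin (M := `|1|)) => //; exact: aeW.
have E1 : (\int[sigma]_q (EFin \o (fun q : S => 1%R)) q = 1)%E.
  have := integral_cst sigma measurableT 1%E; rewrite mul1e sigma1 => <-.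
  exact: eq_integral.
have iz := integrableZl measurableT (m%:R) ix.
have iD := integrableD measurableT i1 iz.
have := integralZl measurableT iD e.
rewrite (integralD measurableT i1 iz) E1 (integralZl measurableT ix) (integral_mean ix).
by move=> H; apply: (etrans _ H); exact: eq_integral.
Qed.

(* If Phi t1 > Phi 0, subtract half the slope of the chord over [0, t1]: as
   Phi t - Phi 0 = O(t^2), the result W has an interior minimum ts.  There all
   second differences of Phi are >= 0, so 1 + m G ts >= 0 = 1 + m G 0, against
   [mean_xcot_lt]. *)
Lemma pole_maximum :
  (\int[sigma]_q (1 + m%:R * xcot (thead (\val q)))%:E = 0)%E ->
  exists2 r : R, 0 < r & forall t, 0 <= t < r -> Phi t <= Phi 0.
Proof.
move=> lap0.
have [r0 r00 Gr] := mean_xcot_lt.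
exists (Num.min r0 dl); first by rewrite lt_min r00.
move=> t1 /andP[t10]; rewrite lt_min => /andP[t1r t1d].
rewrite leNgt; apply/negP => Phi1.
have {t10} t10 : 0 < t1.
  by rewrite lt_neqAle t10 andbT; apply: contraTN Phi1 => /eqP <-; rewrite ltxx.
(* Subtracting half the chord slope M leaves W t1 = (Phi t1 - Phi 0) / 2 > 0 = W 0. *)
pose M := (Phi t1 - Phi 0) / t1.
have M0 : 0 < M by rewrite divr_gt0// subr_gt0.
pose W t := Phi t - Phi 0 - M / 2 * t.
have tdl t : 0 <= t <= t1 -> 0 <= t <= dl.
  by move=> /andP[-> tt1]; rewrite (le_trans tt1)// ltW.
have Wcont : {within `[0, t1], continuous W}.
  apply/subspace_continuousP => t /=; rewrite in_itv/= => tI.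
  apply: cvgB; last by apply: cvgM; [exact: cvg_cst|exact: cvg_within].
  apply: cvgB; last exact: cvg_cst.
  apply/cvgrPdist_le => e e0.
  have L0 : 0 < slopebound dl.
    by rewrite /slopebound ltr_pwDl// divr_ge0 ?(ltW dl0)// mulr_ge0// pi_ge0.
  apply: filterS (nbhsx_ballx t (e / slopebound dl) (divr_gt0 e0 L0)) => x tx xI.
  apply: le_trans (mean_halfsq_lipschitz (tdl _ tI) (tdl _ xI)) _.
  by rewrite mulrC -ler_pdivlMr// ltW.
have [ts tsI Wmin] := EVT_min (ltW t10) Wcont.
have W1 : 0 < W t1.
  rewrite /W; have -> : M / 2 * t1 = (Phi t1 - Phi 0) / 2 by rewrite /M; field; rewrite gt_eqF.
  by move: Phi1; lra.
pose K := 2 * curvbound dl + 1.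
have K0 : 0 < K.
  rewrite /K /curvbound ltr_pwDr// mulr_ge0// addr_ge0// divr_ge0 ?exprn_ge0 ?(ltW dl0)//.
  by rewrite addr_ge0// pi_ge0.
have Wneg : exists2 t, t \in `[0, t1] & W t < 0.
  (* For t <= M / (2 K) the quadratic bound gives Phi t - Phi 0 <= t^2 K / 2 <= t M / 4, less than
     the subtracted t M / 2. *)
  pose t := Num.min t1 (M / (2 * K)).
  have t0 : 0 < t by rewrite lt_min t10 divr_gt0// mulr_gt0.
  have tt1 : t <= t1 by rewrite ge_min lexx.
  have tM : t <= M / (2 * K) by rewrite ge_min lexx orbT.
  exists t; first by rewrite in_itv/= ltW.
  have := @mean_halfsq_quadratic t; rewrite -/K => /(_ _)/wrap[].
    by apply: tdl; rewrite ltW.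
  have : t * (t * K) <= t * (M / 2).
    rewrite ler_pM2l// -ler_pdivlMr//; apply: le_trans tM _.
    by rewrite invfM mulrA.
  rewrite /W; have : 0 < t * M by rewrite mulr_gt0.
  nra.
have ts0 : W ts < 0 by have [t tI Wt] := Wneg; exact: le_lt_trans (Wmin t tI) Wt.
have {tsI} tsI : 0 < ts < t1.
  move: tsI; rewrite in_itv/= => /andP[a b]; rewrite !lt_neqAle a b !andbT.
  apply/andP; split; [apply: contraTneq ts0 => <-|apply: contraTneq ts0 => ->].
    by rewrite /W subrr mulr0 subr0 ltxx.
  by rewrite ltNge ltW.
have /andP[ts_gt0 ts_lt] := tsI.
have t1pi : t1 <= pi.
  by apply: (le_trans (ltW t1d)); case/andP: dl01 => _ d1; apply: (le_trans d1); have := pi_ge2 R; lra.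
have cos_lt : cos t1 < cos ts.
  rewrite ltr_cos// in_itv/= ?(ltW ts_gt0) ?(ltW t10)//=.
  by apply: le_trans t1pi; exact: ltW.
(* Steps h <= eta keep every end point within distance t1 of the pole: ts +- h stays in [[0, t1]],
   and cos ts cos h >= cos t1 follows from 1 - cos h <= h^2 / 2 <= h <= cos ts - cos t1. *)
pose eta := Num.min (Num.min ts (t1 - ts)) (Num.min (cos ts - cos t1) 1).
have eta0 : 0 < eta.
  by rewrite !lt_min ts_gt0 !subr_gt0 ts_lt cos_lt/=.
pose h_ n := eta * n.+1%:R^-1.
have h_gt0 n : 0 < h_ n by rewrite mulr_gt0 ?invr_gt0.
have h_eta n : h_ n <= eta.
  by rewrite -[leRHS]mulr1 ler_pM2l// invf_le1// ler1n.
have h_eta' n : [/\ h_ n <= ts, h_ n <= t1 - ts, h_ n <= cos ts - cos t1 & h_ n <= 1].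
  by have := h_eta n; rewrite !le_min => /andP[/andP[-> ->] /andP[-> ->]].
have Wts t : 0 <= t <= t1 -> M / 2 * (t - ts) <= Phi t - Phi ts.
  by move=> tI; have := Wmin t tI; rewrite /W mulrBr; lra.
have MA (t : R) x : dotp x x = 1 -> thead x = cos t -> mean sigma (@halfsq R) x = Phi t.
  move=> x1 xt; apply: (mean_eq f_meas f_ge0 sigma_radial (@measurable_halfsq R) x1) => //.
  exact: meridian_unit.
(* As ts < 1 <= pi / 2, a move across the meridian does not bring the point closer to the pole. *)
have cos_ts0 : 0 <= cos ts.
  apply: cos_ge0_pihalf; have := pi_ge2 R; case/andP: dl01 => _ d1 pi2; apply/andP; split; lra.
have ch n : cos t1 <= cos ts * cos (h_ n) <= cos ts.
  have [_ _ hc h1] := h_eta' n; have hn0 := h_gt0 n.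
  apply/andP; split; last by rewrite -[leRHS]mulr1 ler_wpM2l// cos_le1.
  have := one_sub_cos_le (h_ n); have := cos_le1 ts; have := cos_le1 (h_ n).
  nra.
(* The end point lies at a distance tau >= ts, so minimality of W at ts and M > 0 give Phi tau >=
   Phi ts. *)
have across n i s : s ^+ 2 = 1 -> i != ord0 -> Phi ts <= mean sigma (@halfsq R) (geodesic ts i s (h_ n)).
  move=> s1 i0; have /andP[c1 c2] := ch n.
  pose tau := acos (cos ts * cos (h_ n)).
  have cI : -1 <= cos ts * cos (h_ n) <= 1.
    by rewrite (le_trans (cos_geN1 t1) c1) (le_trans c2 (cos_le1 ts)).
  have cE : cos tau = cos ts * cos (h_ n) by rewrite acosK// in_itv.
  have tau0 : 0 <= tau by rewrite acos_ge0.
  have taupi : tau <= pi by rewrite acos_lepi.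
  have tauI : ts <= tau <= t1.
    have tsI' : 0 <= ts <= pi by rewrite (ltW ts_gt0) (le_trans (ltW ts_lt) t1pi).
    have t1I : 0 <= t1 <= pi by rewrite (ltW t10).
    have tauI' : 0 <= tau <= pi by rewrite tau0.
    by rewrite -(le_cosE tauI' tsI') -(le_cosE t1I tauI') cE c1 c2.
  have -> : mean sigma (@halfsq R) (geodesic ts i s (h_ n)) = Phi tau.
    by apply: MA; [exact: geodesic_unit|rewrite thead_geodesic (negbTE i0) cE].
  have /andP[ta tb] := tauI.
  have := Wts tau; rewrite tb (le_trans (ltW ts_gt0) ta) => /(_ isT).
  move=> H; rewrite -subr_ge0; apply: le_trans H.
  by rewrite mulr_ge0 ?subr_ge0// divr_ge0// ltW.
(* Along the meridian the linear term of W cancels in the symmetric difference. *)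
have along n : 0 <= mean sigma (@halfsq R) (geodesic ts ord0 1 (h_ n)) +
    mean sigma (@halfsq R) (geodesic ts ord0 (-1) (h_ n)) - 2 * Phi ts.
  have [ha hb _ _] := h_eta' n; have hn0 := h_gt0 n.
  have G1 (s : R) : s ^+ 2 = 1 -> mean sigma (@halfsq R) (geodesic ts ord0 s (h_ n)) = Phi (ts + s * h_ n).
    by move=> s1; apply: MA; [exact: geodesic_unit|exact: geodesic0].
  rewrite !G1 ?sqrrN ?expr1n// mul1r mulN1r.
  have A1 := Wts (ts + h_ n); have A2 := Wts (ts - h_ n).
  have {}A1 : M / 2 * (ts + h_ n - ts) <= Phi (ts + h_ n) - Phi ts by apply: A1; lra.
  have {}A2 : M / 2 * (ts - h_ n - ts) <= Phi (ts - h_ n) - Phi ts by apply: A2; lra.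
  lra.
have near_g n i s : s ^+ 2 = 1 -> near_pole (geodesic ts i s (h_ n)).
  move=> s1; apply: (near_pole_cos (t := t1)); first exact: geodesic_unit.
    have [->|i0] := eqVneq i ord0; last first.
      by rewrite thead_geodesic (negbTE i0); case/andP: (ch n).
    have [ha hb _ _] := h_eta' n; have hn0 := h_gt0 n.
    rewrite geodesic0//; move/eqP: s1; rewrite sqrf_eq1 => /orP[]/eqP ->.
      by rewrite le_cosE; [lra|apply/andP; split; lra..].
    by rewrite le_cosE; [lra|apply/andP; split; lra..].
  by rewrite !ltW.
have near_ts : near_pole (meridian m ts).
  by apply: near_pole_meridian; apply: tdl; rewrite !ltW.
have mk : measurable_fun setT (fun u : R => 1 + m%:R * xcot u).
  by apply: measurable_funD => //; apply: measurable_funM => //; exact: measurable_xcot.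
have h0 n : h_ n != 0 by rewrite gt_eqF.
have hcvg : h_ @ \oo --> (0 : R).
  apply: cvg_small => n; rewrite gtr0_norm// -[leRHS]mul1r ler_pM2r ?invr_gt0//.
  by rewrite !ge_min lexx !orbT.
have iw : sigma.-integrable setT (EFin \o (fun q : S => m.+1%:R * K)).
  by apply: (ae_bounded_integrable sigma_fin (M := `|m.+1%:R * K|)) => //; exact: aeW.
have := @laplacian_integral_le0 R m m0 f f_meas f_ge0 sigma sigma_radial (@halfsq R) (@dhalfsq R)
  (@ddhalfsq R) (fun u => 1 + m%:R * xcot u) (-1) ts h_ (fun=> m.+1%:R * K)
  (@derive_halfsq R) (@derive_dhalfsq R) (@laplacian_halfsq R m) mk h0 hcvg iw
  (halfsq_integrable sigma1 _) (fun n i s _ => halfsq_integrable sigma1 _).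
move=> /(_ _)/wrap[|/(_ _)/wrap[|]].
- apply: filterS ae_near_pole => q qP n gq.
  rewrite mulNr mulN1r lerN2 -mulrA; rewrite (mulrC K).
  by apply: sdiff_sum_halfsq_le => // i s; exact: near_g.
- move=> n; rewrite mulN1r oppr_le0; apply: sumr_ge0 => i _.
  have [->|i0] := eqVneq i ord0; first exact: along.
  have := across n i 1; have := across n i (-1); rewrite sqrrN expr1n.
  by move=> /(_ erefl i0) + /(_ erefl i0); lra.
have near0 : near_pole (meridian m 0) by apply: near_pole_meridian; rewrite lexx ltW.
rewrite integral_laplacian_halfsq// lee_fin mulN1r oppr_le0 => pos.
have := integral_laplacian_halfsq 1 near0; rewrite mul1r meridian0.
have -> : (\int[sigma]_q (1 * (1 + m%:R * xcot (dotp (north R m) (\val q))))%:E = 0)%E.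
  by rewrite -[RHS]lap0; apply: eq_integral => q _; rewrite mul1r dotp_north.
move=> -[zero].
have : G ts < G 0 by apply: Gr; rewrite ts_gt0 (lt_trans ts_lt).
rewrite -(ltr_pM2l (_ : 0 < m%:R)) ?ltr0n// meridian0.
by move: pos zero; lra.
Qed.
End pole_maximum.

(** * From [mu] to the model measure at the north pole *)

Section frechet_radial.
Context (R : realType) (m : nat).
Hypothesis m0 : (0 < m)%N.
Variable f : R -> R.
Hypothesis f_meas : measurable_fun (`[0, pi] : set R) f.
Hypothesis f_ge0 : forall phi : R, 0 <= phi <= pi -> 0 <= f phi.
Notation S := (sphere R m.+1).
Notation V := (sphere_volume R m.+1).
Variables (p : S) (mu : probability S R).
Hypothesis mu_radial : radial f (\val p) mu.
Variable sigma : {measure set S -> \bar R}.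
Hypothesis sigma_radial : radial f (north R m) sigma.

Let n1 : dotp (north R m) (north R m) = 1. Proof. by rewrite dotp_north thead_cons. Qed.

Lemma radial_transport_north (k : R -> R) x x' : dotp x x = 1 -> dotp x' x' = 1 ->
  dotp (\val p) x = thead x' -> measurable_fun setT k ->
  (\int[mu]_q (k (dotp x (\val q)))%:E = \int[sigma]_q (k (dotp x' (\val q)))%:E)%E.
Proof.
move=> x1 x1' xx' mk; apply: (radial_transport f_meas f_ge0 mu_radial sigma_radial
  (sphere_unit p) x1 n1 x1' _ mk).
by rewrite dotp_north.
Qed.

Lemma radial_mass : sigma setT = 1%E.
Proof.
have := radial_transport_north (sphere_unit p) n1 _ (measurable_cst (1 : R) : measurable_fun setT (cst (1 : R) : R -> R)).
rewrite sphere_unit thead_cons => /(_ erefl).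
have C (nu : {measure set S -> \bar R}) : (\int[nu]_(q in setT) 1%:E = nu setT)%E.
  by rewrite integral_cst// mul1e.
by rewrite /= (C sigma) (C mu) => <-; exact: probability_setT.
Qed.

Lemma frechet_mean (x : S) :
  frechet mu x = mean sigma (@halfsq R) (meridian m (sdist p x)).
Proof.
congr fine; rewrite -(radial_transport_north (sphere_unit x) (meridian_unit m _) _ (@measurable_halfsq R)).
  by apply: eq_integral => q _; rewrite /sdist dotpC.
by rewrite thead_meridian /sdist acosK// in_itv/=; exact: dotp_unit_itv (sphere_unit p) (sphere_unit x).
Qed.

(** Balls around the antipode become caps in u = <p, q>: with e = min (eps, 1) <= pi and dl = (1 -
    cos e) / 4, the threshold -1 + 2 dl is strictly below - cos e. *)
Lemma antipode_cap (eps : R) : 0 < eps -> exists2 dl : R, 0 < dl <= 1 &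
  forall q : S, dotp (\val p) (\val q) <= -1 + 2 * dl -> sball (antipode p) eps q.
Proof.
move=> eps0; pose e := Num.min eps 1; have e0 : 0 < e by rewrite lt_min eps0/=.
have e1 : e <= 1 by rewrite ge_min lexx orbT.
have epi : e <= pi by apply: (le_trans e1); have := pi_ge2 R; lra.
have ce : cos e < 1 by rewrite -cos0 ltr_cos// in_itv/= ?lexx ?pi_ge0// (ltW e0).
have ceN := cos_geN1 e.
exists ((1 - cos e) / 4); first by apply/andP; split; lra.
move=> q qp; rewrite /sball /sdist/=.
have -> : dotp (map_tuple -%R (\val p)) (\val q) = - dotp (\val p) (\val q).
  by rewrite /dotp -sumrN; apply: eq_bigr => i _; rewrite tnth_map mulNr.
have uI := dotp_unit_itv (sphere_unit p) (sphere_unit q).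
set u := dotp _ _ in uI qp *.
have nuI : -1 <= - u <= 1 by move: uI => /andP[a b]; rewrite lerN2 b lerNl a.
apply: (@lt_le_trans _ _ e); last by rewrite ge_min lexx.
rewrite -ltr_cos ?in_itv/= ?acos_ge0 ?acos_lepi ?(ltW e0)//.
rewrite acosK ?in_itv//; lra.
Qed.

(** The indicator of the cap has integral 0 against [mu], and [radial_transport_north] carries this
    over to [sigma]. *)
Lemma vanishing_cap (dl : R) :
  (forall q, dotp (\val p) (\val q) <= -1 + 2 * dl -> f (sdist p q) = 0) ->
  {ae sigma, forall q, -1 + 2 * dl < thead (\val q)}.
Proof.
move=> fq; pose c : R := -1 + 2 * dl; pose k (u : R) : R := (u <= c)%R%:R.
have mle : measurable_fun setT (fun u : R => u <= c) by exact: measurable_fun_ler.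
have mk : measurable_fun setT k.
  rewrite (_ : k = fun u => if u <= c then 1 else 0).
    exact: measurable_fun_ifT.
  by apply/funext => u; rewrite /k; case: ifP.
have mkx x : measurable_fun setT (fun q : S => (k (dotp x (\val q)))%:E).
  by apply/measurable_EFinP; exact: (measurable_mean x mk).
have := radial_transport_north (sphere_unit p) n1 _ mk.
rewrite sphere_unit thead_cons => /(_ erefl).
rewrite (radial_integral f_meas f_ge0 mu_radial (mkx _)); last by move=> q; rewrite lee_fin.
rewrite integral0_eq => [H|q _]; last first.
  rewrite dens_sdist /k -EFinM; congr EFin.
  by case: leP => [/fq ->|_]; rewrite ?mul0r ?mulr0.
have : ae_eq sigma setT (fun q : S => (k (dotp (north R m) (\val q)))%:E) (cst 0%E).
  apply: (ae_eq_integral_abs sigma measurableT (mkx _)).1.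
  by rewrite [RHS]H; apply: eq_integral => q _; rewrite gee0_abs// lee_fin.
apply: filterS => q /(_ I) /=; rewrite dotp_north /k.
by case: leP => // _ [] /eqP; rewrite oner_eq0.
Qed.

Lemma measurable_cotbound : measurable_fun setT (@cotbound R).
Proof.
apply: measurable_fun_ifT => //; first exact: measurable_fun_ltr.
apply: measurable_funM => //; apply: (measurableT_comp (@measurable_inv R)).
apply: (measurableT_comp (@measurable_sqrt R)); apply: measurable_funB => //; exact: measurable_funX.
Qed.

(** The volume is radial around every point, so [radial_transport] applies to it as well. *)
Lemma sphere_volume_radial x : dotp x x = 1 -> radial (cst (1 : R)) x V.
Proof.
move=> x1 A mA; rewrite -[LHS]mul1e -integral_cst// integral_mkcond.
apply: eq_integral => q _.
have uI := dotp_unit_itv x1 (sphere_unit q).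
have -> : dens (cst (1 : R)) (dotp x (\val q)) = 1.
  by rewrite /dens patchE mem_set//= in_itv/= acos_ge0// acos_lepi.
by rewrite patchE mul1r indicE; case: (q \in A).
Qed.

(** In polar coordinates the singularity pi / sin phi meets the factor sin^m phi with m >= 1, so the
    integrand is at most pi; this is where d >= 2 enters. *)
Lemma cotbound_integral_volume : (\int[V]_q (cotbound (dotp (\val p) (\val q)))%:E < +oo)%E.
Proof.
have mc := measurable_cotbound.
have one0 (phi : R) : 0 <= phi <= pi -> 0 <= cst (1 : R) phi by rewrite /= ler01.
have -> : (\int[V]_q (cotbound (dotp (\val p) (\val q)))%:E =
    \int[V]_q (cotbound (dotp (north R m) (\val q)))%:E)%E.
  have E : dotp (\val p) (\val p) = dotp (north R m) (north R m) by rewrite sphere_unit n1.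
  exact: (radial_transport (measurable_cst _) one0 (sphere_volume_radial (sphere_unit p))
    (sphere_volume_radial n1) (sphere_unit p) (sphere_unit p) n1 n1 E mc).
have mcE : measurable_fun setT (EFin \o @cotbound R) by exact/measurable_EFinP.
under eq_integral do rewrite dotp_north.
rewrite (ge0_integral_polar m0 mcE); last by move=> u; rewrite lee_fin cotbound_ge0.
have [v v0 ->] := sphere_volume_pos m0 f_meas f_ge0 sigma_radial radial_mass.
have mcos : measurable_fun setT (@cos R) by apply: continuous_measurable_fun; exact: continuous_cos.
have msin : measurable_fun setT (@sin R) by apply: continuous_measurable_fun; exact: continuous_sin.
apply: lte_mul_pinfty => //; first by rewrite lee_fin ltW.
apply: (@le_lt_trans _ _ (\int[@lebesgue_measure R]_(phi in `[0%R, pi]) (cst pi%:E phi))%E).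
  apply: ge0_le_integral => //.
  - move=> phi; rewrite /= in_itv/= => phi0.
    by rewrite -EFinM lee_fin mulr_ge0 ?cotbound_ge0// exprn_ge0// sin_ge0_pi.
  - apply: emeasurable_funM; apply/measurable_EFinP; apply: measurable_funTS.
      exact: (measurableT_comp mc mcos).
    exact: measurable_funX.
  - move=> phi; rewrite /= in_itv/= => phi0; rewrite -EFinM lee_fin.
    have s0 : 0 <= sin phi by rewrite sin_ge0_pi.
    rewrite /cotbound /sinac; case: ltP => c0; last by rewrite mul0r pi_ge0.
    rewrite -sin2cos2 sqrtr_sqr ger0_norm// -mulrA -[leRHS]mulr1 ler_wpM2l ?pi_ge0//.
    have [->|sN0] := eqVneq (sin phi) 0; first by rewrite invr0 mul0r ler01.
    rewrite -[in leLHS](prednK m0) exprS mulrA mulVf// mul1r exprn_ile1// sin_le1.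
by rewrite integral_cst//= lebesgue_measure_itv/= lte_fin pi_gt0 -EFinD -EFinM ltry.
Qed.

(** Split at u = -1 + dl. On the cap around the antipode the density is at most M and [cotbound] is
    integrable for the volume; elsewhere [cotbound] is at most pi / dl and the density has total
    mass 1. *)
Lemma cotbound_integrable (dl M : R) : 0 < dl <= 1 ->
  (forall q, dotp (\val p) (\val q) <= -1 + dl -> `|f (sdist p q)| <= M) ->
  sigma.-integrable setT (EFin \o (fun q => cotbound (thead (\val q)))).
Proof.
move=> dl01 fM; have /andP[dl0 dl1] := dl01.
have mc := measurable_cotbound.
have mcx x : measurable_fun setT (fun q : S => (cotbound (dotp x (\val q)))%:E).
  by apply/measurable_EFinP; exact: (measurable_mean x mc).
apply/integrableP; split.
  by have := mcx (north R m); apply: eq_measurable_fun => q _; rewrite /= dotp_north.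
have -> : (\int[sigma]_q `|(EFin \o (fun q => cotbound (thead (\val q)))) q| =
    \int[sigma]_q (cotbound (dotp (north R m) (\val q)))%:E)%E.
  by apply: eq_integral => q _; rewrite /= dotp_north ger0_norm// cotbound_ge0.
rewrite -(radial_transport_north (sphere_unit p) n1 _ mc); last by rewrite sphere_unit thead_cons.
rewrite (radial_integral f_meas f_ge0 mu_radial (mcx _)); last first.
  by move=> q; rewrite lee_fin cotbound_ge0.
have md : measurable_fun setT (fun q : S => (dens f (dotp (\val p) (\val q)))%:E).
  by apply/measurable_EFinP; exact: (measurable_mean _ (measurable_dens f_meas)).
have pd0 : 0 <= pi / dl :> R by rewrite divr_ge0 ?pi_ge0// ltW.
apply: (@le_lt_trans _ _ (\int[V]_q (`|M|%:E * (cotbound (dotp (\val p) (\val q)))%:E +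
   (dens f (dotp (\val p) (\val q)))%:E * (pi / dl)%:E))%E).
  apply: ge0_le_integral => //.
  - by move=> q _; rewrite mule_ge0// lee_fin ?dens_ge0// cotbound_ge0.
  - exact: emeasurable_funM.
  - apply: emeasurable_funD; apply: emeasurable_funM => //.
  - move=> q _; rewrite -!EFinM -EFinD lee_fin.
    have d0 := dens_ge0 f_ge0 (dotp (\val p) (\val q)).
    have c0 := cotbound_ge0 (dotp (\val p) (\val q)).
    have [uN|uN] := leP (dotp (\val p) (\val q)) (-1 + dl).
      apply: ler_wpDr; first by rewrite mulr_ge0.
      rewrite ler_wpM2r// dens_sdist; apply: le_trans (ler_norm _) _.
      exact: le_trans (fM q uN) (ler_norm _).
    apply: ler_wpDl; first by rewrite mulr_ge0.
    rewrite ler_wpM2l// /cotbound; case: ltP => // u0.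
    by rewrite ler_pM2l ?pi_gt0// lef_pV2 ?posrE ?(lt_le_trans dl0)// sinac_ge.
rewrite ge0_integralD//; last 4 first.
- by move=> q _; rewrite mule_ge0// lee_fin cotbound_ge0.
- exact: emeasurable_funM.
- by move=> q _; rewrite mule_ge0// lee_fin dens_ge0.
- exact: emeasurable_funM.
apply: lte_add_pinfty.
  rewrite ge0_integralZl//; last by move=> q _; rewrite lee_fin cotbound_ge0.
  by apply: lte_mul_pinfty => //; exact: cotbound_integral_volume.
have mcst : measurable_fun setT (cst (pi / dl)%:E : S -> \bar R) by exact: measurable_cst.
rewrite -(radial_integral f_meas f_ge0 mu_radial mcst); last by move=> q; rewrite lee_fin.
by rewrite integral_cst// [X in (_ * X)%E]probability_setT mule1 ltry.
Qed.
End frechet_radial.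

Theorem proposition2p10 (R : realType) (d : nat) (d_ge2 : (2 <= d)%N)
    (p : sphere R d) (mu : probability (sphere R d) R) (f : R -> R)
    (f_meas : measurable_fun (`[0, pi] : set R) f)
    (f_ge0 : forall phi : R, 0 <= phi <= pi -> 0 <= f phi)
    (mu_f : forall A : set (sphere R d), measurable A ->
       mu A = (\int[sphere_volume R d]_(q in A) (f (sdist p q))%:E)%E) :
  ((exists2 eps : R, 0 < eps &
      exists M : R, forall q, sball (antipode p) eps q ->
        `|f (sdist p q)| <= M) ->
    0 < alpha d f -> local_minimum (frechet mu) p) /\
  ((d < 4)%N ->
    (exists2 eps : R, 0 < eps &
      forall q, sball (antipode p) eps q -> f (sdist p q) = 0) ->
    alpha d f = 0 -> local_maximum (frechet mu) p).
Proof.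
case: d d_ge2 p mu mu_f => [//|m] d_ge2 p mu mu_f.
have m0 : (0 < m)%N by [].
have mu_radial : radial f (\val p) mu.
  move=> A mA; rewrite mu_f// integral_mkcond; apply: eq_integral => q _.
  by rewrite patchE dens_sdist indicE; case: (q \in A); rewrite ?mulr1 ?mulr0.
have [sigma sr] := radial_exists f_meas f_ge0 (north R m).
have s1 := radial_mass f_meas f_ge0 mu_radial sr.
have FE x := frechet_mean f_meas f_ge0 mu_radial sr x.
have [v v0 vE] := sphere_volume_pos m0 f_meas f_ge0 sr s1.
have := mean_alpha m0 f_meas f_ge0 sr s1 vE v0.
have : alpha m.+1 f = v / m.+1%:R * fine (\int[lebesgue_measure]_(phi in `[0%R, pi])
    (f phi * derive1 (fun t : R => t * sin t ^+ m) phi)%:E)%E.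
  by rewrite /alpha vE.
move: (\int[lebesgue_measure]_(_ in _) _)%E => I -> lapE.
have w0 : 0 < v / m.+1%:R by rewrite divr_gt0.
have pp0 : sdist p p = 0 by rewrite /sdist sphere_unit acos1.
split=> [[eps eps0 [M fM]]|m4 [eps eps0 f0]]; have [dl dl01 cap] := antipode_cap p eps0.
  rewrite pmulr_rgt0// => I0.
  have cq : forall q : sphere R m.+1, dotp (\val p) (\val q) <= -1 + dl -> `|f (sdist p q)| <= M.
    move=> q qd; apply/fM/cap/(le_trans qd); rewrite lerD2l.
    by case/andP: dl01; lra.
  have ci := cotbound_integrable m0 f_meas f_ge0 mu_radial sr dl01 cq.
  have lap_gt0 : (0 < \int[sigma]_q (1 + m%:R * xcot (thead (\val q)))%:E)%E.
    rewrite lapE mule_gt0 ?lte_fin//.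
    (* [fine] sends an infinite integral to 0, so alpha > 0 already makes I a positive real. *)
    by case: I I0 {lapE} => [r||] /=; rewrite ?ltxx.
  have [r r0 min_] := pole_minimum m0 f_meas f_ge0 sr s1 ci lap_gt0.
  exists r => // x xr; rewrite !FE pp0; apply: min_.
  rewrite xr andbT acos_ge0//; exact: dotp_unit_itv (sphere_unit _) (sphere_unit _).
move/eqP; rewrite mulf_eq0 (gt_eqF w0)/= => /eqP I0.
have m2 : (m <= 2)%N by [].
have far := vanishing_cap f_meas f_ge0 mu_radial sr (fun q qd => f0 q (cap q qd)).
have near0 : near_pole dl (meridian m 0).
  by apply: (near_pole_meridian _ dl01); case/andP: dl01 => dl0 _; rewrite lexx ltW.
have lap0 : (\int[sigma]_q (1 + m%:R * xcot (thead (\val q)))%:E = 0)%E.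
  (* [fine I = 0] would also hold for an infinite I; this is excluded because the Laplacian has a
     finite integral once the density vanishes near the antipode. *)
  have := integral_laplacian_halfsq m0 f_meas f_ge0 sr s1 dl01 far 1 near0.
  rewrite meridian0; under eq_integral do rewrite mul1r dotp_north.
  rewrite lapE; case: I I0 {lapE} => [r /= ->|_|_]; first by rewrite mule0.
    by rewrite gt0_muley.
  by rewrite gt0_muleNy.
have [r r0 max_] := pole_maximum m0 m2 f_meas f_ge0 sr s1 dl01 far lap0.
exists r => // x xr; rewrite !FE pp0; apply: max_.
rewrite xr andbT acos_ge0//; exact: dotp_unit_itv (sphere_unit _) (sphere_unit _).
Qed.
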